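(* Let $\mathbb K\in\{\mathbb R,\mathbb C\}$ and let $\theta\subset\Delta=\{\alpha_1,\dots,\alpha_{d-1}\}$ be symmetric. Suppose $\Gamma\subset\mathsf{PSL}(d,\mathbb K)$ is a non-elementary $\mathsf P_\theta$-transverse subgroup, $\phi\in\mathfrak a_\theta^*$ and $\delta^\phi(\Gamma)<+\infty$. If $G$ is a subgroup of $\Gamma$ such that $Q_G^\phi(\delta^\phi(G))=+\infty$ and $\Lambda_\theta(G)$ is a proper subset of $\Lambda_\theta(\Gamma)$, then $$\delta^\phi(\Gamma)>\delta^\phi(G).$$
   Context: $\mathfrak a=\{\mathrm{diag}(a_1,\dots,a_d): a_i\in\mathbb R,\ \sum a_i=0\}$. The Cartan projection of $g\in\mathsf{PSL}(d,\mathbb K)$ is $\kappa(g)=\mathrm{diag}(\log\sigma_1(g),\dots,\log\sigma_d(g))$, where $\sigma_1(g)\ge\dots\ge\sigma_d(g)$ are the singular values of a lift of $g$ to $\mathsf{SL}(d,\mathbb K)$. The simple roots are $\alpha_j(\mathrm{diag}(a_1,\dots,a_d))=a_j-a_{j+1}$, $\Delta=\{\alpha_1,\dots,\alpha_{d-1}\}$, with fundamental weights $\omega_{\alpha_j}(\mathrm{diag}(a_1,\dots,a_d))=a_1+\dots+a_j$. A subset $\theta\subset\Delta$ is symmetric if $\alpha_k\in\theta\iff\alpha_{d-k}\in\theta$. Set $\mathfrak a_\theta=\{\mathrm{diag}(a_1,\dots,a_d)\in\mathfrak a: a_j=a_{j+1}\text{ for all }\alpha_j\notin\theta\}$; the restrictions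 $\omega_\alpha|_{\mathfrak a_\theta}$, $\alpha\in\theta$, form a basis of $\mathfrak a_\theta^*$. The partial Cartan projection $\kappa_\theta:\mathsf{PSL}(d,\mathbb K)\to\mathfrak a_\theta$ is defined by $\omega_\alpha(\kappa_\theta(g))=\omega_\alpha(\kappa(g))$ for all $\alpha\in\theta$. $\mathcal F_\theta$ is the manifold of partial flags $F=(F^j)_{\alpha_j\in\theta}$ in $\mathbb K^d$ with $\dim F^j=j$ (nested). Flags $F,G\in\mathcal F_\theta$ are transverse if $F^j\oplus G^{d-j}=\mathbb K^d$ for all $\alpha_j\in\theta$. A subgroup $\Gamma$ is $\mathsf P_\theta$-divergent if $\min_{\alpha\in\theta}\alpha(\kappa(\gamma_n))\to+\infty$ for every sequence $\{\gamma_n\}$ of distinct elements of $\Gamma$. If $\alpha(\kappa(g))>0$ for all $\alpha\in\theta$, then $U_\theta(g)\in\mathcal F_\theta$ is the flag whose $j$-dimensional part is $k\langle e_1,\dots,e_j\rangle$, where $g=k\,e^{\kappa(g)}\,\ell$ is a singular value decomposition. For $\Gamma$ $\mathsf P_\theta$-divergent, the limit set $\Lambda_\theta(\Gamma)\subset\mathcal F_\theta$ is the set of limits of convergent sequences $U_\theta(\gamma_n)$ with $\gamma_n\in\Gamma$ distinct. $\Gamma$ is $\mathsf P_\theta$-transverse if it is $\mathsf P_\theta$-divergent and any two distinct flags in $\Lambda_\theta(\Gamma)$ are transverse; it is non-elementary if $\Lambda_\theta(\Gamma)$ is infinite. For a discrete subgroup $\Gamma$ and $\phi\in\mathfrak a_\theta^*$,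 $Q_\Gamma^\phi(s)=\sum_{\gamma\in\Gamma}e^{-s\phi(\kappa_\theta(\gamma))}$ and $\delta^\phi(\Gamma)=\inf\{s>0: Q_\Gamma^\phi(s)<+\infty\}\in[0,+\infty]$ is its critical exponent. *)

(* Defs.v *)
From HB Require Import structures.
From mathcomp Require Import all_boot all_order all_algebra.
From mathcomp Require Import all_classical all_reals all_analysis.
From mathcomp Require Import complex.

Set Implicit Arguments.
Unset Strict Implicit.
Unset Printing Implicit Defensive.

Import Order.TTheory GRing.Theory Num.Theory.
Import numFieldNormedType.Exports.

Local Open Scope classical_set_scope.
Local Open Scope quotient_scope.
Local Open Scope ring_scope.

Variant RC := RealNumbers | ComplexNumbers.

Definition RCfield (R : realType) (k : RC) : numFieldType :=
  match k with
  | RealNumbers => R : numFieldType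
  | ComplexNumbers => R[i] : numFieldType
  end.

Definition RCof_real (R : realType) (k : RC) : R -> RCfield R k :=
  match k with
  | RealNumbers => fun x => x
  | ComplexNumbers => fun x => real_complex R x
  end.

Definition RCconj (R : realType) (k : RC) : RCfield R k -> RCfield R k :=
  match k with
  | RealNumbers => fun x => x
  | ComplexNumbers => fun x => conjc x
  end.

(* PSL(d, K) is the quotient of SL(d, K) by its centre, i.e. by its scalar
   matrices. *)
Section ProjectiveSpecialLinear.
Variables (d : nat) (K : fieldType).

Record SL := MkSL { SL_mx :> 'M[K]_d ; SL_det : \det SL_mx == 1 }.

HB.instance Definition _ := [isSub for SL_mx].
HB.instance Definition _ := [Choice of SL by <:].

Lemma SL_unit (A : SL) : (A : 'M[K]_d) \in unitmx.
Proof. by rewrite unitmxE (eqP (SL_det A)) unitr1. Qed.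

Lemma SL_mul_det (A B : SL) : \det ((A : 'M[K]_d) *m B) == 1.
Proof. by rewrite det_mulmx !(eqP (SL_det _)) mulr1. Qed.

Lemma SL_inv_det (A : SL) : \det (invmx A) == 1.
Proof. by rewrite det_inv (eqP (SL_det _)) invr1. Qed.

Lemma SL_one_det : \det (1%:M : 'M[K]_d) == 1.
Proof. by rewrite det1. Qed.

Definition SL_mul (A B : SL) : SL := MkSL (SL_mul_det A B).
Definition SL_inv (A : SL) : SL := MkSL (SL_inv_det A).
Definition SL_one : SL := MkSL SL_one_det.

Definition central_rel (A B : SL) : bool := is_scalar_mx (A *m invmx B).

Lemma central_relP (A B : SL) :
  reflect (exists c : K, (A : 'M[K]_d) = c%:M *m B) (central_rel A B).
Proof.
apply: (iffP is_scalar_mxP) => -[c cE]; exists c.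
  by rewrite -cE mulmxKV // SL_unit.
by rewrite cE mulmxK // SL_unit.
Qed.

Lemma central_scalar_neq0 (A B : SL) (c : K) :
  (A : 'M[K]_d) = c%:M *m B -> d != 0 -> c != 0.
Proof.
move=> AE d0; apply/eqP => c0; have := SL_det A.
rewrite AE c0 mul_scalar_mx scale0r.
by case: (d) d0 => // n _; rewrite det0 eq_sym oner_eq0.
Qed.

Lemma central_rel_equiv : equiv_class_of central_rel.
Proof.
have sym A B : central_rel A B -> central_rel B A.
  move=> /central_relP[c AE]; apply/central_relP.
  have [d0|d0] := eqVneq d 0.
    by exists 1; apply/matrixP => i; have := ltn_ord i; rewrite {2}d0.
  exists c^-1; rewrite AE !mul_scalar_mx scalerA mulVf ?scale1r //.
  exact: central_scalar_neq0 AE d0.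
split.
- by move=> A; apply/central_relP; exists 1; rewrite mul1mx.
- by move=> A B; apply/idP/idP; exact: sym.
- move=> B A C /central_relP[a AE] /central_relP[b BE]; apply/central_relP.
  by exists (a * b); rewrite AE BE mulmxA scalar_mxM.
Qed.

Canonical central_equiv := EquivRelPack central_rel_equiv.
Canonical central_encModRel := defaultEncModRel central_rel.

Definition PSL : Type := {eq_quot central_rel}%qT.

HB.instance Definition _ := Choice.on PSL.
HB.instance Definition _ := EqQuotient.on PSL.

Lemma PSL_eqP (A B : SL) :
  (\pi_PSL A = \pi_PSL B) <-> exists c : K, (A : 'M[K]_d) = c%:M *m B.
Proof. by split=> [/eqmodP/central_relP|/central_relP/eqmodP]. Qed.

Definition PSL_mul (x y : PSL) : PSL := \pi_PSL (SL_mul (repr x) (repr y)).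
Definition PSL_inv (x : PSL) : PSL := \pi_PSL (SL_inv (repr x)).
Definition PSL_one : PSL := \pi_PSL SL_one.

Lemma repr_pi (A : SL) :
  exists c : K, (repr (\pi_PSL A) : 'M[K]_d) = c%:M *m A.
Proof. by apply/PSL_eqP; rewrite reprK. Qed.

Lemma pi_mul (A B : SL) :
  PSL_mul (\pi_PSL A) (\pi_PSL B) = \pi_PSL (SL_mul A B).
Proof.
have [a aE] := repr_pi A; have [b bE] := repr_pi B.
apply/PSL_eqP; exists (a * b); rewrite /= aE bE.
by rewrite !mul_scalar_mx -scalemxAl -scalemxAr scalerA.
Qed.

Lemma pi_inv_mul (A : SL) : PSL_mul (\pi_PSL (SL_inv A)) (\pi_PSL A) = PSL_one.
Proof.
by rewrite pi_mul; congr (\pi_PSL _); apply: val_inj; rewrite /= mulVmx ?SL_unit.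
Qed.

Lemma pi_mul_inv (A : SL) : PSL_mul (\pi_PSL A) (\pi_PSL (SL_inv A)) = PSL_one.
Proof.
by rewrite pi_mul; congr (\pi_PSL _); apply: val_inj; rewrite /= mulmxV ?SL_unit.
Qed.

Lemma PSL_ex (x : PSL) : exists A : SL, x = \pi_PSL A.
Proof. by exists (repr x); rewrite reprK. Qed.

Lemma PSL_mulA : associative PSL_mul.
Proof.
move=> x y z.
have [A ->] := PSL_ex x; have [B ->] := PSL_ex y; have [C ->] := PSL_ex z.
rewrite !pi_mul; congr (\pi_PSL _); apply: val_inj; exact: mulmxA.
Qed.

Lemma PSL_mul1 : left_id PSL_one PSL_mul.
Proof.
move=> x; have [A ->] := PSL_ex x; rewrite pi_mul.
congr (\pi_PSL _); apply: val_inj; exact: mul1mx.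
Qed.

Lemma PSL_mulr1 : right_id PSL_one PSL_mul.
Proof.
move=> x; have [A ->] := PSL_ex x; rewrite pi_mul.
congr (\pi_PSL _); apply: val_inj; exact: mulmx1.
Qed.

Lemma PSL_mulV : left_inverse PSL_one PSL_inv PSL_mul.
Proof. by move=> x; rewrite -{2}[x]reprK; exact: pi_inv_mul. Qed.

Lemma PSL_mulrV : right_inverse PSL_one PSL_inv PSL_mul.
Proof. by move=> x; rewrite -{1}[x]reprK; exact: pi_mul_inv. Qed.

HB.instance Definition _ := isGroup.Build PSL
  PSL_mulA PSL_mul1 PSL_mulr1 PSL_mulV PSL_mulrV.

End ProjectiveSpecialLinear.

Definition is_subgroup (gT : groupType) (H : set gT) : Prop :=
  group_closed [in H].

(* The simple root alpha_(j+1) is indexed by j : 'I_d.-1; in particular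
   alpha_(d-(j+1)) is indexed by rev_ord j. *)
Section CartanSpace.
Variables (R : realType) (d : nat).
Implicit Types (j : 'I_d.-1) (a : 'rV[R]_d) (theta : {set 'I_d.-1}).

Definition ord_cur j : 'I_d := widen_ord (leq_pred d) j.

Lemma ord_next_subproof j : (j.+1 < d)%N.
Proof. by rewrite -ltn_predRL. Qed.

Definition ord_next j : 'I_d := Ordinal (ord_next_subproof j).

Definition simple_root j a : R^o := a 0 (ord_cur j) - a 0 (ord_next j).

Definition fund_weight j a : R^o := \sum_(i < d | (i <= j)%N) a 0 i.

Definition coord_sum a : R^o := \sum_(i < d) a 0 i.

Definition symmetric_roots theta : Prop :=
  forall j, (j \in theta) = (rev_ord j \in theta).

Definition cartan_theta theta : {vspace 'rV[R]_d} :=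
  (lker (linfun coord_sum) :&:
     \bigcap_(j | j \notin theta) lker (linfun (simple_root j)))%VS.

Lemma coord_sum_linear : linear coord_sum.
Proof.
move=> c a b; rewrite /coord_sum scaler_sumr -big_split /=.
by apply: eq_bigr => i _; rewrite !mxE.
Qed.
HB.instance Definition _ :=
  GRing.isLinear.Build R 'rV[R]_d R^o *:%R coord_sum coord_sum_linear.

Lemma simple_root_linear j : linear (simple_root j).
Proof.
by move=> c a b; rewrite /simple_root !mxE scalerBr opprD addrACA.
Qed.
HB.instance Definition _ j :=
  GRing.isLinear.Build R 'rV[R]_d R^o *:%R (simple_root j)
    (simple_root_linear j).

Lemma mem_cartan_theta theta a :
  (a \in cartan_theta theta) =
  (\sum_(i < d) a 0 i == 0) &&
  [forall (j | j \notin theta), a 0 (ord_cur j) == a 0 (ord_next j)].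
Proof.
rewrite memv_cap memv_ker lfunE /=; congr (_ && _).
apply/subv_bigcapP/'forall_implyP => /= aE j jt; have := aE j jt.
  by rewrite -memvE memv_ker lfunE /= subr_eq0.
by rewrite -memvE memv_ker lfunE /= subr_eq0.
Qed.

End CartanSpace.

Section Flags.
Variables (d : nat) (K : numFieldType) (theta : {set 'I_d.-1}).

(* As for the roots, the index j stands for the subspace of dimension j+1. *)
Definition flag_index : Type := {j : 'I_d.-1 | j \in theta}.
HB.instance Definition _ := Finite.on flag_index.

Definition is_flag (F : {ffun flag_index -> {vspace 'cV[K]_d}}) : bool :=
  [forall i, \dim (F i) == (val i).+1] &&
  [forall i : flag_index, forall j : flag_index,
     (val i <= val j)%N ==> (F i <= F j)%VS].

Record flag := MkFlag {
  flag_fun :> {ffun flag_index -> {vspace 'cV[K]_d}};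
  flag_prop : is_flag flag_fun }.

HB.instance Definition _ := [isSub for flag_fun].
HB.instance Definition _ := [Choice of flag by <:].

(* The subspaces of index j and rev_ord j have complementary dimensions. *)
Definition transverse (F G : flag) : Prop :=
  forall i j : flag_index, val j = rev_ord (val i) ->
    (F i + G j)%VS = fullv /\ directv (F i + G j).

(* <e_0, ..., e_j> *)
Definition std_subspace (j : 'I_d.-1) : {vspace 'cV[K]_d} :=
  <<[seq delta_mx i ord0 | i : 'I_d <- enum 'I_d & (i <= j)%N]>>%VS.

(* k <e_0, ..., e_j>, with the matrix k replaced by 1 if it is singular *)
Definition frame_subspace (k : 'M[K]_d) (j : 'I_d.-1) : {vspace 'cV[K]_d} :=
  (linfun (mulmx (if k \in unitmx then k else 1%:M)) @: std_subspace j)%VS.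

Lemma std_subspaceS (i j : 'I_d.-1) :
  (i <= j)%N -> (std_subspace i <= std_subspace j)%VS.
Proof.
move=> ij; apply: sub_span => v /mapP[l]; rewrite mem_filter => /andP[li _] ->.
by apply: map_f; rewrite mem_filter (leq_trans li ij) mem_enum.
Qed.

Lemma dim_std_subspace (j : 'I_d.-1) : \dim (std_subspace j) = j.+1.
Proof.
pose e := [seq delta_mx i ord0 | i <- enum 'I_d] : seq 'cV[K]_d.
have e_full : <<e>>%VS = fullv.
  apply/eqP; rewrite eqEsubv subvf /=; apply/subvP => v _.
  rewrite (matrix_sum_delta v); apply: memv_suml => i _.
  apply: memv_suml => l _; rewrite ord1; apply/memvZ/memv_span/map_f.
  by rewrite mem_enum.
have e_free : free e.
  by rewrite /free e_full dimvf /dim /= size_map size_enum_ord muln1.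
have e_inj : injective (fun i : 'I_d => delta_mx i ord0 : 'cV[K]_d).
  move=> i l /matrixP/(_ i ord0); rewrite !mxE !eqxx /=.
  by case: eqP => // _ /eqP; rewrite oner_eq0.
have sub_free_e :
    free [seq delta_mx i ord0 : 'cV[K]_d | i : 'I_d <- enum 'I_d & (i <= j)%N].
  have -> : [seq delta_mx i ord0 : 'cV[K]_d | i : 'I_d <- enum 'I_d & (i <= j)%N]
      = [seq v <- e | [exists i : 'I_d, (i <= j)%N && (v == delta_mx i ord0)]].
    rewrite [RHS]filter_map; congr ([seq _ | _ <- _]); apply: eq_filter => i /=.
    apply/idP/existsP => [ij|[l /andP[lj /eqP/e_inj ->]]] //.
    by exists i; rewrite ij eqxx.
  exact: filter_free.
rewrite /std_subspace (eqP sub_free_e) size_map size_filter -sum1_count.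
rewrite big_enum_cond /=.
have jd : (j.+1 <= d)%N by exact: ltnW (ord_next_subproof j).
by rewrite -(big_ord_widen d (fun=> 1%N) jd) big_const_ord iter_addn_0 mul1n.
Qed.

Lemma frame_is_flag (k : 'M[K]_d) :
  is_flag [ffun j => frame_subspace k (val j)].
Proof.
rewrite /is_flag; apply/andP; split; apply/forallP => i.
  rewrite ffunE limg_dim_eq ?dim_std_subspace //.
  suff /eqP -> : lker (linfun (mulmx (if k \in unitmx then k else 1%:M)
      : 'cV[K]_d -> 'cV[K]_d)) == 0%VS by rewrite capv0.
  apply/lker0P => u v; rewrite !lfunE /=; apply: can_inj (mulKmx _) _ _.
  by case: ifP => // _; exact: unitmx1.
apply/forallP => j; apply/implyP => ij.
by rewrite !ffunE limgS // std_subspaceS.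
Qed.

Definition flag_of_frame (k : 'M[K]_d) : flag := MkFlag (frame_is_flag k).

(* The topology of the homogeneous space GL(d, K) / P_theta, i.e. the
   quotient topology for k |-> k F_0, where F_0 is the standard flag. *)
Definition flag_open (U : set flag) : Prop :=
  open [set k : 'M[K]_d | k \in unitmx /\ U (flag_of_frame k)].

Lemma continuous_det : continuous (fun k : 'M[K]_d => \det k : K).
Proof.
rewrite /determinant.
apply: (@continuous_big K _ +%R 0 predT) => [|s _ k].
  exact: add_continuous.
apply: (@cvgM K _ (nbhs k) (nbhs_filter k)); first exact: cvg_cst.
apply: (@continuous_big K _ *%R 1 predT _ 'M[K]_d) => [|i _].
  exact: mul_continuous.
exact: coord_continuous.
Qed.

Lemma flag_openT : flag_open setT.
Proof.
rewrite /flag_open (_ : [set k | _] =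
  (fun k : 'M[K]_d => \det k : K) @^-1` (~` [set 0])); last first.
  apply/seteqP; split=> k /=; rewrite unitmxE unitfE.
    by case=> /eqP.
  by move/eqP.
apply: open_comp => [k _|]; first exact: continuous_det.
by rewrite openC; apply: accessible_closed_set1; apply: hausdorff_accessible;
  exact: norm_hausdorff.
Qed.

Lemma flag_openI : setI_closed flag_open.
Proof.
move=> U V oU oV; rewrite /flag_open.
rewrite (_ : [set k | _] =
  [set k : 'M[K]_d | k \in unitmx /\ U (flag_of_frame k)] `&`
  [set k | k \in unitmx /\ V (flag_of_frame k)]); first exact: openI.
by apply/seteqP; split=> k /=; [case=> ku [Uk Vk] | case=> -[ku Uk] [_ Vk]].
Qed.

Lemma flag_open_bigU (I : Type) (f : I -> set flag) :
  (forall i, flag_open (f i)) -> flag_open (\bigcup_i f i).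
Proof.
move=> of_; rewrite /flag_open.
rewrite (_ : [set k | _] = \bigcup_i
  [set k : 'M[K]_d | k \in unitmx /\ f i (flag_of_frame k)]).
  by apply: bigcup_open => i _; exact: of_.
apply/seteqP; split=> k /=; first by case=> ku [i _ fk]; exists i.
by case=> i _ [ku fk]; split=> //; exists i.
Qed.

HB.instance Definition _ :=
  isOpenTopological.Build flag flag_openT flag_openI flag_open_bigU.

End Flags.

Section TransverseGroups.
Variables (R : realType) (k : RC) (d : nat) (theta : {set 'I_d.-1}).

Local Notation K := (RCfield R k).
Local Notation PSLK := (PSL d (RCfield R k)).
Implicit Types (g : PSLK) (Gamma : set PSLK).

Definition is_unitary (u : 'M[K]_d) : Prop :=
  u *m (map_mx (@RCconj R k) u)^T = 1%:M.

Definition is_svd (A : 'M[K]_d) (u : 'M[K]_d) (s : 'rV[R]_d) (v : 'M[K]_d) :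
    Prop :=
  [/\ is_unitary u, is_unitary v,
      (forall i, 0 <= s 0 i),
      (forall i j : 'I_d, (i <= j)%N -> s 0 j <= s 0 i) &
      A = u *m diag_mx (map_mx (@RCof_real R k) s) *m v].

(* The vector s of a singular value decomposition of A is unique. *)
Definition singular_values (A : 'M[K]_d) : 'rV[R]_d :=
  xget 0 [set s | exists u v, is_svd A u s v].

Definition cartan_proj g : 'rV[R]_d :=
  map_mx (@ln R) (singular_values (repr g)).

(* The fundamental weights indexed by theta restrict to a basis of the dual of
   cartan_theta, so exactly one x satisfies the condition. *)
Definition cartan_proj_theta g : subvs_of (cartan_theta R theta) :=
  xget 0 [set x | forall j, j \in theta ->
    fund_weight j (vsval x) = fund_weight j (cartan_proj g)].

(* Independent of the choices if alpha(cartan_proj g) > 0 for all alpha in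
   theta; in a divergent group this holds for all but finitely many g. *)
Definition U_theta g : flag K theta :=
  flag_of_frame theta
    (xget 1%:M [set u | exists s v, is_svd (repr g) u s v]).

Definition divergent Gamma : Prop :=
  forall gam : nat -> PSLK, injective gam -> (forall n, Gamma (gam n)) ->
    \big[mine/+oo%E]_(j in theta) (simple_root j (cartan_proj (gam n)))%:E
      @[n --> \oo] --> +oo%E.

Definition limit_set Gamma : set (flag K theta) :=
  [set F | exists gam : nat -> PSLK,
    [/\ injective gam, (forall n, Gamma (gam n)) &
        U_theta (gam n) @[n --> \oo] --> F]].

Definition transverse_group Gamma : Prop :=
  divergent Gamma /\
  (forall F G, limit_set Gamma F -> limit_set Gamma G -> F <> G ->
     transverse F G).

Definition non_elementary Gamma : Prop := infinite_set (limit_set Gamma).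

Variable phi : 'Hom(subvs_of (cartan_theta R theta), R^o).

Definition poincare_series Gamma (s : R) : \bar R :=
  (\esum_(g in Gamma) (expR (- s * phi (cartan_proj_theta g)))%:E)%E.

Definition critical_exponent Gamma : \bar R :=
  ereal_inf [set s%:E | s in
    [set s : R | 0 < s /\ (poincare_series Gamma s < +oo)%E]].

End TransverseGroups.

Arguments U_theta {R k d} theta g.
Arguments limit_set {R k d} theta Gamma.

(* Main.v *)
Require Import Defs.
From HB Require Import structures.
From mathcomp Require Import all_boot all_order all_algebra.
From mathcomp Require Import all_classical all_reals all_analysis.
From mathcomp Require Import perm complex zify ring lra.

(* Let om_i be the log of the norm of the minors of size i + 1 of a lift: it is
   subadditive and stays at bounded distance from the i-th fundamental weight of
   the Cartan projection.  If om_i (g gam) >= om_i g + om_i gam - M for all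
   g in G and i in theta, then phi (kappa_theta (g gam)) is, up to a constant, at
   most the sum of the values at g and gam.  Let A be the set of such gam in Gamma.
   A product h gam with h in G and both gam and h gam in A forces
   om_i h + om_i h^-1 <= 2 M, which happens for finitely many h only; hence
   Q_G(s) Q_A(s) <= C Q_Gamma(s).
   Up to a finite set, Gamma is covered by two translates of A, so that
   Q_Gamma(s) <= C' (1 + Q_A(s)).  Therefore Q_G(s) is bounded for all s slightly
   larger than the critical exponent of Gamma; if this were at most that of G,
   Fatou's lemma would contradict the divergence of Q_G at its critical exponent.
   The covering comes from the convergence dynamics.  By Cauchy-Binet, along an
   ultrafilter the rescaled minors of a sequence gamma_n tend to a rank one matrix
   x (x) v, where x is an attracting and v a repelling limit flag, and om_i is
   additive up to a constant on products whose intermediate flags are transverse.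
   Choose gamma_n with attracting flag in the limit set of Gamma but not of G;
   left multiplication by gamma_n, or by gamma_n h where h moves the repelling
   flag, then brings almost all of Gamma into A.  Such an h exists: if Gamma fixed
   a limit flag y, some h in Gamma would contract it; the powers of h would be
   attracted to another flag a, also fixed by Gamma, and every limit flag would
   be y or a. *)

Set Implicit Arguments.
Unset Strict Implicit.
Unset Printing Implicit Defensive.

Import Order.TTheory GRing.Theory Num.Theory.
Import numFieldNormedType.Exports.

Local Open Scope classical_set_scope.
Local Open Scope ring_scope.

Local Notation is_unitary := Defs.is_unitary.

(** * Scalars and ultrafilter limits *)

(** The coefficients of phi in the fundamental weights may have either sign, so subadditivity of
    om_i alone does not bound phi (kappa_theta (g gam)) from above. A lower bound on om_i (g gam)
    for every i in theta is needed as well, and it can fail when the repelling flag of g is not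
    transverse to the attracting flag of gam. A limit flag of Gamma that is not one of G is
    transverse to all repelling flags of sequences in G at once; this is what makes one constant M
    possible. The two inequalities then close up: where Q_Gamma(s) is finite and Q_G(s) is large,
    Q_A(s) is a small fraction of Q_Gamma(s), so the covering bounds Q_Gamma(s), hence Q_G(s), by
    the finitely many uncovered terms. Exterior powers appear as arrays of minors indexed by
    arbitrary functions, for which Cauchy-Binet is a matrix product up to a factorial. Ultrafilters
    replace the extraction of subsequences: every bounded sequence converges, and each property or
    its negation holds almost everywhere. *)

Section ScalarField.
Variables (R : realType) (k : RC).
Local Notation K := (RCfield R k).
Local Notation conj := (@RCconj R k).
Local Notation ofR := (@RCof_real R k).

(** The norm of [K] takes its values in [K] itself; a real-valued modulus lets one set of real
    estimates serve both fields. *)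
Definition rabs (x : K) : R :=
  match k return RCfield R k -> R with
  | RealNumbers => fun x => `|x|
  | ComplexNumbers => fun x => complex.Re `|x|
  end x.

Lemma RCconj_is_zmod_morphism : zmod_morphism conj.
Proof. by rewrite /RCconj; case: k => //= x y; exact: rmorphB. Qed.

Lemma RCconj_is_monoid_morphism : monoid_morphism conj.
Proof.
rewrite /RCconj; case: k => //=; split=> [|x y]; first exact: rmorph1.
exact: rmorphM.
Qed.
HB.instance Definition _ :=
  GRing.isZmodMorphism.Build K K conj RCconj_is_zmod_morphism.
HB.instance Definition _ :=
  GRing.isMonoidMorphism.Build K K conj RCconj_is_monoid_morphism.

Lemma RCof_real_is_zmod_morphism : zmod_morphism ofR.
Proof. by rewrite /RCof_real; case: k => //= x y; exact: rmorphB. Qed.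

Lemma RCof_real_is_monoid_morphism : monoid_morphism ofR.
Proof.
rewrite /RCof_real; case: k => //=; split=> [|x y]; first exact: rmorph1.
exact: rmorphM.
Qed.
HB.instance Definition _ :=
  GRing.isZmodMorphism.Build R K ofR RCof_real_is_zmod_morphism.
HB.instance Definition _ :=
  GRing.isMonoidMorphism.Build R K ofR RCof_real_is_monoid_morphism.

Lemma RCconjK : involutive conj.
Proof. by rewrite /RCconj; case: k => //=; exact: conjcK. Qed.

Lemma RCconj_ofR x : conj (ofR x) = ofR x.
Proof. by rewrite /RCconj /RCof_real; case: k => //=; exact: conjc_real. Qed.

Lemma normr_rabs (x : K) : `|x| = ofR (rabs x).
Proof. by move: x; rewrite /rabs /RCof_real; case: k. Qed.

Lemma ler_ofR : {mono ofR : x y / x <= y}.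
Proof. by rewrite /RCof_real; case: k => //= x y; exact: lecR. Qed.

Lemma ltr_ofR : {mono ofR : x y / x < y}.
Proof. by rewrite /RCof_real; case: k => //= x y; exact: ltcR. Qed.

Lemma ofR_inj : injective ofR.
Proof. exact: fmorph_inj. Qed.

Lemma gt0_ofR (e : K) : 0 < e -> exists2 r, 0 < r & e = ofR r.
Proof.
move=> e0; exists (rabs e); last by rewrite -normr_rabs gtr0_norm.
by rewrite -ltr_ofR -normr_rabs gtr0_norm // rmorph0.
Qed.

Lemma rabs_ge0 (x : K) : 0 <= rabs x.
Proof. by rewrite -ler_ofR rmorph0 -normr_rabs normr_ge0. Qed.

Lemma rabsM (x y : K) : rabs (x * y) = rabs x * rabs y.
Proof. by apply: ofR_inj; rewrite rmorphM /= -!normr_rabs normrM. Qed.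

Lemma rabs1 : rabs 1 = 1.
Proof. by apply: ofR_inj; rewrite -normr_rabs normr1 rmorph1. Qed.

Lemma rabs0 : rabs 0 = 0.
Proof. by apply: ofR_inj; rewrite -normr_rabs normr0 rmorph0. Qed.

Lemma rabsN (x : K) : rabs (- x) = rabs x.
Proof. by apply: ofR_inj; rewrite -!normr_rabs normrN. Qed.

Lemma rabsX (x : K) n : rabs (x ^+ n) = rabs x ^+ n.
Proof. by apply: ofR_inj; rewrite rmorphXn /= -!normr_rabs normrX. Qed.

Lemma rabs_ofR x : rabs (ofR x) = `|x|.
Proof.
rewrite /rabs /RCof_real; case: k => //=.
by rewrite expr0n addr0 sqrtr_sqr.
Qed.

Lemma rabs_eq0 (x : K) : (rabs x == 0) = (x == 0).
Proof. by rewrite -(inj_eq ofR_inj) -normr_rabs rmorph0 normr_eq0. Qed.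

Lemma rabs_gt0 (x : K) : (0 < rabs x) = (x != 0).
Proof. by rewrite lt_def rabs_eq0 rabs_ge0 andbT. Qed.

Lemma rabsD (x y : K) : rabs (x + y) <= rabs x + rabs y.
Proof. by rewrite -ler_ofR rmorphD /= -!normr_rabs ler_normD. Qed.

Lemma rabs_sum (I : Type) (r : seq I) (P : pred I) (F : I -> K) :
  rabs (\sum_(i <- r | P i) F i) <= \sum_(i <- r | P i) rabs (F i).
Proof.
elim/big_rec2: _ => [|i y x _ yx]; first by rewrite rabs0.
by apply: le_trans (rabsD _ _) _; rewrite lerD2l.
Qed.

Lemma rabs_prod (I : Type) (r : seq I) (P : pred I) (F : I -> K) :
  rabs (\prod_(i <- r | P i) F i) = \prod_(i <- r | P i) rabs (F i).
Proof. exact: (big_morph rabs rabsM rabs1). Qed.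

Lemma mul_conj (x : K) : x * conj x = ofR (rabs x ^+ 2).
Proof.
move: x; rewrite /rabs /RCconj /RCof_real; case: k => //= x.
  by rewrite -normrX ger0_norm ?sqr_ge0.
case: x => a b; rewrite /= sqr_sqrtr ?addr_ge0 ?sqr_ge0//.
by apply/eqP; rewrite eq_complex /=; apply/andP; split; apply/eqP; ring.
Qed.

Lemma rabs_conj (x : K) : rabs (conj x) = rabs x.
Proof.
apply/eqP; rewrite -(@eqrXn2 _ 2) ?rabs_ge0 //; apply/eqP/ofR_inj.
by rewrite -!mul_conj RCconjK mulrC.
Qed.

Lemma cvg_rabsP (T : Type) (F : set_system T) {FF : Filter F} (f : T -> K) l :
  f @ F --> l <-> forall e, 0 < e -> F [set t | rabs (l - f t) < e].
Proof.
split=> [/(@cvgrPdist_lt _ K) fl e e0|fl].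
  have := fl (ofR e); rewrite -(rmorph0 ofR) ltr_ofR => /(_ e0).
  by apply: filterS => t /=; rewrite normr_rabs ltr_ofR.
apply/(@cvgrPdist_lt _ K) => e /gt0_ofR[r r0 ->].
by apply: filterS (fl r r0) => t /=; rewrite normr_rabs ltr_ofR.
Qed.

Lemma cvg_rabs (T : Type) (F : set_system T) {FF : Filter F} (f : T -> K) l :
  f @ F --> l -> (fun t => rabs (f t)) @ F --> rabs l.
Proof.
move=> /cvg_rabsP fl; apply/(@cvgrPdist_lt _ R) => e e0.
apply: filterS (fl e e0) => t /=; apply: le_lt_trans.
rewrite ler_norml; apply/andP; split; last first.
  by rewrite lerBlDr; apply: le_trans (rabsD _ _); rewrite subrK.
rewrite lerNl opprB lerBlDr -[X in X + _]rabsN opprB.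
by apply: le_trans (rabsD _ _); rewrite subrK.
Qed.

End ScalarField.

Section UltraLimits.
Variables (T : Type) (F : set_system T) (UF : UltraFilter F).

Lemma ultraN (A : set T) : ~ F A -> F (~` A).
Proof. by case: (in_ultra_setVsetC A UF). Qed.

Lemma ultra_finite_exists (I : finType) (A : I -> set T) :
  F [set t | exists i, A i t] -> exists i, F (A i).
Proof.
move=> FA; apply: contrapT => nA.
suff [t [[i Ait] nAt]] : [set t | exists i, A i t] `&`
    [set t | forall i, (~` A i) t] !=set0 by exact: nAt Ait.
apply: (@filter_ex _ F); apply: filterI => //.
have FN i : F (~` A i) by apply: ultraN => FAi; apply: nA; exists i.
exact: (filter_forall _ FN).
Qed.

(** The limit is the supremum of the numbers that are almost everywhere lower bounds of [f]. The
    ultrafilter decides for each number whether it is one. *)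
Lemma ultra_cvgR (R : realType) (f : T -> R) (B : R) :
  F [set t | `|f t| <= B] -> exists l : R, f @ F --> l.
Proof.
move=> FB; pose S := [set x : R | F [set t | x <= f t]].
have SB : S (- B) by apply: filterS FB => t /=; rewrite ler_norml => /andP[].
have ubS : ubound S B.
  move=> x Sx; have [t [/= xf]] := filter_ex (filterI Sx FB).
  by rewrite ler_norml => /andP[_]; exact: le_trans.
have hS : has_sup S by split; [exists (- B)|exists B].
exists (sup S); apply/(@cvgrPdist_lt _ R) => e e0.
have [x Sx xe] := sup_adherent e0 hS.
have nS : F (~` [set t | sup S + e / 2 <= f t]).
  apply: ultraN => Se; have := sup_ubound hS.2 Se.
  by apply/negP; rewrite -ltNge ltrDl divr_gt0.
apply: filterS (filterI Sx nS) => t [/= xf /negP]; rewrite -ltNge => fe.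
rewrite ltr_norml; lra.
Qed.

Lemma ultra_cvgK (R : realType) (k : RC) (f : T -> RCfield R k) (B : R) :
  F [set t | rabs (f t) <= B] -> exists l : RCfield R k, f @ F --> l.
Proof.
case: k f => /= f FB; first exact: ultra_cvgR FB.
have reB (z : R[i]) : `|complex.Re z| <= complex.Re `|z|.
  by rewrite normc_def /= -sqrtr_sqr ler_sqrt ?addr_ge0 ?sqr_ge0// lerDl sqr_ge0.
have imB (z : R[i]) : `|complex.Im z| <= complex.Re `|z|.
  by rewrite normc_def /= -sqrtr_sqr ler_sqrt ?addr_ge0 ?sqr_ge0// lerDr sqr_ge0.
have [|a fa] := @ultra_cvgR R (fun t => complex.Re (f t)) B.
  by apply: filterS FB => t /=; apply: le_trans.
have [|b fb] := @ultra_cvgR R (fun t => complex.Im (f t)) B.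
  by apply: filterS FB => t /=; apply: le_trans.
exists (a +i* b)%C; apply/(@cvg_rabsP R ComplexNumbers) => e e0.
have e2 : 0 < e / 2 by rewrite divr_gt0.
move/(@cvgrPdist_lt _ R) : fa => /(_ _ e2) fa.
move/(@cvgrPdist_lt _ R) : fb => /(_ _ e2) fb.
apply: filterS (filterI fa fb) => t /= [{}fa {}fb].
rewrite (_ : _ - _ = (a - complex.Re (f t))%:C%C +
    'i%C * (b - complex.Im (f t))%:C%C); last first.
  case: (f t) => x y; apply/eqP; rewrite eq_complex /=.
  by apply/andP; split; apply/eqP; ring.
apply: (le_lt_trans (@rabsD R ComplexNumbers (a - complex.Re (f t))%:C%C
  ('i%C * (b - complex.Im (f t))%:C%C))).
rewrite (@rabsM R ComplexNumbers) !(@rabs_ofR R ComplexNumbers).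
have -> : @rabs R ComplexNumbers 'i%C = 1.
  by rewrite /rabs normc_def /= expr0n add0r expr1n sqrtr1.
by rewrite mul1r; lra.
Qed.

End UltraLimits.

Arguments rabs : simpl never.
Arguments RCconj : simpl never.
Arguments RCof_real : simpl never.

Lemma ultra_nat_exists :
  exists F : set_system nat, UltraFilter F /\ \oo `<=` F.
Proof. exact: ultraFilterLemma. Qed.

Section BigLimits.
Context (T : Type) (F : set_system T) {FF : Filter F}.
Variables (L : numFieldType) (I : Type) (f : I -> T -> L) (l : I -> L).
Hypothesis fl : forall i, f i @ F --> l i.

Lemma cvg_bigsum (r : seq I) :
  (fun t => \sum_(i <- r) f i t) @ F --> \sum_(i <- r) l i.
Proof.
elim: r => [|i r IH].
  by rewrite big_nil; under eq_fun do rewrite big_nil; exact: cvg_cst.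
by rewrite big_cons; under eq_fun do rewrite big_cons; apply: cvgD.
Qed.

Lemma cvg_bigprod (r : seq I) :
  (fun t => \prod_(i <- r) f i t) @ F --> \prod_(i <- r) l i.
Proof.
elim: r => [|i r IH].
  by rewrite big_nil; under eq_fun do rewrite big_nil; exact: cvg_cst.
by rewrite big_cons; under eq_fun do rewrite big_cons; apply: cvgM.
Qed.

End BigLimits.

Section MatrixLimits.
Context (T : Type) (F : set_system T) {FF : Filter F}.
Variables (R : realType) (k : RC).
Local Notation K := (RCfield R k).
Local Notation conj := (@RCconj R k).

(** Entrywise convergence reduces limits of products and determinants to limits of scalars;
    [mcvg_nbhs] and [mcvg_id] relate it to the topology of matrices. *)
Definition mcvg m n (A : T -> 'M[K]_(m, n)) (B : 'M[K]_(m, n)) : Prop :=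
  forall i j, (fun t => A t i j) @ F --> B i j.

Lemma mcvg_cst m n (A : 'M[K]_(m, n)) : mcvg (fun=> A) A.
Proof. by move=> i j; exact: cvg_cst. Qed.

Lemma mcvg_mul m n p (A : T -> 'M[K]_(m, n)) (B : T -> 'M[K]_(n, p)) A' B' :
  mcvg A A' -> mcvg B B' -> mcvg (fun t => A t *m B t) (A' *m B').
Proof.
move=> cA cB i j; rewrite mxE; under eq_fun do rewrite mxE.
by apply: cvg_bigsum => l; apply: cvgM; [exact: cA|exact: cB].
Qed.

Lemma mcvg_sub m n p q f g (A : T -> 'M[K]_(m, n)) A' :
  mcvg A A' -> mcvg (fun t => mxsub f g (A t) : 'M[K]_(p, q)) (mxsub f g A').
Proof. by move=> cA i j; rewrite mxE; under eq_fun do rewrite mxE; exact: cA. Qed.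

Lemma cvg_det n (A : T -> 'M[K]_n) A' :
  mcvg A A' -> (fun t => \det (A t)) @ F --> \det A'.
Proof.
move=> cA; apply: cvg_bigsum => s; apply: cvgM; first exact: cvg_cst.
by apply: cvg_bigprod => i; exact: cA.
Qed.

Lemma cvg_conj (f : T -> K) (l : K) : f @ F --> l -> (fun t => conj (f t)) @ F --> conj l.
Proof.
move=> /cvg_rabsP fl; apply/cvg_rabsP => e /fl; apply: filterS => t /=.
by rewrite -rmorphB /= rabs_conj.
Qed.

End MatrixLimits.

Lemma cvgK_unique (T : Type) (F : set_system T) {FF : ProperFilter F}
    (R : realType) (k : RC) (f : T -> RCfield R k) (a b : RCfield R k) :
  f @ F --> a -> f @ F --> b -> a = b.
Proof. by move=> fa fb; apply: (cvg_unique (@norm_hausdorff _ _) fa fb). Qed.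

(** * Singular value decomposition *)

Section SingularValueDecomposition.
Variables (R : realType) (k : RC).
Local Notation K := (RCfield R k).
Local Notation conj := (@RCconj R k).
Local Notation ofR := (@RCof_real R k).

Definition adjoint m n (A : 'M[K]_(m, n)) : 'M[K]_(n, m) := (map_mx conj A)^T.

Lemma adjointE m n (A : 'M[K]_(m, n)) i j : adjoint A i j = conj (A j i).
Proof. by rewrite !mxE. Qed.

Lemma adjointK m n : cancel (@adjoint m n) (@adjoint n m).
Proof. by move=> A; apply/matrixP => i j; rewrite !mxE RCconjK. Qed.

Lemma adjointM m n p (A : 'M[K]_(m, n)) (B : 'M[K]_(n, p)) :
  adjoint (A *m B) = adjoint B *m adjoint A.
Proof. by rewrite /adjoint map_mxM trmx_mul. Qed.

Lemma adjoint1 n : adjoint (1%:M : 'M[K]_n) = 1%:M.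
Proof. by rewrite /adjoint map_mx1 trmx1. Qed.

Lemma adjoint_diag n (s : 'rV[R]_n) :
  adjoint (diag_mx (map_mx ofR s)) = diag_mx (map_mx ofR s).
Proof.
apply/matrixP => i j; rewrite !mxE eq_sym.
by case: eqP => [->|_]; rewrite ?mulr1n ?mulr0n ?RCconj_ofR ?rmorph0.
Qed.

Variable d : nat.
Implicit Types (A u v p : 'M[K]_d).

Lemma unitaryP u : is_unitary u <-> u *m adjoint u = 1%:M.
Proof. by []. Qed.

Lemma unitary_adj u : is_unitary u -> adjoint u *m u = 1%:M.
Proof. by move=> /mulmx1C. Qed.

Lemma unitary_unitmx u : is_unitary u -> u \in unitmx.
Proof. by case/mulmx1_unit. Qed.

Lemma unitary_inv u : is_unitary u -> invmx u = adjoint u.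
Proof.
move=> uu; have uU := unitary_unitmx uu.
by rewrite -[LHS]mulmx1 -(unitaryP u).1 // mulKmx.
Qed.

Lemma unitary_adjoint u : is_unitary u -> is_unitary (adjoint u).
Proof. by move=> uu; apply/unitaryP; rewrite adjointK unitary_adj. Qed.

Lemma unitary_mul u v : is_unitary u -> is_unitary v -> is_unitary (u *m v).
Proof.
move=> /unitaryP uu /unitaryP vv; apply/unitaryP.
by rewrite adjointM mulmxA -(mulmxA u) vv mulmx1.
Qed.

Lemma unitary1 : is_unitary (1%:M : 'M[K]_d).
Proof. by apply/unitaryP; rewrite adjoint1 mulmx1. Qed.

Lemma unitary_rabs_le1 u i j : is_unitary u -> rabs (u i j) <= 1.
Proof.
move=> /unitaryP/matrixP/(_ i i); rewrite !mxE eqxx.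
under eq_bigr do rewrite adjointE mul_conj.
rewrite -rmorph_sum -(rmorph1 ofR) => /ofR_inj uE.
rewrite -(@expr_le1 _ 2) ?rabs_ge0 //.
by rewrite -uE (bigD1 j) //= lerDl sumr_ge0 // => l _; rewrite sqr_ge0.
Qed.

(** Compactness of the unitary group: the entries are bounded by 1, and the defining equation passes
    to the limit. *)
Lemma unitary_ultra_lim (T : Type) (F : set_system T) (UF : UltraFilter F)
    (u : T -> 'M[K]_d) :
  (forall t, is_unitary (u t)) -> exists2 l, is_unitary l & mcvg F u l.
Proof.
move=> uu.
have cu i j : exists l : K, (fun t => u t i j) @ F --> l.
  apply: (@ultra_cvgK _ _ _ _ _ _ 1).
  by apply: filterE => t; exact: unitary_rabs_le1.
pose l i j := projT1 (cid (cu i j)).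
have lP i j : (fun t => u t i j) @ F --> l i j by rewrite /l; case: cid.
pose L : 'M[K]_d := \matrix_(i, j) l i j.
have cL : mcvg F u L by move=> i j; rewrite mxE; exact: lP.
exists L => //; apply/unitaryP.
have cLL : mcvg F (fun t => u t *m adjoint (u t)) (L *m adjoint L).
  apply: mcvg_mul => // i j; rewrite adjointE; under eq_fun do rewrite adjointE.
  by apply: cvg_conj; exact: cL.
apply/matrixP => i j; have := cLL i j.
under eq_fun do rewrite (unitaryP _).1 //.
by move=> c1; apply: (cvgK_unique c1); exact: cvg_cst.
Qed.

(** A rotation in the plane of the coordinates [a] and [b], with [t] in the role of the tangent of
    the angle and [n] of the normalizing factor sqrt(1 + |t|^2). *)
Definition givens (a b : 'I_d) (t : K) (n : R) : 'M[K]_d :=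
  \matrix_(i, j)
    if j == a then (if i == a then 1 else if i == b then t else 0) / ofR n
    else if j == b then (if i == b then 1 else if i == a then - conj t else 0)
      / ofR n
    else (i == j)%:R.

Lemma sum_givens_a (a b : 'I_d) t n (f : 'I_d -> K) : a != b ->
  \sum_i f i * givens a b t n i a = (f a + f b * t) / ofR n.
Proof.
move=> ab; have ba : (b == a) = false by rewrite eq_sym (negPf ab).
rewrite (bigD1 a) //= (bigD1 b) 1?eq_sym //= big1 => [|i].
  by rewrite !mxE !eqxx ba addr0 mul1r mulrDl mulrA.
by case/andP=> /negPf ia /negPf ib; rewrite mxE eqxx ia ib mul0r mulr0.
Qed.

Lemma sum_givens_b (a b : 'I_d) t n (f : 'I_d -> K) : a != b ->
  \sum_i f i * givens a b t n i b = (f b - f a * conj t) / ofR n.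
Proof.
move=> ab; have ba : (b == a) = false by rewrite eq_sym (negPf ab).
rewrite (bigD1 a) //= (bigD1 b) 1?eq_sym //= big1 => [|i].
  by rewrite !mxE !eqxx ba (negPf ab) addr0 mul1r mulrBl !mulNr mulrN mulrA addrC.
by case/andP=> /negPf ia /negPf ib; rewrite mxE eqxx ba ia ib mul0r mulr0.
Qed.

Lemma sum_givens_c (a b c : 'I_d) t n (f : 'I_d -> K) : c != a -> c != b ->
  \sum_i f i * givens a b t n i c = f c.
Proof.
move=> ca cb; rewrite (bigD1 c) //= big1 => [|i ic].
  by rewrite mxE (negPf ca) (negPf cb) eqxx mulr1 addr0.
by rewrite mxE (negPf ca) (negPf cb) (negPf ic) mulr0.
Qed.

Lemma givens_unitary (a b : 'I_d) t n : a != b -> 0 < n ->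
  n ^+ 2 = 1 + rabs t ^+ 2 -> is_unitary (givens a b t n).
Proof.
move=> ab n0 nE; set g := givens a b t n.
rewrite -[g]adjointK; apply/unitary_adjoint/unitaryP; rewrite adjointK.
have nN0 : ofR n != 0 by rewrite fmorph_eq0 gt_eqF.
have nE' : ofR n * ofR n = 1 + t * conj t.
  by rewrite mul_conj -rmorphM -expr2 nE rmorphD rmorph1.
have cn x : conj (x / ofR n) = conj x / ofR n by rewrite rmorphM fmorphV /= RCconj_ofR.
apply/matrixP => i j; rewrite !mxE.
under eq_bigr do rewrite adjointE.
have ba : b != a by rewrite eq_sym.
have [->|ja] := eqVneq j a; [|have [->|jb] := eqVneq j b].
- rewrite (sum_givens_a t n (fun l => conj (g l i)) ab) !mxE !eqxx (negPf ab).
  rewrite (negPf ba).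
  have [_|ia] := eqVneq i a; [|have [_|ib] := eqVneq i b] => /=.
  + rewrite !cn rmorph1 mulrAC -mulrDl -mulrA -invfM nE' (mulrC (conj t)).
    by rewrite divff // -nE' mulf_neq0.
  + rewrite !cn rmorph1 rmorphN /= RCconjK.
    by rewrite mul1r mulNr (mulrC _ t) addNr mul0r.
  + by rewrite rmorph0 mul0r addr0 mul0r.
- rewrite (sum_givens_b t n (fun l => conj (g l i)) ab) !mxE !eqxx (negPf ab).
  rewrite (negPf ba).
  have [->|ia] := eqVneq i a; [|have [_|ib] := eqVneq i b] => /=.
  + rewrite (negPf ab) !cn rmorph1.
    by rewrite mul1r (mulrC _ (conj t)) subrr mul0r.
  + rewrite !cn rmorph1 rmorphN /= RCconjK.
    rewrite mulrAC -mulrBl -mulrA -invfM nE' mulNr opprK.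
    by rewrite divff // -nE' mulf_neq0.
  + by rewrite rmorph0 mul0r subr0 mul0r.
- rewrite (sum_givens_c t n (fun l => conj (g l i)) ja jb) mxE.
  have [->|ia] := eqVneq i a; [|have [->|ib] := eqVneq i b] => /=.
  + by rewrite (negPf ja) (negPf jb) mul0r rmorph0 eq_sym (negPf ja).
  + by rewrite ?(negPf ba) (negPf jb) (negPf ja) mul0r rmorph0 eq_sym (negPf jb).
  + by rewrite eq_sym; case: eqP => _; rewrite ?rmorph1 ?rmorph0.
Qed.

Definition col_sqnorm (B : 'M[K]_d) (i : 'I_d) : R := \sum_l rabs (B l i) ^+ 2.

Lemma col_sqnormE (B : 'M[K]_d) i :
  ofR (col_sqnorm B i) = \sum_l B l i * conj (B l i).
Proof. by rewrite rmorph_sum; apply: eq_bigr => l _; rewrite mul_conj. Qed.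

End SingularValueDecomposition.

Section SVDExistence.
Variables (R : realType) (k : RC) (d : nat).
Local Notation K := (RCfield R k).
Local Notation conj := (@RCconj R k).
Local Notation ofR := (@RCof_real R k).
Implicit Types (A B u v p : 'M[K]_d).

Lemma col_sqnorm_givens B (a b : 'I_d) t n (z := \sum_l B l b * conj (B l a)) :
  a != b -> 0 < n ->
  let B' := B *m givens a b t n in
  [/\ ofR (n ^+ 2 * col_sqnorm B' a) = ofR (col_sqnorm B a) +
        (t * z + conj (t * z)) + ofR (rabs t ^+ 2 * col_sqnorm B b),
      ofR (n ^+ 2 * col_sqnorm B' b) = ofR (col_sqnorm B b) -
        (t * z + conj (t * z)) + ofR (rabs t ^+ 2 * col_sqnorm B a) &
      forall c, c != a -> c != b -> col_sqnorm B' c = col_sqnorm B c].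
Proof.
move=> ab n0 B'.
have nN0 : ofR n != 0 by rewrite fmorph_eq0 gt_eqF.
have zc : conj z = \sum_l B l a * conj (B l b).
  rewrite rmorph_sum; apply: eq_bigr => l _.
  by rewrite rmorphM /= RCconjK mulrC.
have cn x : ofR (n ^+ 2) * (x / ofR n * conj (x / ofR n)) = x * conj x.
  rewrite [conj (x / _)]rmorphM fmorphV /= RCconj_ofR mulrACA -invfM.
  by rewrite -rmorphM /= -expr2 mulrC divfK // fmorph_eq0 expf_neq0 // gt_eqF.
move: (n ^+ 2) cn (rabs t ^+ 2) (mul_conj t) => N cn T tE.
split.
- rewrite !rmorphM /= !col_sqnormE -tE zc -[in RHS]/z mulr_sumr.
  rewrite /z !mulr_sumr -!big_split /=; apply: eq_bigr => l _.
  rewrite mxE (sum_givens_a t n (fun i => B l i) ab) cn rmorphD rmorphM /=.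
  by ring.
- rewrite !rmorphM /= !col_sqnormE -tE zc -[in RHS]/z mulr_sumr.
  rewrite /z !mulr_sumr -big_split /= -sumrB -big_split /=.
  apply: eq_bigr => l _.
  rewrite mxE (sum_givens_b t n (fun i => B l i) ab) cn rmorphB rmorphM /= RCconjK.
  by ring.
- move=> c ca cb; apply: eq_bigr => l _.
  by rewrite mxE (sum_givens_c t n (fun i => B l i) ca cb).
Qed.

(* The weights decrease strictly, so that a maximizer over the unitary group
   both orthogonalizes the columns and sorts their norms. *)
Definition weighted_sqnorm B : R := \sum_(i < d) (d - i)%:R * col_sqnorm B i.

Lemma weighted_sqnorm_cvg (T : Type) (F : set_system T) (FF : Filter F)
    (B : T -> 'M[K]_d) B' :
  mcvg F B B' -> (fun t => weighted_sqnorm (B t)) @ F --> weighted_sqnorm B'.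
Proof.
move=> cB.
apply: cvg_bigsum => i; apply: cvgM; first exact: cvg_cst.
apply: cvg_bigsum => l; under eq_fun do rewrite expr2; rewrite expr2.
by apply: cvgM; apply: cvg_rabs; exact: cB.
Qed.

(** An ultrafilter limit of a maximizing sequence is a maximizer, by compactness of the unitary
    group and continuity of the functional. *)
Lemma unitary_maximizer A : exists2 p, is_unitary p &
  forall q, is_unitary q -> weighted_sqnorm (A *m q) <= weighted_sqnorm (A *m p).
Proof.
pose S := [set weighted_sqnorm (A *m q) | q in [set q | is_unitary q]].
have S1 : S (weighted_sqnorm (A *m 1%:M)) by exists 1%:M => //; exact: unitary1.
have Sub : has_ubound S.
  pose M := \sum_(i < d) (d - i)%:R * \sum_(l < d) (\sum_(j < d) rabs (A l j)) ^+ 2.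
  exists M => _ [q qq <-]; apply: ler_sum => i _; apply: ler_wpM2l => //.
  apply: ler_sum => l _; rewrite ler_pXn2r ?nnegrE ?rabs_ge0 ?sumr_ge0//; last first.
    by move=> j _; exact: rabs_ge0.
  rewrite mxE; apply: le_trans (rabs_sum _ _ _) _; apply: ler_sum => j _.
  by rewrite rabsM ler_piMr ?rabs_ge0 ?unitary_rabs_le1.
have hS : has_sup S by split => //; exists (weighted_sqnorm (A *m 1%:M)).
have qex n : exists q, is_unitary q /\
    sup S - n.+1%:R^-1 < weighted_sqnorm (A *m q).
  have n0 : 0 < n.+1%:R^-1 :> R by rewrite invr_gt0.
  have [_ [q qq <-] qS] := sup_adherent n0 hS.
  by exists q.
pose q n := projT1 (cid (qex n)).
have qP n : is_unitary (q n) /\ sup S - n.+1%:R^-1 < weighted_sqnorm (A *m q n).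
  by rewrite /q; case: cid.
have [F [UF ooF]] := ultra_nat_exists.
have [p pp qp] := unitary_ultra_lim UF (fun n => (qP n).1).
exists p => // q' qq'.
have c1 : (fun n => weighted_sqnorm (A *m q n)) @ F --> weighted_sqnorm (A *m p).
  by apply: weighted_sqnorm_cvg; apply: mcvg_mul => //; exact: mcvg_cst.
apply: (@le_trans _ _ (sup S)); first by apply: sup_ubound => //; exists q'.
apply/ler_addgt0Pr => e e0.
have Fe : F [set n | n.+1%:R^-1 < e].
  apply: ooF; have := near_infty_natSinv_lt (PosNum e0); by apply.
move/(@cvgrPdist_lt _ R) : c1 => /(_ _ e0) c1.
have ce : F [set n | weighted_sqnorm (A *m q n) < weighted_sqnorm (A *m p) + e].
  by apply: filterS c1 => n /=; rewrite ltr_norml => /andP[]; lra.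
suff : forall e', 0 < e' -> sup S <= weighted_sqnorm (A *m p) + e + e'.
  by move=> H; apply/ler_addgt0Pr.
move=> e' e'0.
have Fe' : F [set n | n.+1%:R^-1 < e'].
  by apply: ooF; have := near_infty_natSinv_lt (PosNum e'0); apply.
have [n [/= h1 h2]] := @filter_ex _ F _ _ (filterI Fe' ce).
by move: (qP n).2; move: (_^-1) h1 => x h1; lra.
Qed.

Lemma maximizer_orthogonal A p : is_unitary p ->
  (forall q, is_unitary q -> weighted_sqnorm (A *m q) <= weighted_sqnorm (A *m p)) ->
  forall a b : 'I_d, (a < b)%N ->
  \sum_l (A *m p) l b * conj ((A *m p) l a) = 0 /\
  col_sqnorm (A *m p) b <= col_sqnorm (A *m p) a.
Proof.
move=> pp pmax a b ab; set B := A *m p; set z := \sum_l _.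
have aDb : a != b by rewrite -val_eqE ltn_eqF.
set qa := col_sqnorm B a; set qb := col_sqnorm B b.
(* Rotating columns a and b of B by a Givens matrix does not increase the
   functional; the part linear in t is the first variation. *)
have key t r : t * z + conj (t * z) = ofR r -> r + rabs t ^+ 2 * (qb - qa) <= 0.
  move=> tzE; pose n := Num.sqrt (1 + rabs t ^+ 2).
  have n2 : n ^+ 2 = 1 + rabs t ^+ 2 by rewrite sqr_sqrtr // addr_ge0 ?sqr_ge0.
  have n0 : 0 < n by rewrite sqrtr_gt0 ltr_pwDl ?sqr_ge0.
  have [] := col_sqnorm_givens B t aDb n0.
  rewrite -/z tzE -/qa -/qb; set B' := B *m _ => qa' qb' qc.
  have {}qa' : n ^+ 2 * col_sqnorm B' a = qa + r + rabs t ^+ 2 * qb.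
    by apply: (@ofR_inj R k); rewrite qa' !rmorphD.
  have {}qb' : n ^+ 2 * col_sqnorm B' b = qb - r + rabs t ^+ 2 * qa.
    by apply: (@ofR_inj R k); rewrite qb' rmorphD rmorphB.
  have := pmax (p *m givens a b t n) (unitary_mul pp (givens_unitary aDb n0 n2)).
  rewrite mulmxA -/B -/B' /weighted_sqnorm.
  rewrite (bigD1 a) //= (bigD1 b) 1?eq_sym //= [leRHS](bigD1 a) //=.
  rewrite [X in _ <= _ + X](bigD1 b) 1?eq_sym //= -/qa -/qb.
  rewrite (eq_bigr (fun i : 'I_d => (d - i)%:R * col_sqnorm B i)); last first.
    by move=> i /andP[ia ib]; rewrite qc.
  rewrite !addrA lerD2r.
  have wab : (d - b)%:R + 1 <= (d - a)%:R :> R.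
    by rewrite natr1 ler_nat ltn_sub2l.
  move: wab; set wa : R := (d - a)%N%:R; set wb : R := (d - b)%N%:R => wab.
  have n20 : 0 <= n ^+ 2 by rewrite sqr_ge0.
  move=> /(ler_wpM2l n20); rewrite mulrDr mulrCA qa' (mulrCA _ wb) qb' n2 => H.
  have : (wa - wb) * (r + rabs t ^+ 2 * (qb - qa)) <= 0 by lra.
  by rewrite pmulr_rle0 //; lra.
have z0 : z = 0.
  apply/eqP/negPn/negP => zN0.
  have Z0 : 0 < rabs z ^+ 2 by rewrite exprn_gt0 // rabs_gt0.
  (* With t = e conj(z) the first variation is 2 e |z|^2. This [e] is small enough for the
     second-order term to take away at most half of it. *)
  pose e := (1 + `|qb - qa|)^-1.
  have e0 : 0 < e by rewrite invr_gt0 ltr_pwDl.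
  have : ofR e * conj z * z + conj (ofR e * conj z * z) =
      ofR (2 * e * rabs z ^+ 2).
    rewrite -mulrA (mulrC _ z) mul_conj -rmorphM RCconj_ofR -rmorphD.
    by congr ofR; ring.
  move=> /key; rewrite rabsM rabs_conj rabs_ofR (gtr0_norm e0).
  have -> : 2 * e * rabs z ^+ 2 + (e * rabs z) ^+ 2 * (qb - qa) =
     (e * rabs z ^+ 2) * (2 + e * (qb - qa)) by ring.
  rewrite pmulr_rle0 ?(mulr_gt0 e0) // => H.
  have : `|e * (qb - qa)| <= 1.
    by rewrite normrM gtr0_norm // ler_pdivrMl ?mulr1 ?lerDr ?ltr_pwDl.
  by rewrite ler_norml => /andP[]; lra.
split => //.
(* Once z = 0 the first variation vanishes for every t, and t = 1 leaves the comparison of the two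
   column norms. *)
have := key 1 0; rewrite z0 mulr0 rmorph0 addr0 rmorph0 rabs1 => /(_ erefl).
by lra.
Qed.

(** For a maximizer p the columns of A p are orthogonal with nonincreasing norms. These norms are
    the singular values, the normalized columns form u, and v is the adjoint of p. *)
Lemma svd_exists A : A \in unitmx -> exists u s v, is_svd A u s v.
Proof.
move=> AU; have [p pp pmax] := unitary_maximizer A.
have orth := maximizer_orthogonal pp pmax.
set B := A *m p in orth.
have BU : B \in unitmx by rewrite unitmx_mul AU unitary_unitmx.
have q0 i : 0 < col_sqnorm B i.
  rewrite lt_def sumr_ge0 ?andbT => [|l _]; last exact: sqr_ge0.
  rewrite psumr_eq0 => [|l _]; last exact: sqr_ge0.
  apply/negP => /allP B0.
  suff : B *m delta_mx i 0 = 0 :> 'cV[K]_d.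
    move/(congr1 (mulmx (invmx B))); rewrite mulKmx // mulmx0.
    by move=> /matrixP/(_ i 0); rewrite !mxE !eqxx => /eqP; rewrite oner_eq0.
  rewrite -colE; apply/matrixP => l j; rewrite mxE [RHS]mxE.
  by have /= := B0 l; rewrite mem_index_enum sqrf_eq0 rabs_eq0 => /(_ isT)/eqP.
pose s : 'rV[R]_d := \row_i Num.sqrt (col_sqnorm B i).
have s0 i : 0 < s 0 i by rewrite mxE sqrtr_gt0.
have s2 i : s 0 i ^+ 2 = col_sqnorm B i by rewrite mxE sqr_sqrtr // ltW.
pose D := diag_mx (map_mx ofR s); pose D' := diag_mx (map_mx ofR (map_mx GRing.inv s)).
have DD : D' *m D = 1%:M.
  rewrite mulmx_diag -diag_const_mx; congr diag_mx; apply/rowP => i; rewrite !mxE.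
  by rewrite -rmorphM mulVf ?rmorph1 // gt_eqF // sqrtr_gt0.
have BB : adjoint B *m B = D *m D.
  rewrite mulmx_diag; apply/matrixP => i j; rewrite mxE.
  under eq_bigr do rewrite adjointE mulrC.
  rewrite !mxE; have [<-|ij] := eqVneq i j.
    rewrite mulr1n -col_sqnormE -rmorphM -expr2 sqr_sqrtr // ltW //; exact: q0.
  rewrite mulr0n; case/lt_total/orP : ij => ij; first by have [] := orth _ _ ij.
  have [oij _] := orth _ _ ij; rewrite -[LHS]RCconjK -[RHS](rmorph0 conj).
  congr conj; rewrite rmorph_sum -[RHS]oij; apply: eq_bigr => l _.
  by rewrite rmorphM /= RCconjK mulrC.
exists (B *m D'), s, (adjoint p); split.
- rewrite -[B *m D']adjointK; apply: unitary_adjoint; apply/unitaryP.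
  rewrite adjointK adjointM adjoint_diag -/D' mulmxA -(mulmxA D') BB.
  by rewrite mulmxA DD mul1mx (mulmx1C DD).
- exact: unitary_adjoint.
- by move=> i; exact: ltW.
- move=> i j ij; rewrite !mxE ler_sqrt; last exact: ltW.
  move: ij; rewrite leq_eqVlt => /orP[/eqP/val_inj->//|ij].
  by have [] := orth _ _ ij.
- rewrite -/D -(mulmxA B) DD mulmx1 /B -mulmxA.
  by rewrite (unitaryP p).1 // mulmx1.
Qed.

End SVDExistence.

Section SingularValuesUnique.
Variables (R : realType) (k : RC) (d : nat).
Local Notation K := (RCfield R k).
Local Notation ofR := (@RCof_real R k).
Implicit Types (A u v : 'M[K]_d).

Lemma char_poly_unitary_conj u A : is_unitary u ->
  char_poly (u *m A *m adjoint u) = char_poly A.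
Proof.
move=> /unitaryP uu; rewrite /char_poly.
have uuP : map_mx polyC u *m map_mx polyC (adjoint u) = 1%:M.
  by rewrite -map_mxM uu map_mx1.
have -> : char_poly_mx (u *m A *m adjoint u) =
    map_mx polyC u *m char_poly_mx A *m map_mx polyC (adjoint u).
  rewrite /char_poly_mx mulmxBr mulmxBl !map_mxM; congr (_ - _).
  by rewrite mul_mx_scalar -scalemxAl uuP scalemx1.
rewrite !det_mulmx mulrAC -det_mulmx uuP det1 mul1r.
by [].
Qed.

(** The squares of the singular values are the roots of the characteristic polynomial of A times its
    adjoint, and a nonincreasing vector is determined by the multiset of its entries. *)
Lemma svd_unique A u s v u' s' v' :
  is_svd A u s v -> is_svd A u' s' v' -> s = s'.
Proof.
have svd_char u1 s1 v1 : is_svd A u1 s1 v1 ->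
    char_poly (A *m adjoint A) =
    \prod_(x <- [seq ofR (s1 0 i ^+ 2) | i <- enum 'I_d]) ('X - x%:P).
  move=> [uu /unitaryP vv _ _ ->].
  rewrite adjointM adjointM adjoint_diag -!mulmxA (mulmxA v1) vv mul1mx.
  rewrite (mulmxA (diag_mx _)) mulmxA char_poly_unitary_conj //.
  rewrite mulmx_diag char_poly_trig ?diag_mx_is_trig // big_map big_enum /=.
  apply: eq_bigr => i _; congr ('X - _%:P).
  by rewrite !mxE eqxx mulr1n -rmorphM expr2.
move=> svd1 svd2.
have := svd_char _ _ _ svd1; rewrite (svd_char _ _ _ svd2) => /esym/prod_XsubC_eq.
have mapE (t : 'rV[R]_d) : [seq ofR (t 0 i ^+ 2) | i <- enum 'I_d] =
    [seq ofR (x ^+ 2) | x <- [seq t 0 i | i <- enum 'I_d]].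
  by rewrite -[RHS]map_comp.
rewrite !mapE => sE'.
have ss (t : 'rV[R]_d) : (forall i j : 'I_d, (i <= j)%N -> t 0 j <= t 0 i) ->
    sorted >=%O [seq t 0 i | i <- enum 'I_d].
  move=> td; rewrite sorted_map.
  have : sorted (relpre (val : 'I_d -> nat) leq) (enum 'I_d).
    by rewrite -sorted_map val_enum_ord iota_sorted.
  by apply: sub_sorted => i j /=; exact: td.
case: svd1 svd2 => _ _ s0 sd _ [_ _ s0' sd' _].
have sE : perm_eq [seq s 0 i | i <- enum 'I_d] [seq s' 0 i | i <- enum 'I_d].
  move: sE' => /(@perm_map _ _ (fun z => Num.sqrt (rabs z))).
  have sq (t : 'rV[R]_d) : (forall i, 0 <= t 0 i) ->
      [seq Num.sqrt (rabs z) | z <- [seq ofR (x ^+ 2) | x <- [seq t 0 i | i <- enum 'I_d]]]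
      = [seq t 0 i | i <- enum 'I_d].
    move=> t0; rewrite -!map_comp; apply: eq_map => i /=.
    by rewrite rabs_ofR ger0_norm ?sqr_ge0 // sqrtr_sqr ger0_norm.
  by rewrite !sq.
have /(sorted_eq ge_trans ge_anti) := ss _ sd.
move=> /(_ _ (ss _ sd') sE) /eq_in_map sE2.
by apply/rowP => i; apply: sE2; rewrite mem_enum.
Qed.

Lemma singular_valuesE A u s v : is_svd A u s v -> singular_values A = s.
Proof.
move=> As; rewrite /singular_values.
case: xgetP => [t _ [u' [v' At]]|/(_ s)]; first exact: svd_unique At As.
by case; exists u, v.
Qed.

(** [singular_values] and [U_theta] choose their decompositions independently; by uniqueness of s, a
    single decomposition realizes both choices. *)
Lemma PSL_svd theta (g : PSL d K) : exists u v,
  [/\ is_svd (repr g : 'M[K]_d) u (singular_values (repr g : 'M[K]_d)) v,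
      U_theta theta g = flag_of_frame theta u &
      forall i, 0 < singular_values (repr g : 'M[K]_d) 0 i].
Proof.
have gU := SL_unit (repr g).
rewrite /U_theta; case: xgetP => [u _ [s [v As]]|no]; last first.
  by have [u [s [v]]] := svd_exists gU; move=> As; case: (no u); exists s, v.
exists u, v; split => //; first by rewrite (singular_valuesE As).
rewrite (singular_valuesE As) => i; case: As => _ _ s0 _ AE.
rewrite lt_def s0 andbT; apply/negP => /eqP si0.
move: gU; rewrite AE !unitmx_mul => /andP[/andP[_ +] _].
rewrite unitmxE det_diag unitfE => /prodf_neq0/(_ i isT).
by rewrite mxE si0 rmorph0 eqxx.
Qed.

End SingularValuesUnique.

(** * Minors and flags *)

Section CauchyBinet.
Variables (F : comNzRingType).

Lemma det_mulmx_expand m n (A : 'M[F]_(m, n)) (B : 'M[F]_(n, m)) :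
  \det (A *m B) =
  \sum_(f : {ffun 'I_m -> 'I_n}) (\prod_i A i (f i)) * \det (mxsub f id B).
Proof.
rewrite /determinant.
transitivity (\sum_(s : 'S_m) (-1) ^+ s *
    \sum_(f : {ffun 'I_m -> 'I_n}) \prod_i (A i (f i) * B (f i) (s i))).
  apply: eq_bigr => s _; congr (_ * _).
  rewrite -(bigA_distr_bigA (fun i h => A i h * B h (s i))).
  by apply: eq_bigr => i _; rewrite mxE.
under eq_bigr do rewrite mulr_sumr.
rewrite exchange_big /=; apply: eq_bigr => f _; rewrite mulr_sumr.
apply: eq_bigr => s _; rewrite big_split /= mulrCA; congr (_ * (_ * _)).
by apply: eq_bigr => i _; rewrite mxE.
Qed.

(** Summing over all functions instead of subsets counts each subset m! times, whereas functions
    that are not injective contribute 0. Permuting the rows of A and averaging turns the product of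
    entries in [det_mulmx_expand] into a determinant. *)
Lemma cauchy_binet m n (A : 'M[F]_(m, n)) (B : 'M[F]_(n, m)) :
  m`!%:R * \det (A *m B) =
  \sum_(f : {ffun 'I_m -> 'I_n}) \det (mxsub id f A) * \det (mxsub f id B).
Proof.
transitivity (\sum_(s : 'S_m) (-1) ^+ s * \det (row_perm s A *m B)).
  rewrite -(card_Sn m) mulr_natl -sumr_const.
  apply: eq_big => [s|s _]; first by rewrite inE.
  rewrite row_permE -mulmxA det_mulmx det_perm.
  by rewrite mulrA -expr2 sqrr_sign mul1r.
under eq_bigr do rewrite det_mulmx_expand mulr_sumr.
rewrite exchange_big /=; apply: eq_bigr => f _.
rewrite -[\det (mxsub id f A)]det_tr {2}/determinant mulr_suml; apply: eq_bigr => s _.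
by rewrite mulrA; congr (_ * _ * _); apply: eq_bigr => i _; rewrite !mxE.
Qed.

End CauchyBinet.

Section Minors.
Variable F : numFieldType.

Definition minor d j (A : 'M[F]_d) (f g : {ffun 'I_j -> 'I_d}) : F :=
  \det (mxsub f g A).

Lemma minorM d j (A B : 'M[F]_d) (f g : {ffun 'I_j -> 'I_d}) :
  j`!%:R * minor (A *m B) f g = \sum_h minor A f h * minor B h g.
Proof.
rewrite /minor mxsub_mul cauchy_binet; apply: eq_bigr => h _.
by rewrite -!mxsub_comp.
Qed.

End Minors.

(** * Subspaces through their Plücker coordinates *)

Section Frames.
Variables (d : nat) (K : numFieldType).
Implicit Types (i : 'I_d.-1) (x y z v A : 'M[K]_d).

Definition mdim i : nat := i.+1.

Lemma mdim_le i : (mdim i <= d)%N.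
Proof. exact: ltnW (ord_next_subproof i). Qed.

(** The minors with columns [lead i] are the Plücker coordinates of the span of the first i + 1
    columns, that is, of the subspace of index i in the flag of a frame. *)
Definition lead i : {ffun 'I_(mdim i) -> 'I_d} :=
  [ffun a => widen_ord (mdim_le i) a].

Lemma lead_lt i a : (lead i a < i.+1)%N.
Proof. by rewrite ffunE /=; exact: ltn_ord. Qed.

Lemma leadP i (b : 'I_d) : (b <= i)%N -> exists a, lead i a = b.
Proof. by move=> bi; exists (@Ordinal (mdim i) b bi); apply: val_inj; rewrite ffunE. Qed.

(** For invertible p this is the stabilizer of the standard subspace of index i. *)
Definition upper i (p : 'M[K]_d) : Prop :=
  forall a b : 'I_d, (i < a)%N -> (b <= i)%N -> p a b = 0.

Lemma sum_lead i (f : 'I_d -> K) :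
  (forall b : 'I_d, (i < b)%N -> f b = 0) -> \sum_b f b = \sum_a f (lead i a).
Proof.
move=> f0; rewrite (bigID (fun b : 'I_d => (b < i.+1)%N)) /=.
rewrite [X in _ + X]big1 => [|b]; last by rewrite -leqNgt => /f0.
rewrite addr0 (reindex_onto (lead i) (fun b => inord b)) /=; last first.
  move=> b bi; apply: val_inj; rewrite ffunE /= inordK //.
apply: eq_bigl => a; rewrite lead_lt /=.
by apply/eqP/val_inj; rewrite /= ffunE inordK /=.
Qed.

Lemma minor_upper i x p (f : {ffun 'I_(mdim i) -> 'I_d}) : upper i p ->
  minor (x *m p) f (lead i) = minor x f (lead i) * minor p (lead i) (lead i).
Proof.
move=> pu; rewrite /minor -det_mulmx; congr (\det _); apply/matrixP => a b.
rewrite !mxE (@sum_lead i) => [|c ic].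
  by apply: eq_bigr => c _; rewrite !mxE.
by rewrite pu ?mulr0 // -ltnS lead_lt.
Qed.

(** Cramer's rule: replacing a row of the leading block X by a lower row of z gives a minor that
    vanishes by hypothesis. The lower row is thus annihilated by the adjugate of X, and det X = c is
    nonzero. *)
Lemma upper_of_minor i z c : c != 0 ->
  (forall f, minor z f (lead i) = c * minor 1%:M f (lead i)) -> upper i z.
Proof.
move=> c0 zE a b ia bi; pose X := mxsub (lead i) (lead i) z.
have detX : \det X = c.
  have := zE (lead i); rewrite /minor -/X => ->.
  rewrite (_ : mxsub _ _ _ = 1%:M) ?det1 ?mulr1 //.
  apply/matrixP => a' b'; rewrite !mxE; congr (_ %:R); congr nat_of_bool.
  by rewrite -!val_eqE /= !ffunE.
pose r := \row_j z a (lead i j).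
have r0 : r *m \adj X = 0.
  apply/rowP => l; rewrite !mxE.
  pose f := [ffun a' => if a' == l then a else lead i a'] : {ffun _ -> _}.
  have fE a' : f a' = if a' == l then a else lead i a' by rewrite ffunE.
  have -> : \sum_j r 0 j * (\adj X) j l = minor z f (lead i).
    rewrite /minor (expand_det_row _ l); apply: eq_bigr => j _.
    rewrite !mxE fE eqxx; congr (_ * _); rewrite /cofactor; congr (_ * \det _).
    by apply/matrixP => a' b'; rewrite !mxE fE eq_sym (negPf (neq_lift _ _)).
  rewrite zE /minor (expand_det_row _ l) big1 ?mulr0 // => j _.
  rewrite !mxE fE eqxx.
  have /negPf -> : a != lead i j.
    by rewrite -val_eqE gtn_eqF // (leq_trans (lead_lt _)).
  by rewrite mul0r.
have rz : r = 0.
  have : r *m \adj X *m X = 0 by rewrite r0 mul0mx.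
  rewrite -mulmxA mul_adj_mx detX mul_mx_scalar => /eqP.
  by rewrite scaler_eq0 (negPf c0) => /eqP.
have [b' <-] := leadP bi.
by move/rowP/(_ b') : rz; rewrite !mxE.
Qed.

Lemma minor1_lead i : minor 1%:M (lead i) (lead i) = 1 :> K.
Proof.
rewrite /minor (_ : mxsub _ _ _ = 1%:M) ?det1 //.
apply/matrixP => a' b'; rewrite !mxE; congr (_ %:R); congr nat_of_bool.
by rewrite -!val_eqE /= !ffunE.
Qed.

Lemma mem_std_subspace i (w : 'cV[K]_d) :
  (w \in std_subspace K i) <-> (forall b : 'I_d, (i < b)%N -> w b 0 = 0).
Proof.
split=> [ws b ib|w0].
  pose D := \matrix_(a, c) ((a == c) && (i < a)%N)%:R : 'M[K]_d.
  have sD : (std_subspace K i <= lker (linfun (mulmx D)))%VS.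
    apply/span_subvP => e /mapP[a]; rewrite mem_filter => /andP[ai _] ->.
    rewrite memv_ker lfunE /= -colE; apply/eqP/matrixP => c j; rewrite !mxE.
    by case: eqP => //= ->; rewrite ltnNge ai.
  have := subvP sD _ ws; rewrite memv_ker lfunE /= => /eqP/matrixP/(_ b 0).
  rewrite !mxE (bigD1 b) //= big1 => [|c cb]; last first.
    by rewrite mxE eq_sym (negPf cb) mul0r.
  by rewrite mxE eqxx ib mul1r addr0.
rewrite (matrix_sum_delta w); apply: memv_suml => b _; apply: memv_suml => j _.
rewrite ord1; have [bi|ib] := leqP b i; last by rewrite w0 // scale0r mem0v.
apply/memvZ/memv_span; apply/mapP; exists b => //.
by rewrite mem_filter bi mem_enum.
Qed.

Lemma mem_frame_subspace i x (w : 'cV[K]_d) : x \in unitmx ->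
  (w \in frame_subspace x i) <->
  (forall b : 'I_d, (i < b)%N -> (invmx x *m w) b 0 = 0).
Proof.
move=> xU; rewrite /frame_subspace xU; split.
  move=> /memv_imgP[u us ->]; rewrite lfunE /= mulKmx //.
  exact/mem_std_subspace.
move=> /mem_std_subspace ws; apply/memv_imgP; exists (invmx x *m w) => //.
by rewrite lfunE /= mulKVmx.
Qed.

Lemma frame_subspace_eq i x y : x \in unitmx -> y \in unitmx ->
  frame_subspace x i = frame_subspace y i <-> upper i (invmx y *m x).
Proof.
move=> xU yU; split=> [xy a b ia bi|u].
  have : x *m delta_mx b 0 \in frame_subspace y i.
    rewrite -xy mem_frame_subspace // => c ic; rewrite mulKmx // mxE.
    by case: eqP => // cb; move: ic; rewrite cb ltnNge bi.
  by rewrite mem_frame_subspace // => /(_ a ia); rewrite mulmxA -colE mxE.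
apply/eqP; rewrite eqEdim; apply/andP; split; last first.
  have dimf w : \dim (frame_subspace w i) = i.+1.
    have /andP[/forallP dimw _] := frame_is_flag [set: 'I_d.-1]%SET w.
    have /eqP := dimw (exist _ i (finset.in_setT i)).
    by rewrite ffunE.
  by rewrite !dimf.
apply/subvP => w; rewrite !mem_frame_subspace // => xw b ib.
have -> : invmx y *m w = (invmx y *m x) *m (invmx x *m w).
  by rewrite -mulmxA mulKVmx.
rewrite mxE big1 // => c _.
have [ci|ic] := leqP c i; first by rewrite u // mul0r.
by rewrite xw // mulr0.
Qed.

(** Proportional Plücker coordinates determine the subspace. Multiplying by the inverse of y reduces
    the claim to the standard frame, where [upper_of_minor] applies. *)
Lemma frame_minor_prop i x y a b : x \in unitmx -> y \in unitmx -> a != 0 ->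
  (forall f, a * minor x f (lead i) = b * minor y f (lead i)) ->
  frame_subspace x i = frame_subspace y i.
Proof.
move=> xU yU a0 abE; apply/frame_subspace_eq => //.
have mf0 : (mdim i)`!%:R != 0 :> K by rewrite pnatr_eq0 -lt0n fact_gt0.
have zE f : a * minor (invmx y *m x) f (lead i) = b * minor 1%:M f (lead i).
  apply: (mulfI mf0); rewrite -(mulVmx yU) mulrCA minorM [RHS]mulrCA minorM.
  by rewrite !mulr_sumr; apply: eq_bigr => h _; rewrite mulrCA abE mulrCA.
have b0 : b != 0.
  apply/eqP => b0.
  have x0 f : minor x f (lead i) = 0.
    by apply: (mulfI a0); rewrite abE b0 mul0r mulr0.
  have := minor1_lead i => /(congr1 ( *%R (mdim i)`!%:R)).
  rewrite -(mulVmx xU) minorM big1 ?mulr1 => [/esym/eqP|h _].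
    by rewrite (negPf mf0).
  by rewrite x0 mulr0.
apply: (@upper_of_minor _ _ (b / a)) => [|f]; first by rewrite mulf_neq0 ?invr_eq0.
by apply: (mulfI a0); rewrite zE mulrA mulrCA mulfV // mulr1.
Qed.

Lemma frame_subspace_mul i A x y : A \in unitmx -> x \in unitmx -> y \in unitmx ->
  frame_subspace x i = frame_subspace y i ->
  frame_subspace (A *m x) i = frame_subspace (A *m y) i.
Proof.
move=> AU xU yU /(frame_subspace_eq _ xU yU) u.
apply/frame_subspace_eq; rewrite ?unitmx_mul ?AU //.
suff -> : invmx (A *m y) *m (A *m x) = invmx y *m x by [].
have AyU : A *m y \in unitmx by rewrite unitmx_mul AU.
by rewrite -[RHS](mulKmx AyU) -(mulmxA A) mulKVmx.
Qed.

Lemma frame_subspace_scale i c x : c != 0 -> x \in unitmx ->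
  frame_subspace (c *: x) i = frame_subspace x i.
Proof.
move=> c0 xU; apply/frame_subspace_eq => //; first by rewrite unitmxZ ?unitfE.
rewrite -scalemxAr mulVmx // => a b ia bi; rewrite !mxE.
by case: eqP => [ab|]; rewrite ?mulr0 //; move: ia; rewrite ab ltnNge bi.
Qed.

Variable theta : {set 'I_d.-1}.

Lemma flag_of_frameP x y : flag_of_frame theta x = flag_of_frame theta y <->
  (forall i, i \in theta -> frame_subspace x i = frame_subspace y i).
Proof.
split=> [xy i it|xy].
  have := congr1 (fun F : flag K theta => F (exist _ i it)) xy.
  by rewrite /= !ffunE.
by apply: val_inj; apply/ffunP => -[i it]; rewrite !ffunE; exact: xy.
Qed.

(* Turns a coframe v, whose first i + 1 rows cut out a subspace of codimension
   i + 1 for each i, into a frame of the flag of these subspaces, and back. *)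
Definition rev_mx : 'M[K]_d := \matrix_(a, b) (a == rev_ord b)%:R.

Lemma rev_mxK : rev_mx *m rev_mx = 1%:M.
Proof.
apply/matrixP => a b; rewrite !mxE (bigD1 (rev_ord b)) //= big1 => [|c cb].
  by rewrite !mxE eqxx rev_ordK mulr1 addr0.
by rewrite [X in _ * X]mxE (negPf cb) mulr0.
Qed.

Lemma rev_mx_unit : rev_mx \in unitmx.
Proof. by case/mulmx1_unit: rev_mxK. Qed.

Lemma rev_mxE m (A : 'M[K]_(d, m)) a b : (rev_mx *m A) a b = A (rev_ord a) b.
Proof.
rewrite mxE (bigD1 (rev_ord a)) //= big1 => [|c cb].
  by rewrite !mxE rev_ordK eqxx mul1r addr0.
rewrite mxE (_ : a == _ = false) ?mul0r //; apply/negP => /eqP ac.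
by move: cb; rewrite ac rev_ordK eqxx.
Qed.

Definition dual_frame v : 'M[K]_d := invmx v *m rev_mx.
Definition coframe x : 'M[K]_d := rev_mx *m invmx x.

Lemma dual_frame_unit v : v \in unitmx -> dual_frame v \in unitmx.
Proof. by move=> vU; rewrite unitmx_mul unitmx_inv vU rev_mx_unit. Qed.

Lemma coframe_unit v : v \in unitmx -> coframe v \in unitmx.
Proof. by move=> vU; rewrite unitmx_mul unitmx_inv vU rev_mx_unit. Qed.

Lemma coframeK x : x \in unitmx -> dual_frame (coframe x) = x.
Proof.
move=> xU; rewrite /dual_frame /coframe.
have rxU : rev_mx *m invmx x \in unitmx by rewrite unitmx_mul rev_mx_unit unitmx_inv.
apply: (can_inj (mulKmx rxU)); rewrite mulKVmx // -mulmxA mulVmx // mulmx1.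
by [].
Qed.

(** The pairing of the exterior powers of a coframe and a frame. For invertible matrices it is
    nonzero exactly when the flag of x is transverse to the one cut out by v. *)
Definition pairs_with v x : Prop :=
  forall i, i \in theta -> minor (v *m x) (lead i) (lead i) != 0.

Lemma transverse_pairs v x : symmetric_roots theta ->
  v \in unitmx -> x \in unitmx ->
  transverse (flag_of_frame theta x) (flag_of_frame theta (dual_frame v)) ->
  pairs_with v x.
Proof.
move=> sym vU xU tr i it; apply/negP => /eqP m0.
have jt : rev_ord i \in theta by rewrite -sym.
have [_] := tr (exist _ i it) (exist _ (rev_ord i) jt) erefl.
rewrite /= !ffunE /= => /directv_addP cap0.
pose X := mxsub (lead i) (lead i) (v *m x).
have : \det X^T = 0 by rewrite det_tr.
move=> /eqP/det0P[r rN0 rX].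
(* Extending the kernel vector of the degenerate block by 0 gives u; then x u lies in the subspace
   of x and is killed by the first i + 1 rows of v, hence lies in both subspaces. *)
pose u := \col_b (if [pick a | lead i a == b] is Some a then r 0 a else 0) : 'cV[K]_d.
have uE a : u (lead i a) 0 = r 0 a.
  rewrite mxE; case: pickP => [a' /eqP|/(_ a)]; last by rewrite eqxx.
  move=> /(congr1 val); rewrite /= !ffunE /= => /val_inj; by move=> ->.
have u0 (b : 'I_d) : (i < b)%N -> u b 0 = 0.
  move=> ib; rewrite mxE; case: pickP => // a /eqP ab.
  by move: (lead_lt a); rewrite ab ltnNge ib.
have uN0 : u != 0.
  apply: contra_neq rN0 => uz; apply/rowP => a; rewrite -uE uz !mxE //.
have : x *m u \in (frame_subspace x i :&: frame_subspace (dual_frame v) (rev_ord i))%VS.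
  rewrite memv_cap; apply/andP; split.
    by apply/mem_frame_subspace => // b ib; rewrite mulKmx // u0.
  apply/mem_frame_subspace; first exact: dual_frame_unit.
  move=> b ib.
  have -> : invmx (dual_frame v) = rev_mx *m v.
    apply: (can_inj (mulKmx (dual_frame_unit vU))).
    by rewrite mulmxV ?dual_frame_unit // /dual_frame mulmxA -(mulmxA (invmx v))
      rev_mxK mulmx1 mulVmx.
  rewrite -mulmxA rev_mxE.
  have bi : (rev_ord b <= i)%N.
    move: ib (ltn_ord b) (ltn_ord i); rewrite /=; move: (nat_of_ord b) (nat_of_ord i).
    by clear; move=> b i; case: d => //= n; lia.
  have [a <-] := leadP bi.
  rewrite mulmxA mxE (@sum_lead i) => [|c ic]; last by rewrite u0 ?mulr0.
  move/rowP: rX => /(_ a); rewrite !mxE => {2}<-.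
  by apply: eq_bigr => c _; rewrite uE mulrC !mxE.
rewrite cap0 memv0 => /eqP/(congr1 (mulmx (invmx x))).
by rewrite mulKmx // mulmx0; apply/eqP.
Qed.

End Frames.

(** * Norms of the arrays of minors *)

Section MinorEstimates.
Variables (R : realType) (k : RC) (d : nat).
Local Notation K := (RCfield R k).
Local Notation ofR := (@RCof_real R k).
Implicit Types (i : 'I_d.-1) (x v A B : 'M[K]_d).

Lemma rabs_nat n : rabs (n%:R : K) = n%:R.
Proof. by apply: (@ofR_inj R k); rewrite -normr_rabs normr_nat rmorph_nat. Qed.

Lemma mfact_neq0 i : (mdim i)`!%:R != 0 :> K.
Proof. by rewrite pnatr_eq0 -lt0n fact_gt0. Qed.

Lemma minorZ i c A (f g : {ffun 'I_(mdim i) -> 'I_d}) :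
  minor (c *: A) f g = c ^+ mdim i * minor A f g.
Proof.
by rewrite -detZ; congr (\det _); apply/matrixP => a b; rewrite !mxE.
Qed.

Definition minor_norm i A : R :=
  \sum_(f : {ffun 'I_(mdim i) -> 'I_d}) \sum_(g : {ffun 'I_(mdim i) -> 'I_d})
    rabs (minor A f g).

Lemma minor_norm_ge0 i A : 0 <= minor_norm i A.
Proof. by do 2!apply: sumr_ge0 => ? _; exact: rabs_ge0. Qed.

Lemma minor_le_norm i A (f g : {ffun 'I_(mdim i) -> 'I_d}) : rabs (minor A f g) <= minor_norm i A.
Proof.
rewrite /minor_norm (bigD1 f) //= (bigD1 g) //= -addrA lerDl addr_ge0 //.
  by apply: sumr_ge0 => ? _; exact: rabs_ge0.
by do 2!apply: sumr_ge0 => ? _; exact: rabs_ge0.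
Qed.

Lemma minor_normZ i c A : minor_norm i (c *: A) = rabs c ^+ mdim i * minor_norm i A.
Proof.
rewrite /minor_norm mulr_sumr; apply: eq_bigr => f _.
by rewrite mulr_sumr; apply: eq_bigr => g _; rewrite minorZ rabsM rabsX.
Qed.

(** The factorial of [minorM] stands on the favourable side, being at least 1, so the sum norm is
    submultiplicative without a constant. *)
Lemma minor_normM i A B : minor_norm i (A *m B) <= minor_norm i A * minor_norm i B.
Proof.
rewrite /minor_norm mulr_suml; apply: ler_sum => f _.
apply: (@le_trans _ _ (\sum_g \sum_h rabs (minor A f h) * rabs (minor B h g))).
  apply: ler_sum => g _.
  have := minorM A B f g => /(congr1 (@rabs R k)); rewrite rabsM => mE.
  apply: (@le_trans _ _ (rabs ((mdim i)`!%:R : K) * rabs (minor (A *m B) f g))).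
    rewrite ler_peMl ?rabs_ge0 //.
    by rewrite rabs_nat ler1n fact_gt0.
  rewrite mE; apply: le_trans (rabs_sum _ _ _) _.
  by apply: ler_sum => h _; rewrite rabsM.
rewrite exchange_big /= mulr_suml; apply: ler_sum => h _.
rewrite -mulr_sumr ler_wpM2l ?rabs_ge0 // [leRHS](bigD1 h) //= lerDl.
by do 2!apply: sumr_ge0 => ? _; exact: rabs_ge0.
Qed.

Lemma minor_col_neq0 i x : x \in unitmx -> exists f : {ffun 'I_(mdim i) -> 'I_d}, minor x f (lead i) != 0.
Proof.
move=> xU; apply: contrapT => nx.
have x0 f : minor x f (lead i) = 0.
  by apply/eqP/negPn/negP => xf; apply: nx; exists f.
have := minor1_lead K i => /(congr1 ( *%R (mdim i)`!%:R)).
rewrite -(mulVmx xU) minorM big1 ?mulr1 => [/esym/eqP|h _].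
  by rewrite (negPf (mfact_neq0 _)).
by rewrite x0 mulr0.
Qed.

Lemma minor_row_neq0 i x : x \in unitmx -> exists g : {ffun 'I_(mdim i) -> 'I_d}, minor x (lead i) g != 0.
Proof.
move=> xU; apply: contrapT => nx.
have x0 f : minor x (lead i) f = 0.
  by apply/eqP/negPn/negP => xf; apply: nx; exists f.
have := minor1_lead K i => /(congr1 ( *%R (mdim i)`!%:R)).
rewrite -(mulmxV xU) minorM big1 ?mulr1 => [/esym/eqP|h _].
  by rewrite (negPf (mfact_neq0 _)).
by rewrite x0 mul0r.
Qed.

Lemma minor_norm_gt0 i A : A \in unitmx -> 0 < minor_norm i A.
Proof.
move=> AU; have [f fN0] := minor_col_neq0 i AU.
by apply: lt_le_trans (minor_le_norm _ f (lead i)); rewrite rabs_gt0.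
Qed.

Section DiagonalMinors.
Variables (s : 'rV[R]_d) (i : 'I_d.-1).
Hypothesis s0 : forall b, 0 < s 0 b.
Hypothesis sd : forall a b : 'I_d, (a <= b)%N -> s 0 b <= s 0 a.
Implicit Types f g : {ffun 'I_(mdim i) -> 'I_d}.

Definition lead_prod : R := \prod_a s 0 (lead i a).

Lemma lead_prod_gt0 : 0 < lead_prod.
Proof. exact: prodr_gt0. Qed.

Lemma minor_diag f g : minor (diag_mx (map_mx ofR s)) f g =
  ofR (\prod_a s 0 (f a)) * minor 1%:M f g.
Proof.
rewrite rmorph_prod /= /minor.
have -> : \prod_a ofR (s 0 (f a)) = \det (diag_mx (\row_a ofR (s 0 (f a)))).
  by rewrite det_diag; apply: eq_bigr => a _; rewrite mxE.
rewrite -det_mulmx; congr (\det _); apply/matrixP => a b.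
rewrite mul_diag_mx !mxE; case: eqP => _; first by rewrite mulr1.
by rewrite mulr0.
Qed.

Lemma minor1_not_inj f g : ~~ injectiveb f -> minor 1%:M f g = 0 :> K.
Proof.
move=> /injectivePn[a [b ab fab]]; rewrite /minor.
by apply: (determinant_alternate ab) => c; rewrite !mxE fab.
Qed.

(** Compared with the leading indices, the image of f exchanges at least one index up to i for a
    larger one, and each exchange costs at least the factor of the gap at i. *)
Lemma prod_gap f : injective f ->
  (exists a, (i < f a)%N) ->
  \prod_a s 0 (f a) <= s 0 (ord_next i) / s 0 (ord_cur i) * lead_prod.
Proof.
move=> fI [a0 ia0].
pose L := lead i @: [set: 'I_(mdim i)]%SET; pose I := f @: [set: 'I_(mdim i)]%SET.
have leadI : injective (lead i).
  by move=> a b /(congr1 val); rewrite /= !ffunE /= => /val_inj.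
have prodE (h : {ffun 'I_(mdim i) -> 'I_d}) : injective h ->
    \prod_a s 0 (h a) = \prod_(b in h @: [set: 'I_(mdim i)]%SET) s 0 b.
  by move=> hI; rewrite big_imset /= => [|? ? _ _ /hI//]; apply: eq_bigl => a; rewrite inE.
have inL b : (b \in L) = (b <= i)%N.
  apply/imsetP/idP => [[a _ ->]|bi]; first by rewrite -ltnS lead_lt.
  by have [a <-] := leadP bi; exists a.
have cL : #|L| = #|I| by rewrite !card_imset.
rewrite /lead_prod (prodE f) // (prodE (lead i)) // -/L -/I.
rewrite (big_setID L) /= [X in _ <= _ * X](big_setID I) /= (finset.setIC L I) mulrCA.
have P0 (A : {set 'I_d}) : 0 < \prod_(b in A) s 0 b by apply: prodr_gt0.
rewrite ler_wpM2l ?(ltW (P0 _)) //.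
set m := #|I :\: L|%SET.
have mE : #|L :\: I|%SET = m.
  by apply/eqP; rewrite -(eqn_add2l #|L :&: I|%SET) cardsID finset.setIC cardsID cL.
have m0 : (0 < m)%N.
  rewrite card_gt0; apply/set0Pn; exists (f a0); rewrite !inE inL -ltnNge ia0.
  by rewrite imset_f.
have sn := s0 (ord_next i); have sc := s0 (ord_cur i).
have le1 : s 0 (ord_next i) / s 0 (ord_cur i) <= 1.
  by rewrite ler_pdivrMr // mul1r sd //= leqnSn.
have h1 : \prod_(b in I :\: L) s 0 b <= s 0 (ord_next i) ^+ m.
  rewrite -prodr_const; apply: ler_prod => b; rewrite !inE inL => /andP[bi _].
  by rewrite ltW // sd //= ltnNge.
have h2 : s 0 (ord_cur i) ^+ m <= \prod_(b in L :\: I) s 0 b.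
  rewrite -mE -prodr_const; apply: ler_prod => b; rewrite !inE inL => /andP[_ bi].
  by rewrite ltW // sd.
apply: le_trans h1 _.
rewrite -ler_pdivrMl ?divr_gt0 // invf_div.
apply: le_trans _ h2.
case: m m0 {mE} => // m _; rewrite exprS [leRHS]exprS mulrA divfK ?gt_eqF //.
by rewrite (ler_pM2l sc) lerXn2r ?nnegrE ?(ltW sn) ?(ltW sc) // sd //= leqnSn.
Qed.

Lemma prod_le_lead f : injective f -> \prod_a s 0 (f a) <= lead_prod.
Proof.
move=> fI; case: (pselect (exists a, (i < f a)%N)) => [fi|nfi].
  apply: le_trans (prod_gap fI fi) _; rewrite ler_piMl ?(ltW lead_prod_gt0) //.
  by rewrite ler_pdivrMr ?s0 // mul1r sd //= leqnSn.
have fL a : exists b, lead i b = f a.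
  by apply: leadP; rewrite leqNgt; apply/negP => ia; apply: nfi; exists a.
pose h a := projT1 (cid (fL a)).
have hE a : lead i (h a) = f a by rewrite /h; case: cid.
have hI : injective h by move=> a b /(congr1 (lead i)); rewrite !hE => /fI.
rewrite /lead_prod [leRHS](reindex_inj hI) /=.
by under [leRHS]eq_bigr do rewrite hE.
Qed.

Lemma minor_norm_diag : minor_norm i (diag_mx (map_mx ofR s)) <=
  minor_norm i 1%:M * lead_prod.
Proof.
rewrite /minor_norm mulr_suml; apply: ler_sum => f _.
rewrite mulr_suml; apply: ler_sum => g _.
rewrite minor_diag rabsM rabs_ofR mulrC.
have [/injectiveP fI|nf] := boolP (injectiveb f).
  rewrite ler_wpM2l ?rabs_ge0 // ger0_norm ?prod_le_lead // prodr_ge0 // => a _.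
  exact/ltW.
by rewrite minor1_not_inj // rabs0 !mul0r.
Qed.

End DiagonalMinors.

End MinorEstimates.
(** * Rank one limits of minors *)

Section Attraction.
Context (T : Type) (F : set_system T) {FF : ProperFilter F}.
Variables (R : realType) (k : RC) (d : nat).
Local Notation K := (RCfield R k).
Local Notation ofR := (@RCof_real R k).
Local Notation indices i := {ffun 'I_(mdim i) -> 'I_d}.
Implicit Types (i : 'I_d.-1) (x v h : 'M[K]_d) (A B : T -> 'M[K]_d).

Lemma eq_cvgK (f g : T -> K) (l l' : K) :
  f =1 g -> l = l' -> f @ F --> l -> g @ F --> l'.
Proof. by move=> /funext -> ->. Qed.

Definition minors_cvg i (c : T -> K) A (P : indices i -> indices i -> K) : Prop :=
  forall f g, (fun t => c t * minor (A t) f g) @ F --> P f g.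

Lemma minors_cvg_mul i c c' A B P Q :
  minors_cvg c A P -> minors_cvg c' B Q ->
  minors_cvg (i := i) (fun t => c t * c' t) (fun t => A t *m B t)
    (fun f g => ((mdim i)`!%:R)^-1 * \sum_h P f h * Q h g).
Proof.
move=> cA cB f g.
have -> : (fun t => c t * c' t * minor (A t *m B t) f g) =
    (fun t => ((mdim i)`!%:R)^-1 *
      \sum_h (c t * minor (A t) f h) * (c' t * minor (B t) h g)).
  apply/funext => t; apply: (mulfI (mfact_neq0 R k i)).
  rewrite mulVKf ?mfact_neq0 // mulrCA minorM mulr_sumr.
  by apply: eq_bigr => h _; rewrite mulrACA.
apply: cvgM; first exact: cvg_cst.
by apply: cvg_bigsum => h; apply: cvgM; [exact: cA|exact: cB].
Qed.

Arguments minors_cvg_mul {i c c' A B P Q} _ _ f g.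

Lemma minors_cvg_mcvg i A x : mcvg F A x ->
  minors_cvg (i := i) (fun=> 1) A (minor x).
Proof.
move=> Ax f g; under eq_fun do rewrite mul1r.
by apply: cvg_det; apply: mcvg_sub.
Qed.

Arguments minors_cvg_mcvg {i A x} _ f g.

Lemma minors_cvg_cst i x : minors_cvg (i := i) (fun=> 1) (fun=> x) (minor x).
Proof. by apply: minors_cvg_mcvg; exact: mcvg_cst. Qed.

Arguments minors_cvg_cst i x f g : clear implicits.

(** Cauchy-Binet for an array of minors multiplied by a rank one array, which stands on the right in
    the first equation and on the left in the second. *)
Lemma sum_minor_lead i x y z f g (c : K) :
  ((mdim i)`!%:R)^-1 * \sum_(h : indices i) minor x f h * (minor y h (lead i) * c) =
  minor (x *m y) f (lead i) * c :> K /\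
  ((mdim i)`!%:R)^-1 * \sum_(h : indices i) (c * minor y (lead i) h) * minor z h g =
  c * minor (y *m z) (lead i) g :> K.
Proof.
split; apply: (mulfI (mfact_neq0 R k i)); rewrite mulVKf ?mfact_neq0 //.
  by rewrite mulrA minorM mulr_suml; apply: eq_bigr => h _; rewrite mulrA.
by rewrite mulrCA minorM mulr_sumr; apply: eq_bigr => h _; rewrite mulrA.
Qed.

Variable theta : {set 'I_d.-1}.

(* A t maps every flag that is not annihilated by the coframe v close to the
   flag of x: up to scaling, the minors of A t tend to a rank one matrix. *)
Definition attracts A x v : Prop := forall i, i \in theta ->
  exists2 c : T -> K, forall t, c t != 0 &
    minors_cvg c A (fun f g => minor x f (lead i) * minor v (lead i) g).

Lemma attracts_mull h A x v : attracts A x v ->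
  attracts (fun t => h *m A t) (h *m x) v.
Proof.
move=> Axv i /Axv[c c0 cA]; exists c => // f g.
have := minors_cvg_mul (minors_cvg_cst i h) cA f g.
rewrite (sum_minor_lead h x 0 f g _).1.
by under eq_fun do rewrite mul1r.
Qed.

Lemma attracts_mulr h A x v : attracts A x v ->
  attracts (fun t => A t *m h) x (v *m h).
Proof.
move=> Axv i /Axv[c c0 cA]; exists c => // f g.
have := minors_cvg_mul cA (minors_cvg_cst i h) f g.
rewrite (sum_minor_lead 0 v h f g _).2.
by under eq_fun do rewrite mulr1.
Qed.

Lemma attracts_scale (b : T -> K) A B x v : (forall t, b t != 0) ->
  (forall t, B t = b t *: A t) -> attracts A x v -> attracts B x v.
Proof.
move=> b0 BE Axv i /Axv[c c0 cA].
exists (fun t => c t / b t ^+ mdim i) => [t|f g].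
  by rewrite mulf_neq0 // invr_eq0 expf_neq0.
apply: eq_cvgK (cA f g) => [t|//].
by rewrite BE minorZ mulrA divfK // expf_neq0.
Qed.

(** The product of the rank one limits is again of rank one, scaled by the pairing of v with x'.
    Transversality makes this scalar invertible, so it can be absorbed into the normalization. *)
Lemma attracts_comp A B x v x' v' : pairs_with theta v x' ->
  attracts A x v -> attracts B x' v' -> attracts (fun t => A t *m B t) x v'.
Proof.
move=> vx' Axv Bxv i it.
have [c c0 cA] := Axv i it; have [c' c'0 cB] := Bxv i it.
set m := minor (v *m x') (lead i) (lead i).
have m0 : m != 0 := vx' i it.
exists (fun t => m^-1 * (c t * c' t)) => [t|f g].
  by rewrite !mulf_neq0 // invr_eq0.
have := minors_cvg_mul cA cB f g => cAB.
under eq_fun do rewrite -mulrA.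
rewrite -(mulKf m0 (_ * _)); apply: cvgM; first exact: cvg_cst.
apply: eq_cvgK cAB => [//|].
transitivity (minor x f (lead i) * (((mdim i)`!%:R)^-1 *
    \sum_(h : indices i) minor v (lead i) h * (minor x' h (lead i) * minor v' (lead i) g))).
  rewrite [RHS]mulrCA; congr (_ * _); rewrite mulr_sumr; apply: eq_bigr => h _.
  exact/esym/mulrA.
by rewrite (sum_minor_lead v x' 0 _ g _).1 -/m; ring.
Qed.

Lemma attracts_unique A x v x' v' :
  x \in unitmx -> v \in unitmx -> x' \in unitmx -> v' \in unitmx ->
  attracts A x v -> attracts A x' v' ->
  flag_of_frame theta x = flag_of_frame theta x'.
Proof.
move=> xU vU xU' vU' Axv Axv'; apply/flag_of_frameP => i it.
have [c c0 cA] := Axv i it; have [c' c'0 cA'] := Axv' i it.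
have [f0 f0N0] := minor_col_neq0 i xU; have [g0 g0N0] := minor_row_neq0 i vU.
have [f1 f1N0] := minor_col_neq0 i xU'; have [g1 g1N0] := minor_row_neq0 i vU'.
set a := minor x f0 (lead i) * minor v (lead i) g0.
have a0 : a != 0 by rewrite mulf_neq0.
pose r := minor x' f0 (lead i) * minor v' (lead i) g0 / a.
have key f g : minor x' f (lead i) * minor v' (lead i) g =
    r * (minor x f (lead i) * minor v (lead i) g).
  apply: (mulfI a0); rewrite [RHS]mulrA (_ : a * r =
    minor x' f0 (lead i) * minor v' (lead i) g0); last by rewrite mulrC divfK.
  (* The normalizations c and c' are unrelated; a product of two entries, one with each, can be read
     in two ways, which makes the two limit arrays proportional. *)
  pose w t := c t * minor (A t) f0 g0 * (c' t * minor (A t) f g).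
  have c1 : w @ F --> a * (minor x' f (lead i) * minor v' (lead i) g).
    by apply: cvgM; [exact: cA|exact: cA'].
  apply: cvgK_unique c1 _.
  apply: eq_cvgK (cvgM (cA' f0 g0) (cA f g)) => [t /=|//].
  by rewrite /w mulrACA [RHS]mulrACA (mulrC (c' t)).
apply/esym/(@frame_minor_prop _ _ i x' x (minor v' (lead i) g1)
  (r * minor v (lead i) g1)) => // f.
by rewrite mulrC key; ring.
Qed.

Lemma minors_cvg_norm i c A P : minors_cvg (i := i) c A P ->
  (fun t => rabs (c t) * minor_norm i (A t)) @ F --> \sum_f \sum_g rabs (P f g).
Proof.
move=> cA.
under eq_fun do rewrite mulr_sumr.
apply: cvg_bigsum => f; under eq_fun do rewrite mulr_sumr.
apply: cvg_bigsum => g; under eq_fun do rewrite -rabsM.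
by apply: cvg_rabs; exact: cA.
Qed.

Lemma sum_rabs_gt0 (I J : finType) (P : I -> J -> K) f g :
  P f g != 0 -> 0 < \sum_f \sum_g rabs (P f g).
Proof.
move=> Pfg; rewrite (bigD1 f) //= (bigD1 g) //= -addrA ltr_pwDl ?rabs_gt0 //.
rewrite addr_ge0 //; first by apply: sumr_ge0 => ? _; exact: rabs_ge0.
by do 2!apply: sumr_ge0 => ? _; exact: rabs_ge0.
Qed.

Lemma attracts_norm A x v i : i \in theta -> x \in unitmx -> v \in unitmx ->
  attracts A x v -> exists c : T -> K, exists2 l : R, 0 < l &
    (forall t, c t != 0) /\
    minors_cvg c A (fun f g => minor x f (lead i) * minor v (lead i) g) /\
    (fun t => rabs (c t) * minor_norm i (A t)) @ F --> l.
Proof.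
move=> it xU vU /(_ i it)[c c0 cA].
exists c; eexists; last by split => //; split => //; exact: minors_cvg_norm cA.
have [f0 f0N0] := minor_col_neq0 i xU; have [g0 g0N0] := minor_row_neq0 i vU.
by apply: (sum_rabs_gt0 (f := f0) (g := g0)); rewrite mulf_neq0.
Qed.

(** After rescaling, the norms of A, B and A B all converge to positive limits, the last because of
    the pairing. Hence the reverse of submultiplicativity holds almost everywhere up to a
    constant. *)
Lemma attracts_norm_comp A B x v x' v' i : i \in theta ->
  x \in unitmx -> v \in unitmx -> x' \in unitmx -> v' \in unitmx ->
  pairs_with theta v x' -> attracts A x v -> attracts B x' v' ->
  exists2 C, 0 < C & F [set t | minor_norm i (A t) * minor_norm i (B t) <=
    C * minor_norm i (A t *m B t)].
Proof.
move=> it xU vU xU' vU' vx' Axv Bxv.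
have [c [a a0 [c0 [cA cNA]]]] := attracts_norm it xU vU Axv.
have [c' [b b0 [c'0 [cB cNB]]]] := attracts_norm it xU' vU' Bxv.
have := minors_cvg_norm (minors_cvg_mul cA cB); set l := (X in _ --> X) => cNAB.
have l0 : 0 < l.
  have [f0 f0N0] := minor_col_neq0 i xU; have [g0 g0N0] := minor_row_neq0 i vU'.
  apply: (sum_rabs_gt0 (f := f0) (g := g0)).
  have -> : ((mdim i)`!%:R)^-1 * \sum_(h : indices i)
      (minor x f0 (lead i) * minor v (lead i) h) * (minor x' h (lead i) * minor v' (lead i) g0)
      = minor x f0 (lead i) * (minor (v *m x') (lead i) (lead i) * minor v' (lead i) g0).
    rewrite -(sum_minor_lead v x' 0 _ g0 _).1 [RHS]mulrCA; congr (_ * _).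
    by rewrite mulr_sumr; apply: eq_bigr => h _; exact/esym/mulrA.
  by rewrite !mulf_neq0 // vx'.
have cq : (fun t => rabs (c t) * minor_norm i (A t) * (rabs (c' t) * minor_norm i (B t)))
    @ F --> a * b by exact: cvgM.
exists ((a * b + 1) / (l / 2)); first by rewrite !divr_gt0 // addr_gt0 // mulr_gt0.
have F1 : F [set t | rabs (c t) * minor_norm i (A t) *
    (rabs (c' t) * minor_norm i (B t)) < a * b + 1].
  move: cq => /(@cvgrPdist_lt _ R)/(_ 1 ltr01); apply: filterS => t /=.
  by rewrite ltr_norml => /andP[]; lra.
have F2 : F [set t | l / 2 < rabs (c t * c' t) * minor_norm i (A t *m B t)].
  have l20 : 0 < l / 2 by rewrite divr_gt0.
  move: cNAB => /(@cvgrPdist_lt _ R)/(_ _ l20); apply: filterS => t /=.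
  by rewrite ltr_norml => /andP[]; lra.
apply: filterS (filterI F1 F2) => t [/= {}F1 {}F2].
have cc0 : 0 < rabs (c t * c' t) by rewrite rabs_gt0 mulf_neq0.
rewrite -(ler_pM2l cc0) {1}rabsM mulrACA.
apply: le_trans (ltW F1) _; rewrite mulrCA mulrAC -[leRHS]mulrA ler_peMr //.
  by rewrite ltW // addr_gt0 // mulr_gt0.
by rewrite ler_pdivlMr ?divr_gt0 // mul1r ltW.
Qed.

End Attraction.

Arguments minors_cvg_mul {T F FF R k d i c c' A B P Q} _ _ f g.
Arguments minors_cvg_mcvg {T F FF R k d i A x} _ f g.
Section SVDAttracts.
Context (T : Type) (F : set_system T) {FF : ProperFilter F}.
Variables (R : realType) (k : RC) (d : nat) (theta : {set 'I_d.-1}).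
Local Notation K := (RCfield R k).
Local Notation ofR := (@RCof_real R k).
Implicit Types i : 'I_d.-1.

Lemma minor1_lead_perm i (f g : {ffun 'I_(mdim i) -> 'I_d})
    (h : 'I_(mdim i) -> 'I_(mdim i)) :
  injective h -> (forall a, f a = lead i (h a)) ->
  minor 1%:M f (lead i) * minor 1%:M (lead i) g = minor 1%:M f g :> K.
Proof.
move=> hI fE.
have fgE (g' : {ffun 'I_(mdim i) -> 'I_d}) :
    minor 1%:M f g' = (-1) ^+ perm hI * minor 1%:M (lead i) g' :> K.
  rewrite /minor -det_perm -det_mulmx -row_permE; congr (\det _).
  by apply/matrixP => a b; rewrite !mxE fE permE.
by rewrite !fgE minor1_lead mulr1.
Qed.

(** Divided by the leading product, a minor with a row beyond i tends to 0 by [prod_gap], and one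
    whose rows permute the leading ones is constant. *)
Lemma diag_minors_cvg i (s : T -> 'rV[R]_d) :
  (forall t b, 0 < s t 0 b) ->
  (forall t (a b : 'I_d), (a <= b)%N -> s t 0 b <= s t 0 a) ->
  (fun t => s t 0 (ord_next i) / s t 0 (ord_cur i)) @ F --> (0 : R) ->
  minors_cvg F (i := i) (fun t => ofR (lead_prod (s t) i)^-1)
    (fun t => diag_mx (map_mx ofR (s t)))
    (fun f g => minor 1%:M f (lead i) * minor 1%:M (lead i) g).
Proof.
move=> s0 sd gap f g.
have -> : (fun t => ofR (lead_prod (s t) i)^-1 * minor (diag_mx (map_mx ofR (s t))) f g) =
    (fun t => ofR (\prod_a s t 0 (f a) / lead_prod (s t) i) * minor 1%:M f g).
  apply/funext => t; rewrite minor_diag mulrA -rmorphM /=.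
  by congr (ofR _ * _); exact: mulrC.
have [/injectiveP fI|nf] := boolP (injectiveb f); last first.
  rewrite !(minor1_not_inj R k _ nf) mul0r; under eq_fun do rewrite mulr0.
  exact: cvg_cst.
case: (pselect (exists a, (i < f a)%N)) => [[a ia]|nfi].
  rewrite (_ : minor 1%:M f (lead i) = 0) ?mul0r; last first.
    rewrite /minor (expand_det_row _ a) big1 // => b _; rewrite !mxE.
    have /negPf -> : f a != lead i b.
      by rewrite -val_eqE gtn_eqF // (leq_trans (lead_lt _)).
    by rewrite mul0r.
  rewrite -[X in _ --> X](mul0r (minor 1%:M f g)); apply: cvgM; last exact: cvg_cst.
  apply/cvg_rabsP => e e0.
  move: gap => /(@cvgrPdist_lt _ R)/(_ _ e0); apply: filterS => t /=.
  rewrite !sub0r normrN rabsN rabs_ofR; apply: le_lt_trans.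
  have P0 := lead_prod_gt0 i (s0 t).
  rewrite ger0_norm ?divr_ge0 ?(ltW P0) ?prodr_ge0 // => [|b _]; last exact: ltW.
  rewrite ger0_norm ?divr_ge0 ?(ltW (s0 _ _)) //.
  by rewrite ler_pdivrMr //; apply: (prod_gap (s0 t) (sd t) fI); exists a.
have fL a : exists b, lead i b = f a.
  by apply: leadP; rewrite leqNgt; apply/negP => ia; apply: nfi; exists a.
pose h a := projT1 (cid (fL a)).
have hE a : lead i (h a) = f a by rewrite /h; case: cid.
have hI : injective h by move=> a b /(congr1 (lead i)); rewrite !hE => /fI.
rewrite (minor1_lead_perm g hI (fun a => esym (hE a))).
rewrite (_ : (fun t => _) = fun=> minor 1%:M f g); first exact: cvg_cst.
apply/funext => t; rewrite (_ : \prod_a _ = lead_prod (s t) i).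
  by rewrite divff ?rmorph1 ?mul1r // gt_eqF // lead_prod_gt0.
rewrite /lead_prod [RHS](reindex_inj hI) /=.
by under [RHS]eq_bigr do rewrite hE.
Qed.

Lemma svd_attracts (u v : T -> 'M[K]_d) (s : T -> 'rV[R]_d) U V :
  (forall t b, 0 < s t 0 b) ->
  (forall t (a b : 'I_d), (a <= b)%N -> s t 0 b <= s t 0 a) ->
  (forall i, i \in theta ->
    (fun t => s t 0 (ord_next i) / s t 0 (ord_cur i)) @ F --> (0 : R)) ->
  mcvg F u U -> mcvg F v V ->
  attracts F theta (fun t => u t *m diag_mx (map_mx ofR (s t)) *m v t) U V.
Proof.
move=> s0 sd gap uU vV i it.
exists (fun t => ofR (lead_prod (s t) i)^-1) => [t|f g].
  by rewrite fmorph_eq0 invr_eq0 gt_eqF // lead_prod_gt0.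
have c1 := diag_minors_cvg s0 sd (gap i it).
have /(_ FF FF FF FF) c2 := minors_cvg_mul
  (minors_cvg_mul (minors_cvg_mcvg uU) c1) (minors_cvg_mcvg vV).
apply: (eq_cvgK _ _ (c2 f g)) => [t|]; first by rewrite mul1r mulr1.
have U1 h : ((mdim i)`!%:R)^-1 * (\sum_(h0 : {ffun 'I_(mdim i) -> 'I_d})
      minor U f h0 * (minor 1%:M h0 (lead i) * minor 1%:M (lead i) h)) =
    minor U f (lead i) * minor 1%:M (lead i) h.
  by rewrite (sum_minor_lead U 1%:M 0 f h _).1 mulmx1.
under eq_bigr do rewrite U1.
by rewrite (sum_minor_lead 0 1%:M V f g _).2 mul1mx.
Qed.

End SVDAttracts.

(** * Fundamental weights as norms of minors *)

Section CartanEstimates.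
Variables (R : realType) (k : RC) (d : nat).
Local Notation K := (RCfield R k).
Local Notation ofR := (@RCof_real R k).
Local Notation PSLK := (PSL d K).
Implicit Types (i : 'I_d.-1) (g h : PSLK).

Definition lift_mx g : 'M[K]_d := repr g.

Lemma lift_unit g : lift_mx g \in unitmx.
Proof. exact: SL_unit. Qed.

Lemma index_gt0 i : (0 < d)%N.
Proof. by case: (d) i => [[]|]. Qed.

Lemma det1_scalar_rabs (A B : SL d K) (c : K) : (0 < d)%N ->
  (A : 'M[K]_d) = c%:M *m B -> rabs c = 1.
Proof.
move=> d0 AE; have /eqP := SL_det A; rewrite AE det_mulmx (eqP (SL_det B)) mulr1.
rewrite det_scalar => /(congr1 (@rabs R k)); rewrite rabs1 rabsX => /eqP.
by rewrite pexpr_eq1 ?rabs_ge0 // => /eqP.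
Qed.

Lemma lift_mul g h : (0 < d)%N -> exists2 c : K, rabs c = 1 &
  lift_mx (g * h)%g = c *: (lift_mx g *m lift_mx h).
Proof.
move=> d0; have [c cE] := repr_pi (SL_mul (repr g) (repr h)).
exists c; first exact: det1_scalar_rabs cE.
by rewrite -mul_scalar_mx; exact: cE.
Qed.

Lemma lift_inv g : (0 < d)%N -> exists2 c : K, rabs c = 1 &
  lift_mx g^-1%g = c *: invmx (lift_mx g).
Proof.
move=> d0; have [c cE] := repr_pi (SL_inv (repr g)).
exists c; first exact: det1_scalar_rabs cE.
by rewrite -mul_scalar_mx; exact: cE.
Qed.

Definition sing_vals g : 'rV[R]_d := singular_values (lift_mx g).

Lemma sing_vals_gt0 g b : 0 < sing_vals g 0 b.
Proof. by have [u [v [_ _ H]]] := PSL_svd finset.set0 g; exact: H. Qed.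

Lemma sing_vals_noninc g (a b : 'I_d) : (a <= b)%N -> sing_vals g 0 b <= sing_vals g 0 a.
Proof. by have [u [v [[_ _ _ H _] _ _]]] := PSL_svd finset.set0 g; exact: H. Qed.

Lemma rabs_det_unitary (u : 'M[K]_d) : is_unitary u -> rabs (\det u) = 1.
Proof.
move=> /unitaryP/(congr1 determinant); rewrite det_mulmx det1 /adjoint det_tr.
rewrite (det_map_mx (@RCconj R k)) mul_conj -(rmorph1 ofR) => /ofR_inj/eqP.
by rewrite pexpr_eq1 ?rabs_ge0 // => /eqP.
Qed.

Lemma sum_ln (I : Type) (r : seq I) (f : I -> R) : (forall j, 0 < f j) ->
  \sum_(j <- r) ln (f j) = ln (\prod_(j <- r) f j).
Proof.
move=> f0; elim: r => [|i r IH]; first by rewrite !big_nil ln1.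
by rewrite !big_cons IH lnM // posrE ?prodr_gt0.
Qed.

Lemma sum_cartan_proj g : \sum_b cartan_proj g 0 b = 0.
Proof.
have [u [v [[uu vv _ _ gE] _ _]]] := PSL_svd finset.set0 g.
have : rabs (\det (lift_mx g)) = 1 by rewrite (eqP (SL_det _)) rabs1.
rewrite /lift_mx gE !det_mulmx !rabsM (rabs_det_unitary uu) (rabs_det_unitary vv).
rewrite mul1r mulr1 det_diag.
rewrite rabs_prod => P1.
under eq_bigr do rewrite mxE.
rewrite sum_ln; last exact: sing_vals_gt0.
apply: etrans (ln1 R); congr ln; rewrite -[RHS]P1; apply: eq_bigr => b _.
by rewrite mxE rabs_ofR gtr0_norm // sing_vals_gt0.
Qed.

Lemma fund_weightE i g :
  fund_weight i (cartan_proj g) = ln (lead_prod (sing_vals g) i).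
Proof.
rewrite /fund_weight big_mkcond /= (@sum_lead _ R i) => [|b ib]; last first.
  by rewrite leqNgt ib.
rewrite /lead_prod -sum_ln; last by move=> b; exact: sing_vals_gt0.
by apply: eq_bigr => a _; rewrite -ltnS lead_lt mxE.
Qed.

(** As the coordinates sum to 0, the weight S is minus the sum of the coordinates after i. So S is
    at least p when p >= 0 and at least -q when q <= 0, which covers p - q in every sign case.
    Divergence of the roots thus makes the weights diverge. *)
Lemma simple_root_le_weight i g :
  simple_root i (cartan_proj g) <= 2 * fund_weight i (cartan_proj g).
Proof.
set a := cartan_proj g.
have ad (b c : 'I_d) : (b <= c)%N -> a 0 c <= a 0 b.
  by move=> bc; rewrite !mxE ler_ln ?posrE ?sing_vals_gt0 // sing_vals_noninc.
have := sum_cartan_proj g; rewrite -/a.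
rewrite (bigID (fun b : 'I_d => (b <= i)%N)) /= -/(fund_weight i a).
set S := fund_weight i a; set S' := \sum_(_ < _ | _) _ => SS'.
rewrite /simple_root; set p := a 0 (ord_cur i); set q := a 0 (ord_next i).
have qp : q <= p by apply: ad; rewrite /= leqnSn.
have pS : 0 <= p -> p <= S.
  move=> p0; rewrite /S /fund_weight (bigD1 (ord_cur i)) //= lerDl sumr_ge0 // => b.
  by move=> /andP[bi _]; apply: le_trans (ad b (ord_cur i) bi).
have qS : q <= 0 -> S' <= q.
  move=> q0; rewrite /S' (bigD1 (ord_next i)) /=; last by rewrite -ltnNge.
  rewrite gerDl sumr_le0 // => b; rewrite -ltnNge => /andP[ib _].
  exact: le_trans (ad (ord_next i) b ib) q0.
have [p0|p0] := leP 0 p; have [q0|q0] := leP q 0.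
- by have := pS p0; have := qS q0; lra.
- by have := pS p0; lra.
- by have := qS q0; lra.
- by have := lt_le_trans q0 qp; lra.
Qed.

Definition om i g : R := ln (minor_norm i (lift_mx g)).

Lemma om_norm_gt0 i g : 0 < minor_norm i (lift_mx g).
Proof. exact: minor_norm_gt0 (lift_unit g). Qed.

Lemma minor_norm_unitary i : exists2 B, 0 < B &
  forall u : 'M[K]_d, is_unitary u -> minor_norm i u <= B.
Proof.
pose B : R := \sum_(f : {ffun 'I_(mdim i) -> 'I_d})
  \sum_(g : {ffun 'I_(mdim i) -> 'I_d}) \sum_(s : 'S_(mdim i)) 1.
have NB (u : 'M[K]_d) : is_unitary u -> minor_norm i u <= B.
  move=> uu; apply: ler_sum => f _; apply: ler_sum => g _.
  apply: le_trans (rabs_sum _ _ _) _; apply: ler_sum => s _.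
  rewrite rabsM rabsX rabsN rabs1 expr1n mul1r rabs_prod.
  by apply: prodr_ile1 => a; rewrite mxE rabs_ge0 unitary_rabs_le1.
exists B; last exact: NB.
have := NB _ (unitary1 R k d); apply: lt_le_trans.
exact: minor_norm_gt0 (unitmx1 _ _).
Qed.

(** Unitary factors change the norm of the minors by bounded factors only, and for the diagonal part
    this norm is comparable to the leading product. *)
Lemma weight_om_close i : exists C, forall g,
  `|fund_weight i (cartan_proj g) - om i g| <= C.
Proof.
have [B B0 NB] := minor_norm_unitary i.
set N1 := minor_norm i (1%:M : 'M[K]_d).
have N10 : 0 < N1 by exact: minor_norm_gt0 (unitmx1 _ _).
exists (`|ln (B * B * N1)| + `|ln (B * B)|) => g; rewrite fund_weightE /om.
have [u [v [[uu vv s0 sd gE] _ _]]] := PSL_svd finset.set0 g.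
set P := lead_prod _ _; have P0 : 0 < P by apply: lead_prod_gt0; exact: sing_vals_gt0.
set D := diag_mx (map_mx ofR (sing_vals g)).
have ND : minor_norm i D <= N1 * P.
  apply: minor_norm_diag; first exact: sing_vals_gt0.
  by move=> a b; exact: sing_vals_noninc.
have le1 : minor_norm i (lift_mx g) <= B * B * N1 * P.
  rewrite /lift_mx gE; apply: le_trans (minor_normM _ _ _) _.
  rewrite -!mulrA mulrCA -/(sing_vals g) -/D mulrC.
  apply: ler_pM; rewrite ?minor_norm_ge0 ?NB //.
  apply: le_trans (minor_normM _ _ _) _.
  by apply: ler_pM; rewrite ?minor_norm_ge0 ?NB.
have le2 : P <= B * B * minor_norm i (lift_mx g).
  have DE : D = adjoint u *m lift_mx g *m adjoint v.
    rewrite /lift_mx gE -!mulmxA (unitaryP v).1 // mulmx1 mulmxA unitary_adj //.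
    by rewrite mul1mx.
  apply: (@le_trans _ _ (minor_norm i D)).
    apply: le_trans (minor_le_norm _ (lead i) (lead i)).
    rewrite minor_diag minor1_lead mulr1 rabs_ofR ger0_norm //.
    by apply: prodr_ge0 => a _; exact/ltW/sing_vals_gt0.
  rewrite DE; apply: le_trans (minor_normM _ _ _) _.
  rewrite [leRHS]mulrAC; apply: ler_pM; rewrite ?minor_norm_ge0 //; last first.
    by apply: NB; exact: unitary_adjoint.
  apply: le_trans (minor_normM _ _ _) _.
  by apply: ler_wpM2r; rewrite ?minor_norm_ge0 // NB //; exact: unitary_adjoint.
have N0 := om_norm_gt0 i g.
move: le1; rewrite -ler_ln ?posrE ?mulr_gt0 // lnM ?posrE ?mulr_gt0 // => le1.
move: le2; rewrite -ler_ln ?posrE ?mulr_gt0 // lnM ?posrE ?mulr_gt0 // => le2.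
have := ler_norm (ln (B * B * N1)); have := ler_norm (ln (B * B)).
have := normr_ge0 (ln (B * B * N1)); have := normr_ge0 (ln (B * B)).
by rewrite ler_norml => *; lra.
Qed.

Lemma omM i g h : om i (g * h)%g <= om i g + om i h.
Proof.
have [c c1 cE] := lift_mul g h (index_gt0 i).
rewrite /om cE minor_normZ c1 expr1n mul1r -lnM ?posrE ?om_norm_gt0 //.
rewrite ler_ln ?posrE ?mulr_gt0 ?om_norm_gt0 ?minor_normM //.
by apply: minor_norm_gt0; rewrite unitmx_mul !lift_unit.
Qed.

End CartanEstimates.

Lemma choose_injective (T : choiceType) (S : nat -> set T) :
  (forall n, infinite_set (S n)) ->
  exists2 gam : nat -> T, injective gam & forall n, S n (gam n).
Proof.
move=> Sinf.
have pick n (l : seq T) : exists x, S n x /\ x \notin l.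
  have [x [Sx /= xl]] := infinite_setN0 (infinite_setD (Sinf n) (finite_seq l)).
  by exists x; split => //; apply/negP.
pose next n l := projT1 (cid (pick n l)).
have nextP n l : S n (next n l) /\ next n l \notin l by rewrite /next; case: cid.
pose L := fix L n := if n is m.+1 then next m (L m) :: L m else [::].
exists (fun n => next n (L n)) => [|n]; last exact: (nextP n _).1.
have memL m n : (m < n)%N -> next m (L m) \in L n.
  elim: n => // n IH; rewrite ltnS leq_eqVlt inE => /orP[/eqP->|/IH->].
    by rewrite eqxx.
  by rewrite orbT.
move=> m n /= mn; apply/eqP; case: ltngtP => // /memL; last first.
  by rewrite -mn (negPf (nextP _ _).2).
by rewrite mn (negPf (nextP _ _).2).
Qed.

Section UltraFinite.
Variables (T : Type) (F : set_system T) (UF : UltraFilter F).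

Lemma ultra_finite_set (X : choiceType) (S : set X) (f : T -> X) :
  finite_set S -> F [set t | S (f t)] -> exists x, F [set t | f t = x].
Proof.
move=> /finite_seqP[s ->] Fs.
have [|i Fi] := ultra_finite_exists UF (A := fun i t => f t = tnth (in_tuple s) i).
  by apply: filterS Fs => t /= /(seq_tnthP (s := s))[i ->]; exists i.
by exists (tnth (in_tuple s) i).
Qed.

End UltraFinite.

(** * Limits of flags *)

Section FlagTopology.
Variables (R : realType) (k : RC) (d : nat) (theta : {set 'I_d.-1}).
Local Notation K := (RCfield R k).
Implicit Types (x : 'M[K]_d) (Fl : flag K theta).

Lemma mcvg_nbhs (T : Type) (F : set_system T) (FF : Filter F)
    (u : T -> 'M[K]_d) x (N : set 'M[K]_d) :
  mcvg F u x -> nbhs x N -> F [set t | N (u t)].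
Proof.
move=> ux /nbhs_ballP[e /= e0 eN].
have [r r0 eE] := gt0_ofR e0.
have Fe : F [set t | forall ij : 'I_d * 'I_d, rabs (x ij.1 ij.2 - u t ij.1 ij.2) < r].
  apply: (filter_forall _ (f := fun ij t => rabs (x ij.1 ij.2 - u t ij.1 ij.2) < r)).
  by move=> [i j]; have /cvg_rabsP := ux i j; apply.
apply: filterS Fe => t ut; apply: eN; split => // i j.
by rewrite -ball_normE /= normr_rabs eE ltr_ofR; exact: (ut (i, j)).
Qed.

Lemma mcvg_id x : mcvg (nbhs x) (fun y : 'M[K]_d => y) x.
Proof. by move=> i j; exact: coord_continuous. Qed.

Lemma flag_cvg (T : Type) (F : set_system T) (FF : Filter F)
    (u : T -> 'M[K]_d) x : x \in unitmx ->
  mcvg F u x -> (fun t => flag_of_frame theta (u t)) @ F --> flag_of_frame theta x.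
Proof.
move=> xU ux N; rewrite nbhsE => -[V [Vo Vx] VN].
have Vopen : open [set y : 'M[K]_d | y \in unitmx /\ V (flag_of_frame theta y)].
  exact: Vo.
have FV := mcvg_nbhs FF ux (open_nbhs_nbhs (conj Vopen (conj xU Vx))).
by apply: (@filterS _ F _ _ _ _ FV) => t /= [_ Vt]; exact: VN.
Qed.

Lemma flag_of_frame_mul A x y : A \in unitmx -> x \in unitmx -> y \in unitmx ->
  flag_of_frame theta x = flag_of_frame theta y ->
  flag_of_frame theta (A *m x) = flag_of_frame theta (A *m y).
Proof.
move=> AU xU yU /flag_of_frameP xy; apply/flag_of_frameP => i it.
exact: frame_subspace_mul (xy i it).
Qed.

Lemma minor_flag_eq i x y (f g : {ffun 'I_(mdim i) -> 'I_d}) :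
  x \in unitmx -> y \in unitmx -> frame_subspace x i = frame_subspace y i ->
  minor x f (lead i) * minor y g (lead i) = minor x g (lead i) * minor y f (lead i).
Proof.
move=> xU yU /(frame_subspace_eq _ xU yU) u.
have [p pu ->] : exists2 p, upper i p & x = y *m p.
  by exists (invmx y *m x) => //; rewrite mulKVmx.
by rewrite !minor_upper //; ring.
Qed.

(** The map from frames to flags is open: the frames with the same flags as those in N form the
    union of the translates of N by the stabilizer of the standard flag. *)
Lemma flag_open_frames (N : set 'M[K]_d) : open N ->
  open [set Fl : flag K theta |
    exists y, [/\ N y, y \in unitmx & flag_of_frame theta y = Fl]].
Proof.
move=> No; rewrite /open /= /flag_open.
pose P := [set p : 'M[K]_d | p \in unitmx /\ forall x, x \in unitmx ->
  flag_of_frame theta (x *m p) = flag_of_frame theta x].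
rewrite (_ : [set x | _] = [set x : 'M[K]_d | x \in unitmx] `&`
    \bigcup_(p in P) [set x | N (x *m p)]); last first.
  apply/seteqP; split=> x /=.
    move=> [xU [y [Ny yU yx]]]; split => //; exists (invmx x *m y) => /=; last first.
      by rewrite mulKVmx.
    split=> [|z zU]; first by rewrite unitmx_mul unitmx_inv xU.
    rewrite mulmxA (flag_of_frame_mul _ yU xU yx) ?unitmx_mul ?unitmx_inv ?zU //.
    by rewrite mulmxKV.
  move=> [xU [p [pU pP] Nxp]]; split => //; exists (x *m p).
  by split => //; [rewrite unitmx_mul xU|exact: pP].
apply: openI.
  have := @flag_openT d K theta; rewrite /flag_open; congr open.
  by apply/seteqP; split=> x /=; [case|].
apply: bigcup_open => p _; rewrite openE => x /= Nxp.
apply: (@mcvg_nbhs _ _ _ (fun y => y *m p) (x *m p) N).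
  by apply: mcvg_mul; [exact: mcvg_id|exact: mcvg_cst].
exact: open_nbhs_nbhs.
Qed.

(** If the flags of x and of the limit differed, some 2 by 2 determinant of their Plücker
    coordinates would be nonzero, and would stay so for frames near the limit paired with almost all
    u t. Convergence of the flags yields such frames with the very flag of u t, for which it is
    0. *)
Lemma flag_lim_unique (T : Type) (F : set_system T) (FF : ProperFilter F)
    (u : T -> 'M[K]_d) x Fl :
  (forall t, u t \in unitmx) -> x \in unitmx -> mcvg F u x ->
  (fun t => flag_of_frame theta (u t)) @ F --> Fl -> Fl = flag_of_frame theta x.
Proof.
move=> uU xU ux uFl.
(* A flag without a frame would be an isolated point of the quotient topology, so convergence to it
   would make it the flag of some u t. *)
have [[y yU yFl]|nFl] := pselect (exists2 y, y \in unitmx & flag_of_frame theta y = Fl); last first.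
  have : F [set t | flag_of_frame theta (u t) = Fl].
    apply: (uFl [set Fl]); apply: open_nbhs_nbhs; split => //.
    rewrite /open /= /flag_open (_ : [set _ | _] = set0); first exact: open0.
    by apply/seteqP; split=> z //= -[zU zF]; apply: nFl; exists z.
  by move=> /filter_ex[t tF]; case: nFl; exists (u t).
rewrite -yFl; apply/flag_of_frameP => i it.
have D0 f g : minor y f (lead i) * minor x g (lead i) =
    minor y g (lead i) * minor x f (lead i).
  apply/eqP; rewrite -subr_eq0; set D := _ - _; apply/negP => /negP DN0.
  (* In the product filter the neighbourhood of y does not depend on t, so the frame z may be chosen
     after t. *)
  pose FF2 := filter_prod (nbhs y) F.
  have cy : mcvg FF2 (fun z => z.1) y.
    move=> a b; have := @mcvg_id y a b; apply: cvg_comp; exact: cvg_fst.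
  have cx : mcvg FF2 (fun z => u z.2) x.
    move=> a b; have := ux a b; apply: cvg_comp; exact: cvg_snd.
  have : (fun z : 'M[K]_d * T => minor z.1 f (lead i) * minor (u z.2) g (lead i) -
      minor z.1 g (lead i) * minor (u z.2) f (lead i)) @ FF2 --> D.
    apply: cvgB; apply: cvgM; apply: cvg_det; exact: mcvg_sub.
  move=> /cvg_rabsP/(_ (rabs D)); rewrite rabs_gt0 => /(_ DN0)[[N S] /= [Ny FS] NS].
  have FW : F [set t | exists z, [/\ N° z, z \in unitmx &
      flag_of_frame theta z = flag_of_frame theta (u t)]].
    apply: (uFl [set Fl' | exists z, [/\ N° z, z \in unitmx &
      flag_of_frame theta z = Fl']]); apply: open_nbhs_nbhs; split.
      by apply: flag_open_frames; exact: open_interior.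
    by exists y.
  have [t [/= St [z [Nz zU zu]]]] := filter_ex (filterI FS FW).
  have := NS (z, t) (conj (interior_subset Nz) St) => /=.
  move/flag_of_frameP : zu => /(_ i it) zu.
  by rewrite (minor_flag_eq f g zU (uU t) zu) subrr subr0 ltxx.
have [g0 g0N0] := minor_col_neq0 i xU.
by apply: (frame_minor_prop yU xU g0N0 (b := minor y g0 (lead i))) => f; rewrite mulrC D0.
Qed.

End FlagTopology.

Section Subsequences.
Variables (R : realType) (k : RC) (d : nat) (theta : {set 'I_d.-1}).
Local Notation K := (RCfield R k).
Local Notation PSLK := (PSL d K).
Variables (T : Type) (F : set_system T) (UF : UltraFilter F).
Variable Gamma : set PSLK.
Hypothesis divGamma : divergent theta Gamma.
Implicit Types (gam : T -> PSLK).

(** Finiteness is the form of divergence that ultrafilters can use: on a finite set of values a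
    sequence is constant almost everywhere. *)
Lemma divergent_finite (M : R) : finite_set [set g | Gamma g /\
  exists2 i, i \in theta & simple_root i (cartan_proj g) <= M].
Proof.
apply: contrapT => Sinf; have [gam gamI gamP] := choose_injective (fun=> Sinf).
have := divGamma gamI (fun n => (gamP n).1).
move=> /cvgeyPgt/(_ M)[n _ /(_ n (leqnn n)) /=].
apply/negP; rewrite -leNgt; have [_ [i it iM]] := gamP n.
by apply: le_trans (bigmin_le_cond _ _ it) _; rewrite lee_fin.
Qed.

(* Along an ultrafilter, this replaces the injectivity of the sequence. *)
Definition nonconst gam : Prop := forall g, ~ F [set t | gam t = g].

Lemma nonconst_root gam M : (forall t, Gamma (gam t)) -> nonconst gam ->
  F [set t | forall i, i \in theta -> M < simple_root i (cartan_proj (gam t))].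
Proof.
move=> gamG gamN.
have : F (~` [set t | Gamma (gam t) /\
  exists2 i, i \in theta & simple_root i (cartan_proj (gam t)) <= M]).
  apply: (ultraN UF) => Fn.
  have [g Fg] := ultra_finite_set UF (divergent_finite M) Fn.
  exact: gamN Fg.
apply: filterS => t nt i it; rewrite ltNge; apply/negP => iM; apply: nt.
by split => //; exists i.
Qed.

(** [limit_set] asks for an injective sequence with an ordinary limit. As gam is not almost
    constant, infinitely many of its values have frames within 1/(n + 1) of x, and distinct ones can
    be picked. *)
Lemma limit_set_frames gam (u : T -> 'M[K]_d) x : nonconst gam ->
  (forall t, Gamma (gam t)) ->
  (forall t, U_theta theta (gam t) = flag_of_frame theta (u t)) ->
  x \in unitmx -> mcvg F u x -> limit_set theta Gamma (flag_of_frame theta x).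
Proof.
move=> gamN gamG gamE xU ux.
pose S n := [set g | exists t, [/\ gam t = g &
  forall ij : 'I_d * 'I_d, rabs (x ij.1 ij.2 - u t ij.1 ij.2) < n.+1%:R^-1]].
have Sinf n : infinite_set (S n).
  move=> Sfin.
  have Fn : F [set t | forall ij : 'I_d * 'I_d,
      rabs (x ij.1 ij.2 - u t ij.1 ij.2) < n.+1%:R^-1].
    apply: (filter_forall _ (f := fun ij t => rabs (x ij.1 ij.2 - u t ij.1 ij.2) < n.+1%:R^-1)).
    by move=> [i j]; have /cvg_rabsP := ux i j; apply; rewrite invr_gt0.
  have FS : F [set t | S n (gam t)] by apply: filterS Fn => t tn; exists t.
  by have [g Fg] := ultra_finite_set UF Sfin FS; exact: gamN Fg.
have [h hI hS] := choose_injective Sinf.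
pose t n := projT1 (cid (hS n)).
have tP n : gam (t n) = h n /\
    forall ij : 'I_d * 'I_d, rabs (x ij.1 ij.2 - u (t n) ij.1 ij.2) < n.+1%:R^-1.
  by rewrite /t; case: cid => s /= [].
exists h; split => // [n|]; first by rewrite -(tP n).1.
have -> : (fun n => U_theta theta (h n)) = fun n => flag_of_frame theta (u (t n)).
  by apply/funext => n; rewrite -(tP n).1.
apply: flag_cvg => // i j; apply/cvg_rabsP => e e0.
have := near_infty_natSinv_lt (PosNum e0); apply: filterS => n /=.
by apply: lt_trans; exact: ((tP n).2 (i, j)).
Qed.

Lemma gap_cvg gam i : (forall t, Gamma (gam t)) -> nonconst gam -> i \in theta ->
  (fun t => sing_vals (gam t) 0 (ord_next i) / sing_vals (gam t) 0 (ord_cur i)) @ F --> (0 : R).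
Proof.
move=> gamG gamN it; apply/(@cvgrPdist_lt _ R) => e e0.
apply: filterS (nonconst_root (- ln e) gamG gamN) => t /(_ i it).
have sn := sing_vals_gt0 (gam t) (ord_next i); have sc := sing_vals_gt0 (gam t) (ord_cur i).
rewrite /simple_root !mxE -/(sing_vals (gam t)) => H.
rewrite sub0r normrN gtr0_norm ?divr_gt0 // -ltr_ln ?posrE ?divr_gt0 //.
by rewrite ln_div ?posrE //; lra.
Qed.

End Subsequences.

Section Extract.
Variables (R : realType) (k : RC) (d : nat) (theta : {set 'I_d.-1}).
Local Notation K := (RCfield R k).
Local Notation ofR := (@RCof_real R k).
Local Notation PSLK := (PSL d K).
Variables (T : Type) (F : set_system T) (UF : UltraFilter F).
Variable Gamma : set PSLK.
Hypothesis thetaS : symmetric_roots theta.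
Hypothesis divGamma : divergent theta Gamma.
Implicit Types (gam : T -> PSLK) (x v : 'M[K]_d).

Definition tends gam x v : Prop :=
  [/\ x \in unitmx, v \in unitmx & attracts F theta (fun t => lift_mx (gam t)) x v].

Lemma tends_unique gam x v x' v' : tends gam x v -> tends gam x' v' ->
  flag_of_frame theta x = flag_of_frame theta x'.
Proof. by move=> [xU vU gx] [xU' vU' gx']; exact: attracts_unique gx gx'. Qed.

Lemma svd_limit gam : (forall t, Gamma (gam t)) -> nonconst F gam ->
  exists u s (v : T -> 'M[K]_d), exists x y, [/\
    forall t, is_svd (lift_mx (gam t)) (u t) (s t) (v t) /\ s t = sing_vals (gam t),
    forall t, U_theta theta (gam t) = flag_of_frame theta (u t),
    mcvg F u x /\ is_unitary x, mcvg F v y /\ is_unitary y & tends gam x y].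
Proof.
move=> gamG gamN.
have uvex t : exists uv : 'M[K]_d * 'M[K]_d,
    is_svd (lift_mx (gam t)) uv.1 (sing_vals (gam t)) uv.2 /\
    U_theta theta (gam t) = flag_of_frame theta uv.1.
  by have [u [v [gE Ug _]]] := PSL_svd theta (gam t); exists (u, v).
pose uv t := projT1 (cid (uvex t)).
have uvP t : is_svd (lift_mx (gam t)) (uv t).1 (sing_vals (gam t)) (uv t).2 /\
    U_theta theta (gam t) = flag_of_frame theta (uv t).1.
  by rewrite /uv; case: cid.
have uu t : is_unitary (uv t).1 by have [[]] := uvP t.
have vv t : is_unitary (uv t).2 by have [[]] := uvP t.
have [x xx ux] := unitary_ultra_lim UF uu.
have [y yy vy] := unitary_ultra_lim UF vv.
exists (fun t => (uv t).1), (fun t => sing_vals (gam t)), (fun t => (uv t).2), x, y.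
split => // [t|t|]; [by split => //; have [] := uvP t|by have [] := uvP t|].
split; [exact: unitary_unitmx|exact: unitary_unitmx|].
rewrite (_ : (fun t => _) = fun t => (uv t).1 *m
    diag_mx (map_mx ofR (sing_vals (gam t))) *m (uv t).2); last first.
  by apply/funext => t; have [[]] := uvP t.
apply: svd_attracts => // [t b|t a b|i it]; [exact: sing_vals_gt0|exact: sing_vals_noninc|].
exact: (gap_cvg UF divGamma).
Qed.

Hypothesis GammaV : forall g, Gamma g -> Gamma g^-1%g.

(** Inverting a decomposition exchanges u and v and reverses the order of the singular values, which
    [rev_mx] restores. The gap of the inverse at i is the gap of gam at [rev_ord i]; hence the
    symmetry of theta. *)
Lemma svd_limit_inv gam u (s : T -> 'rV[R]_d) (v : T -> 'M[K]_d) x y :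
  (forall t, Gamma (gam t)) -> nonconst F gam ->
  (forall t, is_svd (lift_mx (gam t)) (u t) (s t) (v t) /\ s t = sing_vals (gam t)) ->
  mcvg F u x -> is_unitary x -> mcvg F v y -> is_unitary y ->
  tends (fun t => (gam t)^-1%g) (dual_frame y) (coframe x).
Proof.
move=> gamG gamN gE ux xx vy yy.
have xU := unitary_unitmx xx; have yU := unitary_unitmx yy.
split; [exact: dual_frame_unit|exact: coframe_unit|].
pose s' t : 'rV[R]_d := \row_b (s t 0 (rev_ord b))^-1.
have s0 t b : 0 < s t 0 b by rewrite (gE t).2 sing_vals_gt0.
have sd t (a b : 'I_d) : (a <= b)%N -> s t 0 b <= s t 0 a.
  by rewrite (gE t).2; exact: sing_vals_noninc.
have adj_cvg (w : T -> 'M[K]_d) z : mcvg F w z ->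
    mcvg F (fun t => adjoint (w t)) (adjoint z).
  move=> wz i j; rewrite adjointE; under eq_fun do rewrite adjointE.
  by apply: cvg_conj; exact: wz.
rewrite /dual_frame /coframe !unitary_inv //.
(* Without simple roots the claim is empty; otherwise d > 0, as needed to compare lifts. *)
have [i0|no_index] := pselect (exists i : 'I_d.-1, True); last first.
  by move=> i; case: no_index; exists i.
have d0 : (0 < d)%N by have [i _] := i0; exact: index_gt0 i.
have cex t : exists c : K, c != 0 /\ lift_mx (gam t)^-1%g = c *: invmx (lift_mx (gam t)).
  have [c c1 cE] := lift_inv (gam t) d0; exists c; split => //.
  by rewrite -rabs_gt0 c1.
pose c t := projT1 (cid (cex t)).
have cP t : c t != 0 /\ lift_mx (gam t)^-1%g = c t *: invmx (lift_mx (gam t)).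
  by rewrite /c; case: cid.
apply: (attracts_scale (fun t => (cP t).1) (fun t => (cP t).2)).
rewrite (_ : (fun t => _) = fun t => (adjoint (v t) *m rev_mx d K) *m
    diag_mx (map_mx ofR (s' t)) *m (rev_mx d K *m adjoint (u t))); last first.
  apply/funext => t; have [[/[dup] uu /unitary_adj uu' /[dup] vv /unitary_adj vv' _ _ E] _] := gE t.
  have gU := lift_unit (gam t).
  apply: (can_inj (mulKmx gU)); rewrite mulmxV // E.
  have revD : rev_mx d K *m diag_mx (map_mx ofR (s' t)) *m rev_mx d K =
      diag_mx (map_mx ofR (map_mx GRing.inv (s t))).
    apply/matrixP => a b; rewrite -mulmxA rev_mxE mul_diag_mx !mxE rev_ordK.
    rewrite (inj_eq rev_ord_inj); case: eqP => [->|_].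
      by rewrite mulr1n mulr1.
    by rewrite mulr0n mulr0.
  have -> : adjoint (v t) *m rev_mx d K *m diag_mx (map_mx ofR (s' t)) *m
      (rev_mx d K *m adjoint (u t)) =
      adjoint (v t) *m diag_mx (map_mx ofR (map_mx GRing.inv (s t))) *m adjoint (u t).
    by rewrite -revD !mulmxA.
  have DD : diag_mx (map_mx ofR (s t)) *m
      diag_mx (map_mx ofR (map_mx GRing.inv (s t))) = 1%:M.
    rewrite mulmx_diag -diag_const_mx; congr diag_mx; apply/rowP => b; rewrite !mxE.
    by rewrite -rmorphM mulfV ?rmorph1 // gt_eqF.
  rewrite !mulmxA -(mulmxA _ (v t)) (unitaryP _).1 // mulmx1.
  by rewrite -(mulmxA (u t)) DD mulmx1 (unitaryP _).1.
apply: svd_attracts => [t b|t a b ab|i it||].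
- by rewrite mxE invr_gt0.
- rewrite !mxE lef_pV2 ?posrE //; apply: sd => /=; rewrite leq_sub2l //.
- have jt : rev_ord i \in theta by rewrite -thetaS.
  rewrite (_ : (fun t => _) = fun t => sing_vals (gam t) 0 (ord_next (rev_ord i)) /
      sing_vals (gam t) 0 (ord_cur (rev_ord i))); first exact: (gap_cvg UF divGamma).
  apply/funext => t; rewrite -(gE t).2 !mxE invrK mulrC.
  have id : (i.+1 < d)%N := ord_next_subproof i.
  congr (_ / _); congr (s t 0 _); apply: val_inj => /=.
    by move: id; clear; move: (nat_of_ord i) => m; lia.
  by move: id; clear; move: (nat_of_ord i) => m; lia.
- by apply: mcvg_mul; [exact: adj_cvg|exact: mcvg_cst].
- by apply: mcvg_mul; [exact: mcvg_cst|exact: adj_cvg].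
Qed.

Lemma nonconstV gam : nonconst F gam -> nonconst F (fun t => (gam t)^-1%g).
Proof.
move=> gamN g Fg; apply: (gamN g^-1%g); apply: filterS Fg => t /= <-.
by rewrite invgK.
Qed.

(** The convergence property of divergent groups. The repelling flag is a limit flag because it is
    the attracting flag of the inverses: their own decomposition provides a limit flag, which is the
    same by [tends_unique]. *)
Lemma extract gam : (forall t, Gamma (gam t)) -> nonconst F gam ->
  exists x v, [/\ tends gam x v,
    tends (fun t => (gam t)^-1%g) (dual_frame v) (coframe x),
    limit_set theta Gamma (flag_of_frame theta x),
    limit_set theta Gamma (flag_of_frame theta (dual_frame v)) &
    forall Fl, (fun t => U_theta theta (gam t)) @ F --> Fl ->
      Fl = flag_of_frame theta x].
Proof.
move=> gamG gamN.
have [u [s [v [x [y [gE Ug [ux xx] [vy yy] gxy]]]]]] := svd_limit gamG gamN.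
have gamGV t : Gamma (gam t)^-1%g by exact: GammaV.
have gamNV := nonconstV gamN.
have [u' [s' [v' [x' [y' [gE' Ug' [ux' xx'] [vy' yy'] gxy']]]]]] := svd_limit gamGV gamNV.
have gV := svd_limit_inv gamG gamN gE ux xx vy yy.
exists x, y; split => //.
- by apply: (limit_set_frames UF gamN gamG Ug _ ux); exact: unitary_unitmx.
- rewrite (tends_unique gV gxy').
  by apply: (limit_set_frames UF gamNV gamGV Ug' _ ux'); exact: unitary_unitmx.
- move=> Fl; rewrite (_ : (fun t => _) = fun t => flag_of_frame theta (u t)).
    apply: flag_lim_unique => //; last exact: unitary_unitmx.
    by move=> t; apply: unitary_unitmx; have [[]] := gE t.
  exact/funext.
Qed.

Lemma tends_mull h gam x v : tends gam x v ->
  tends (fun t => (h * gam t)%g) (lift_mx h *m x) v.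
Proof.
move=> [xU vU gx]; split => //; first by rewrite unitmx_mul lift_unit.
have [i0|no_index] := pselect (exists i : 'I_d.-1, True); last first.
  by move=> i; case: no_index; exists i.
have d0 : (0 < d)%N by have [i _] := i0; exact: index_gt0 i.
have cex t : exists c : K, c != 0 /\ lift_mx (h * gam t)%g = c *: (lift_mx h *m lift_mx (gam t)).
  have [c c1 cE] := lift_mul h (gam t) d0; exists c; split => //.
  by rewrite -rabs_gt0 c1.
exact: (attracts_scale (fun t => (projT2 (cid (cex t))).1)
  (fun t => (projT2 (cid (cex t))).2) (attracts_mull (lift_mx h) gx)).
Qed.

Lemma tends_mulr h gam x v : tends gam x v ->
  tends (fun t => (gam t * h)%g) x (v *m lift_mx h).
Proof.
move=> [xU vU gx]; split => //; first by rewrite unitmx_mul lift_unit vU.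
have [i0|no_index] := pselect (exists i : 'I_d.-1, True); last first.
  by move=> i; case: no_index; exists i.
have d0 : (0 < d)%N by have [i _] := i0; exact: index_gt0 i.
have cex t : exists c : K, c != 0 /\ lift_mx (gam t * h)%g = c *: (lift_mx (gam t) *m lift_mx h).
  have [c c1 cE] := lift_mul (gam t) h d0; exists c; split => //.
  by rewrite -rabs_gt0 c1.
exact: (attracts_scale (fun t => (projT2 (cid (cex t))).1)
  (fun t => (projT2 (cid (cex t))).2) (attracts_mulr (lift_mx h) gx)).
Qed.

Lemma tends_comp gam x v gam' x' v' : pairs_with theta v x' ->
  tends gam x v -> tends gam' x' v' -> tends (fun t => (gam t * gam' t)%g) x v'.
Proof.
move=> vx' [xU vU gx] [xU' vU' gx']; split => //.
have [i0|no_index] := pselect (exists i : 'I_d.-1, True); last first.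
  by move=> i; case: no_index; exists i.
have d0 : (0 < d)%N by have [i _] := i0; exact: index_gt0 i.
have cex t : exists c : K, c != 0 /\
    lift_mx (gam t * gam' t)%g = c *: (lift_mx (gam t) *m lift_mx (gam' t)).
  have [c c1 cE] := lift_mul (gam t) (gam' t) d0; exists c; split => //.
  by rewrite -rabs_gt0 c1.
exact: (attracts_scale (fun t => (projT2 (cid (cex t))).1)
  (fun t => (projT2 (cid (cex t))).2) (attracts_comp vx' gx gx')).
Qed.

Lemma om_comp gam x v gam' x' v' i : i \in theta -> pairs_with theta v x' ->
  tends gam x v -> tends gam' x' v' ->
  exists C, F [set t | om i (gam t) + om i (gam' t) <= om i (gam t * gam' t)%g + C].
Proof.
move=> it vx' [xU vU gx] [xU' vU' gx'].
have [C C0 FC] := attracts_norm_comp it xU vU xU' vU' vx' gx gx'.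
exists (ln C); apply: filterS FC => t /=.
have [c c1 cE] := lift_mul (gam t) (gam' t) (index_gt0 i).
have N0 : 0 < minor_norm i (lift_mx (gam t) *m lift_mx (gam' t)).
  by apply: minor_norm_gt0; rewrite unitmx_mul !lift_unit.
rewrite -ler_ln ?posrE ?mulr_gt0 ?om_norm_gt0 // !lnM ?posrE ?om_norm_gt0 //.
by rewrite /om cE minor_normZ c1 expr1n mul1r (addrC (ln C)).
Qed.

Lemma nonconst_om gam i M : i \in theta -> (forall t, Gamma (gam t)) ->
  nonconst F gam -> F [set t | M < om i (gam t)].
Proof.
move=> it gamG gamN; have [C CP] := weight_om_close R k i.
apply: filterS (nonconst_root UF divGamma (2 * (M + C)) gamG gamN) => t /(_ i it).
have H (a w o : R) : a <= 2 * w -> `|w - o| <= C -> 2 * (M + C) < a -> M < o.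
  by rewrite ler_norml => ? /andP[? ?] ?; lra.
exact: H (simple_root_le_weight i (gam t)) (CP (gam t)).
Qed.

Hypothesis transGamma : forall F G, limit_set theta Gamma F ->
  limit_set theta Gamma G -> F <> G -> transverse F G.

Lemma limit_pairs v x : v \in unitmx -> x \in unitmx ->
  limit_set theta Gamma (flag_of_frame theta x) ->
  limit_set theta Gamma (flag_of_frame theta (dual_frame v)) ->
  flag_of_frame theta x <> flag_of_frame theta (dual_frame v) ->
  pairs_with theta v x.
Proof.
move=> vU xU xL vL xv; apply: transverse_pairs => //.
exact: transGamma.
Qed.

Lemma tends_limit gam x v : (forall t, Gamma (gam t)) -> nonconst F gam ->
  tends gam x v -> limit_set theta Gamma (flag_of_frame theta x).
Proof.
move=> gamG gamN gx; have [x' [v' [gx' _ xL _ _]]] := extract gamG gamN.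
by rewrite (tends_unique gx gx').
Qed.

End Extract.

(** * No limit flag is fixed by the group *)

Section FixedFlags.
Variables (R : realType) (k : RC) (d : nat) (theta : {set 'I_d.-1}).
Local Notation K := (RCfield R k).
Local Notation PSLK := (PSL d K).
Implicit Types (x y v : 'M[K]_d) (g h : PSLK) (i : 'I_d.-1).

Definition fixes h x : Prop :=
  flag_of_frame theta (lift_mx h *m x) = flag_of_frame theta x.

(* If h fixes the flag of x, this is the modulus of the eigenvalue of h on the
   line spanned by the i-th exterior power of that flag. *)
Definition chi i x h : R :=
  rabs (minor (invmx x *m lift_mx h *m x) (lead i) (lead i)).

Lemma flag_lift_mul g h x : x \in unitmx ->
  flag_of_frame theta (lift_mx (g * h)%g *m x) =
  flag_of_frame theta (lift_mx g *m (lift_mx h *m x)).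
Proof.
move=> xU; apply/flag_of_frameP => i it.
have [c c1 cE] := lift_mul g h (index_gt0 i).
rewrite cE -scalemxAl frame_subspace_scale ?mulmxA //.
  by rewrite -rabs_gt0 c1.
by rewrite !unitmx_mul !lift_unit.
Qed.

Lemma fixesM g h x : x \in unitmx -> fixes g x -> fixes h x -> fixes (g * h)%g x.
Proof.
move=> xU gx hx; rewrite /fixes flag_lift_mul //.
by rewrite (flag_of_frame_mul (lift_unit g) _ xU hx) // unitmx_mul lift_unit.
Qed.

Lemma lift_one : (0 < d)%N -> exists2 c : K, rabs c = 1 & lift_mx (1%g : PSLK) = c%:M.
Proof.
move=> d0; have [c cE] := repr_pi (SL_one d K).
exists c; last by rewrite -[RHS]mulmx1; exact: cE.
exact: det1_scalar_rabs cE.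
Qed.

Lemma fixes1 x : x \in unitmx -> fixes 1%g x.
Proof.
move=> xU; apply/flag_of_frameP => i it.
have [c c1 ->] := lift_one (index_gt0 i).
by rewrite mul_scalar_mx frame_subspace_scale // -rabs_gt0 c1.
Qed.

Lemma fixesV h x : x \in unitmx -> fixes h x -> fixes h^-1%g x.
Proof.
move=> xU hx; have := fixes1 xU; rewrite -(mulVg h) /fixes flag_lift_mul // => <-.
by apply/esym/flag_of_frame_mul; rewrite ?lift_unit ?unitmx_mul ?lift_unit.
Qed.

Lemma fixes_upper h x i : x \in unitmx -> i \in theta -> fixes h x ->
  upper i (invmx x *m lift_mx h *m x).
Proof.
move=> xU it /flag_of_frameP/(_ i it); rewrite -mulmxA.
by move/(frame_subspace_eq i (x := lift_mx h *m x)); apply; rewrite ?unitmx_mul ?lift_unit.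
Qed.

Lemma minor_fixes h x i (f : {ffun 'I_(mdim i) -> 'I_d}) :
  x \in unitmx -> i \in theta -> fixes h x ->
  minor (lift_mx h *m x) f (lead i) =
  minor x f (lead i) * minor (invmx x *m lift_mx h *m x) (lead i) (lead i).
Proof.
move=> xU it hx; rewrite -minor_upper; last exact: fixes_upper.
by rewrite -mulmxA mulKVmx.
Qed.

Lemma chiM i x g h : x \in unitmx -> i \in theta -> fixes g x -> fixes h x ->
  chi i x (g * h)%g = chi i x g * chi i x h.
Proof.
move=> xU it gx hx; rewrite /chi -rabsM -minor_upper; last exact: fixes_upper.
have [c c1 cE] := lift_mul g h (index_gt0 i).
rewrite cE -scalemxAr -scalemxAl minorZ rabsM rabsX c1 expr1n mul1r.
by congr (rabs (minor _ _ _)); rewrite -!mulmxA mulKVmx.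
Qed.

Lemma chi1 i x : x \in unitmx -> chi i x 1%g = 1.
Proof.
move=> xU; rewrite /chi; have [c c1 ->] := lift_one (index_gt0 i).
rewrite mul_mx_scalar -scalemxAl mulVmx // minorZ minor1_lead mulr1 rabsX c1.
by rewrite expr1n.
Qed.

Lemma chiV i x h : x \in unitmx -> i \in theta -> fixes h x ->
  chi i x h * chi i x h^-1%g = 1.
Proof. by move=> xU it hx; rewrite -chiM ?mulgV ?chi1 //; exact: fixesV. Qed.

Lemma chi_gt0 i x h : x \in unitmx -> i \in theta -> fixes h x -> 0 < chi i x h.
Proof.
move=> xU it hx; rewrite lt_def rabs_ge0 andbT; apply/negP => /eqP c0.
by have := chiV xU it hx; rewrite c0 mul0r => /esym/eqP; rewrite oner_eq0.
Qed.

Lemma fixes_exp h x n : x \in unitmx -> fixes h x -> fixes (h ^+ n)%g x.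
Proof.
move=> xU hx; elim: n => [|n IH]; first by rewrite expg0; exact: fixes1.
by rewrite expgS; exact: fixesM.
Qed.

Lemma chi_exp i x h n : x \in unitmx -> i \in theta -> fixes h x ->
  chi i x (h ^+ n)%g = chi i x h ^+ n.
Proof.
move=> xU it hx; elim: n => [|n IH]; first by rewrite expg0 chi1.
by rewrite expgS chiM // ?IH ?exprS //; exact: fixes_exp.
Qed.

Lemma om_lower i : exists C, forall g, - C <= om i g.
Proof.
have [C CP] := weight_om_close R k i; exists C => g.
have := CP g; rewrite ler_norml => /andP[_].
set w : R := fund_weight _ _; suff : 0 <= w by move=> *; lra.
have sr : 0 <= simple_root i (cartan_proj g) :> R.
  rewrite /simple_root !mxE subr_ge0 ler_ln ?posrE ?sing_vals_gt0 //.
  by apply: sing_vals_noninc; rewrite /= leqnSn.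
have := le_trans sr (simple_root_le_weight i g); rewrite -/w.
by rewrite pmulr_rge0.
Qed.

Variables (T : Type) (F : set_system T) (UF : UltraFilter F).
Implicit Types gam : T -> PSLK.
Local Notation tends := (tends theta F).

Lemma tends_near gam gam' x v : F [set t | gam t = gam' t] ->
  tends gam x v -> tends gam' x v.
Proof.
move=> Fg [xU vU gx]; split => // i it; have [c c0 cA] := gx i it.
exists c => // f g; apply/cvg_rabsP => e e0.
have /cvg_rabsP/(_ e e0) := cA f g => Fe.
by apply: filterS (filterI Fg Fe) => t /= [->].
Qed.

(** Two frames of one flag have proportional Plücker coordinates, and the factor goes into the
    normalization c. *)
Lemma tends_flag gam x x' v : x' \in unitmx ->
  flag_of_frame theta x = flag_of_frame theta x' ->
  tends gam x v -> tends gam x' v.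
Proof.
move=> xU' /flag_of_frameP xx' [xU vU gx]; split => // i it.
have [c c0 cA] := gx i it; have [f0 f0N0] := minor_col_neq0 i xU.
have prop f := minor_flag_eq f f0 xU xU' (xx' i it).
have f0N0' : minor x' f0 (lead i) != 0.
  have [f1 f1N0] := minor_col_neq0 i xU'.
  apply/eqP => z; have := prop f1; rewrite z mulr0 => /esym/eqP.
  by rewrite mulf_eq0 (negPf f0N0) (negPf f1N0).
exists (fun t => minor x' f0 (lead i) / minor x f0 (lead i) * c t) => [t|f g].
  by rewrite !mulf_neq0 // invr_eq0.
under eq_fun do rewrite -mulrA.
rewrite (_ : minor x' f (lead i) * _ = minor x' f0 (lead i) / minor x f0 (lead i) *
  (minor x f (lead i) * minor v (lead i) g)); last first.
  apply: (mulfI f0N0); rewrite [LHS]mulrA -prop [RHS]mulrA.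
  by rewrite [X in _ = X * _]mulrC divfK // mulrA [X in X * _ = _]mulrC.
by apply: cvgM; [exact: cvg_cst|exact: cA].
Qed.

(** A flag z transverse to the repelling flag is carried towards the flag of x, but here it does not
    move. *)
Lemma attracted_fixed gam x v z : tends gam x v -> pairs_with theta v z ->
  z \in unitmx -> (forall t, fixes (gam t) z) ->
  flag_of_frame theta x = flag_of_frame theta z.
Proof.
move=> [xU vU gx] vz zU gz; apply/flag_of_frameP => i it.
have [c c0 cA] := attracts_mulr z gx it.
have m0 := vz i it; have [f0 f0N0] := minor_col_neq0 i zU.
apply: (frame_minor_prop xU zU f0N0 (b := minor x f0 (lead i))) => f.
have cv f1 : (fun t => c t * minor (lift_mx (gam t) *m z) f1 (lead i)) @ F -->
    minor x f1 (lead i) * minor (v *m z) (lead i) (lead i) by exact: cA.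
pose w t := c t * minor (lift_mx (gam t) *m z) f (lead i) * minor z f0 (lead i).
have c1 : w @ F --> minor x f (lead i) * minor (v *m z) (lead i) (lead i) *
    minor z f0 (lead i) by apply: cvgM; [exact: cv|exact: cvg_cst].
have c2 : w @ F --> minor x f0 (lead i) * minor (v *m z) (lead i) (lead i) *
    minor z f (lead i).
  rewrite (_ : w = fun t => c t * minor (lift_mx (gam t) *m z) f0 (lead i) *
      minor z f (lead i)); first by apply: cvgM; [exact: cv|exact: cvg_cst].
  apply/funext => t; have /flag_of_frameP/(_ i it) zz := gz t.
  have := minor_flag_eq f f0 _ zU zz; rewrite unitmx_mul lift_unit zU => /(_ isT) E.
  by rewrite /w -!mulrA E.
apply: (mulfI m0).
transitivity (minor x f (lead i) * minor (v *m z) (lead i) (lead i) *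
    minor z f0 (lead i)); first by ring.
by rewrite (cvgK_unique c1 c2); ring.
Qed.

Variable Gamma : set PSLK.
Hypothesis divGamma : divergent theta Gamma.

(** A flag transverse to the repelling flag has Plücker coordinates that gam t stretches at the rate
    of its full norm, and the norm diverges. For a fixed flag this stretching factor is [chi]. *)
Lemma chi_large gam x v z i M : i \in theta -> (forall t, Gamma (gam t)) ->
  nonconst F gam -> tends gam x v -> pairs_with theta v z -> z \in unitmx ->
  (forall t, fixes (gam t) z) -> F [set t | M < chi i z (gam t)].
Proof.
move=> it gamG gamN [xU vU gx] vz zU gz.
have [c [l l0 [c0 [cA cN]]]] := attracts_norm it xU vU gx.
have [f0 f0N0] := minor_col_neq0 i xU.
have cz : (fun t => c t * minor (lift_mx (gam t) *m z) f0 (lead i)) @ F -->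
    minor x f0 (lead i) * minor (v *m z) (lead i) (lead i).
  have := minors_cvg_mul cA (@minors_cvg_cst _ F _ R k d i z) => /(_ _ _ f0 (lead i)).
  rewrite (sum_minor_lead 0 v z f0 (lead i) _).2.
  by under eq_fun do rewrite mulr1; apply.
set a := rabs (minor x f0 (lead i) * minor (v *m z) (lead i) (lead i)).
have a0 : 0 < a by rewrite rabs_gt0 mulf_neq0 // vz.
have a2 : 0 < a / 2 by rewrite divr_gt0.
have : (fun t => rabs (c t * minor (lift_mx (gam t) *m z) f0 (lead i))) @ F --> a.
  exact: cvg_rabs.
move=> /(@cvgrPdist_lt _ R)/(_ _ a2) Fa.
move: cN => /(@cvgrPdist_lt _ R)/(_ l l0) FN.
pose B := `|M| + 1; pose m := rabs (minor z f0 (lead i)).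
have B0 : 0 < B by rewrite ltr_pwDr.
(* The bounds a / 2 < C m ch and C N < 2 l below give ch > a N / (4 l m); the threshold on N makes
   this exceed B. Writing m + 1 for m keeps every factor positive. *)
have Fom := nonconst_om UF divGamma (ln (4 * l * (m + 1) * B / a)) it gamG gamN.
apply: filterS (filterI (filterI Fa FN) Fom) => t /= [[{}Fa {}FN]].
have m0 : 0 <= m := rabs_ge0 _.
have m1 : 0 < m + 1 by rewrite ltr_wpDl.
rewrite /om ltr_ln ?posrE ?om_norm_gt0 //; last first.
  by rewrite divr_gt0 // !mulr_gt0.
move=> {}Fom.
move: Fa; rewrite (minor_fixes _ zU it (gz t)) !rabsM -/m -/(chi i z (gam t)).
set ch := chi _ _ _ => Fa.
have ch0 : 0 <= ch := rabs_ge0 _.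
set C := rabs (c t) in Fa FN; have C0 : 0 < C by rewrite rabs_gt0.
set N := minor_norm _ _ in FN Fom.
have h1 : a / 2 < C * (m * ch) by move: Fa; rewrite ltr_norml => /andP[]; lra.
have h2 : C * N < 2 * l by move: FN; rewrite ltr_norml => /andP[]; lra.
have h3 : 4 * l * (m + 1) * B < N * a by rewrite -ltr_pdivrMr.
have MB : M < B by rewrite /B; have := ler_norm M; lra.
apply: lt_trans MB _.
rewrite ltNge; apply/negP => chB.
have h4 : a < 2 * C * (m + 1) * B.
  have : C * (m * ch) <= C * ((m + 1) * B).
    by rewrite (ler_pM2l C0); apply: ler_pM => //; lra.
  lra.
have : N * a <= N * (2 * C * (m + 1) * B).
  by rewrite ler_wpM2l ?minor_norm_ge0 // ltW.
have : 2 * ((m + 1) * B) * (C * N) <= 2 * ((m + 1) * B) * (2 * l).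
  by rewrite ler_wpM2l ?(ltW h2) // mulr_ge0 // mulr_ge0 // ltW.
lra.
Qed.

End FixedFlags.

Section NonElementary.
Variables (R : realType) (k : RC) (d : nat) (theta : {set 'I_d.-1}).
Local Notation K := (RCfield R k).
Local Notation PSLK := (PSL d K).
Variables (F : set_system nat) (UF : UltraFilter F).
Hypothesis ooF : \oo `<=` F.
Variable Gamma : set PSLK.
Hypothesis thetaS : symmetric_roots theta.
Hypothesis divGamma : divergent theta Gamma.
Hypothesis transGamma : forall F G, limit_set theta Gamma F ->
  limit_set theta Gamma G -> F <> G -> transverse F G.
Hypothesis GammaG : is_subgroup Gamma.
Local Notation tends := (tends theta F).
Local Notation flag_of := (flag_of_frame theta).
Implicit Types (x y v : 'M[K]_d).

Lemma subgroupM g h : Gamma g -> Gamma h -> Gamma (g * h)%g.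
Proof.
move=> gG hG; have := group_closedM GammaG => H.
by have := H g h; rewrite !inE /=; apply.
Qed.

Lemma subgroupV g : Gamma g -> Gamma g^-1%g.
Proof.
move=> gG; have := group_closedV GammaG => H.
by have := H g; rewrite !inE /=; apply.
Qed.

Lemma subgroup1 : Gamma 1%g.
Proof. by have := GammaG.1; rewrite inE. Qed.

Lemma subgroupX g n : Gamma g -> Gamma (g ^+ n)%g.
Proof.
move=> gG; elim: n => [|n IH]; first by rewrite expg0; exact: subgroup1.
by rewrite expgS; exact: subgroupM.
Qed.

Lemma injective_nonconst (gam : nat -> PSLK) : injective gam -> nonconst F gam.
Proof.
move=> gamI g Fg; have [n /= ng] := filter_ex Fg.
have Fn : F [set m | (n < m)%N] by apply: ooF; exists n.+1.
have [m [/= mg nm]] := filter_ex (filterI Fg Fn).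
by move: nm; rewrite (gamI m n) ?ltnn // mg ng.
Qed.

Lemma of_limit Fl : limit_set theta Gamma Fl -> exists gam x v,
  [/\ (forall n, Gamma (gam n)), nonconst F gam, flag_of x = Fl, tends gam x v &
   tends (fun t => (gam t)^-1%g) (dual_frame v) (coframe x) /\
   limit_set theta Gamma (flag_of (dual_frame v))].
Proof.
move=> [gam [gamI gamG gamFl]].
have gamN := injective_nonconst gamI.
have [x [v [gx gxV xL vL gU]]] := extract UF thetaS divGamma subgroupV gamG gamN.
exists gam, x, v; split => //.
by apply/esym/gU => N /gamFl; exact: ooF.
Qed.

Lemma flag_neq_index x y : flag_of x <> flag_of y -> exists i, i \in theta.
Proof.
move=> xy; apply: contrapT => nt; apply: xy; apply/flag_of_frameP => i it.
by case: nt; exists i.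
Qed.

(** If from some power on each further factor h multiplied the norm by less than rho < 1, then om
    would tend to minus infinity along the powers, against [om_lower]. *)
Lemma subseq_om_growth (i : 'I_d.-1) (h : PSLK) (rho : R) : 0 < rho -> rho < 1 ->
  exists kn : nat -> nat, forall n, (n <= kn n)%N /\
    rho * minor_norm i (lift_mx (h ^+ kn n)%g) <= minor_norm i (lift_mx (h ^+ (kn n).+1)%g).
Proof.
move=> r0 r1.
suff kex n : exists m, (n <= m)%N /\
    rho * minor_norm i (lift_mx (h ^+ m)%g) <= minor_norm i (lift_mx (h ^+ m.+1)%g).
  exists (fun n => projT1 (cid (kex n))) => n; by case: cid.
apply: contrapT => nk.
have dec m : om i (h ^+ (n + m))%g <= om i (h ^+ n)%g + ln rho *+ m.
  elim: m => [|m IH]; first by rewrite addn0 addr0.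
  rewrite mulrSr addrA addnS; apply: le_trans (_ : om i (h ^+ (n + m))%g + ln rho <= _).
    rewrite /om addrC -lnM ?posrE ?om_norm_gt0 // ler_ln ?posrE ?mulr_gt0 ?om_norm_gt0 //.
    rewrite leNgt; apply/negP => lt; apply: nk; exists (n + m)%N.
    by rewrite leq_addr; split => //; exact: ltW.
  by rewrite lerD2r.
have [C CP] := om_lower R k i.
have lr : ln rho < 0 by rewrite ln_lt0 // r0.
pose q := (C + om i (h ^+ n)%g) / - ln rho.
have qb : q < (Num.bound `|q|)%:R.
  exact: le_lt_trans (ler_norm q) (archi_boundP (normr_ge0 q)).
have := le_trans (CP _) (dec (Num.bound `|q|)).
have {}qb : C + om i (h ^+ n)%g < (Num.bound `|q|)%:R * - ln rho.
  by rewrite -ltr_pdivrMr ?oppr_gt0.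
move: qb; rewrite -[ln rho *+ _]mulr_natl; move: (Num.bound _)%:R (om _ _) (ln rho) => N o l.
by rewrite mulrN; move: (N * l) => Nl; lra.
Qed.

Lemma exists_moving y : y \in unitmx -> limit_set theta Gamma (flag_of y) ->
  non_elementary theta Gamma -> exists2 h, Gamma h & ~ fixes theta h y.
Proof.
move=> yU yL Linf; apply: contrapT => nomove.
have fixy h : Gamma h -> fixes theta h y.
  by move=> hG; apply: contrapT => nh; apply: nomove; exists h.
have [Fl [FlL FlN]] := infinite_setN0 (infinite_setD Linf (finite_set1 (flag_of y))).
have [gam [x [v [gamG gamN xFl gx [gxV vL]]]]] := of_limit FlL.
have xy : flag_of x <> flag_of y by rewrite xFl => /FlN.
have [i it] := flag_neq_index xy.
have xU : x \in unitmx by case: gx.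
have vU : v \in unitmx by case: gx.
have xL : limit_set theta Gamma (flag_of x) by rewrite xFl.
(* The inverses of gam repel from the flag of x, which is not y, so their [chi] at y is large and
   that of gam is less than 1. *)
have [h hG [h0 h1]] : exists2 h, Gamma h & 0 < chi i y h /\ chi i y h < 1.
  have pr : pairs_with theta (coframe x) y.
    apply: (limit_pairs thetaS transGamma); rewrite ?coframe_unit ?coframeK //.
    by move=> /esym.
  have := chi_large UF divGamma (i := i) 1 it _ (nonconstV UF gamN) gxV pr yU.
  move=> /(_ (fun t => subgroupV (gamG t)) (fun t => fixy _ (subgroupV (gamG t)))).
  move=> /filter_ex[t /= chi1t]; exists (gam t) => //.
  have c0 := chi_gt0 yU it (fixy _ (gamG t)).
  split => //; have := chiV yU it (fixy _ (gamG t)) => cE.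
  rewrite -(ltr_pM2r (lt_trans ltr01 chi1t)) cE mul1r //.
have hy := fixy h hG.
(* Any value strictly between [chi i y h] and 1 would do: below 1 for [subseq_om_growth], above
   [chi] to exclude y as the attracting flag. *)
pose rho := (chi i y h + 1) / 2.
have rho0 : 0 < rho by rewrite /rho; lra.
have rho1 : rho < 1 by rewrite /rho; lra.
have hrho : chi i y h < rho by rewrite /rho; lra.
have [kn knP] := subseq_om_growth i h rho0 rho1.
pose bet n := (h ^+ kn n)%g.
have betG n : Gamma (bet n) by exact: subgroupX.
(* The exponents kn may repeat, but kn m >= m; beyond kn n the powers differ from bet n, since
   [chi i y h] < 1 tells different powers apart. *)
have betN : nonconst F bet.
  move=> g Fg; have [n /= ng] := filter_ex Fg.
  have Fn : F [set m | (kn n < m)%N] by apply: ooF; exists (kn n).+1.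
  have [m [/= mg nm]] := filter_ex (filterI Fg Fn).
  have knm : (kn n < kn m)%N by apply: leq_trans nm (knP m).1.
  have : chi i y (bet m) < chi i y (bet n).
    by rewrite !(chi_exp _ yU it hy) ltr_iXn2l.
  by rewrite mg ng ltxx.
have [a [w [ga gaV aL wL _]]] := extract UF thetaS divGamma subgroupV betG betN.
have aU : a \in unitmx by case: ga.
have wU : w \in unitmx by case: ga.
(* If the powers of h were attracted to y, their norms would be multiplied by
   chi h < rho in the limit. *)
have ay : flag_of a <> flag_of y.
  move=> ay; have [_ _ gy] := tends_flag UF yU ay ga.
  have [c [l l0 [c0 [cA cN]]]] := attracts_norm it yU wU gy.
  have cH := minors_cvg_mul (@minors_cvg_cst _ F _ R k d i (lift_mx h)) cA.
  have {}cH : minors_cvg F c (fun t => lift_mx h *m lift_mx (bet t))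
      (fun f g => minor (lift_mx h *m y) f (lead i) * minor w (lead i) g).
    move=> f g; apply: eq_cvgK (cH _ _ f g) => [t|]; first by rewrite mul1r.
    exact: (sum_minor_lead (lift_mx h) y 0 f g _).1.
  have lE : \sum_f \sum_g rabs (minor y f (lead i) * minor w (lead i) g) = l.
    by apply: cvg_unique (minors_cvg_norm cA) cN => //; exact: norm_hausdorff.
  have chiE (f g : {ffun 'I_(mdim i) -> 'I_d}) :
      chi i y h * rabs (minor y f (lead i) * minor w (lead i) g) =
      rabs (minor (lift_mx h *m y) f (lead i) * minor w (lead i) g).
    rewrite (minor_fixes f yU it hy) !rabsM -/(chi i y h) mulrA.
    by rewrite (mulrC (chi _ _ _)).
  have cHN : (fun t => rabs (c t) * minor_norm i (lift_mx h *m lift_mx (bet t)))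
      @ F --> chi i y h * l.
    rewrite -lE mulr_sumr.
    under eq_bigr do rewrite mulr_sumr.
    under eq_bigr do under eq_bigr do rewrite chiE.
    exact: minors_cvg_norm.
  have le t : rho * (rabs (c t) * minor_norm i (lift_mx (bet t))) <=
      rabs (c t) * minor_norm i (lift_mx h *m lift_mx (bet t)).
    rewrite mulrCA ler_wpM2l ?rabs_ge0 //; have [_] := knP t.
    have [b b1 bE] := lift_mul h (bet t) (index_gt0 i).
    by rewrite expgS bE minor_normZ b1 expr1n mul1r.
  have : rho * l <= chi i y h * l.
    have c1 : (fun t => rho * (rabs (c t) * minor_norm i (lift_mx (bet t)))) @ F --> rho * l.
      by apply: cvgM => //; exact: cvg_cst.
    by apply: (ler_cvg_to c1 cHN); exact: (@filterE _ F _ _ le).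
  by rewrite (ler_pM2r l0) leNgt hrho.
(* h commutes with its powers: the products in the two orders are attracted to h a and to a. *)
have ha : fixes theta h a.
  have t1 := tends_mull UF h ga; have t2 := tends_mulr UF h ga.
  apply: (tends_unique UF t1); apply: (tends_near UF _ t2); apply: (@filterE _ F) => t.
  by rewrite /= /bet -expgSr expgS.
(* The conjugates f n of h2 by bet n all have the same [chi] at y. If they diverged, [chi_large] for
   f and its inverse would force both flags of f to be y; then f n bet n = bet n h2 would be
   attracted to y and to a. *)
have fixa h2 : Gamma h2 -> fixes theta h2 a.
  move=> h2G; pose f n := (bet n * h2 * (bet n)^-1)%g.
  have fG n : Gamma (f n).
    by apply: subgroupM; [exact: subgroupM|exact: subgroupV].
  have chif n : chi i y (f n) = chi i y h2.
    have bG := betG n; have bVG := subgroupV bG.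
    rewrite (chiM yU it (fixy _ (subgroupM bG h2G)) (fixy _ bVG)).
    rewrite (chiM yU it (fixy _ bG) (fixy _ h2G)) mulrAC.
    by rewrite (chiV yU it (fixy _ bG)) mul1r.
  have [fN|[g Fg]] : nonconst F f \/ exists g, F [set n | f n = g].
    have [|nN] := pselect (nonconst F f); first by left.
    by right; apply: contrapT => ng; apply: nN => g Fg; apply: ng; exists g.
  - exfalso.
    have [x2 [w2 [gf gfV x2L w2L _]]] := extract UF thetaS divGamma subgroupV fG fN.
    have x2U : x2 \in unitmx by case: gf.
    have w2U : w2 \in unitmx by case: gf.
    have w2y : flag_of (dual_frame w2) = flag_of y.
      apply: contrapT => w2y.
      have pr : pairs_with theta w2 y.
        by apply: (limit_pairs thetaS transGamma) => // /esym.
      have := chi_large UF divGamma (i := i) (chi i y h2) it fG fN gf pr yU.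
      move=> /(_ (fun t => fixy _ (fG t)))/filter_ex[t /=].
      by rewrite chif ltxx.
    have x2y : flag_of x2 = flag_of y.
      apply: contrapT => x2y.
      have pr : pairs_with theta (coframe x2) y.
        apply: (limit_pairs thetaS transGamma); rewrite ?coframe_unit ?coframeK //.
        by move=> /esym.
      have fGV t : Gamma (f t)^-1%g := subgroupV (fG t).
      have := chi_large UF divGamma (i := i) (chi i y h2)^-1 it fGV (nonconstV UF fN) gfV pr yU.
      move=> /(_ (fun t => fixy _ (fGV t)))/filter_ex[t /=].
      have c0 := chi_gt0 yU it (fixy _ h2G).
      have := chiV yU it (fixy _ (fG t)); rewrite chif => cE.
      by rewrite -(ltr_pM2l c0) cE mulfV ?ltxx // gt_eqF.
    have pr : pairs_with theta w2 a.
      by apply: (limit_pairs thetaS transGamma); rewrite ?w2y.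
    have t1 := tends_comp UF pr gf ga; have t2 := tends_mulr UF h2 ga.
    apply: ay; rewrite -x2y; apply/esym/(tends_unique UF t1).
    apply: (tends_near UF _ t2); apply: (@filterE _ F) => t.
    by rewrite /= /f mulgVK.
  (* If the conjugates are almost constant, h2 commutes with b0 bet t for almost all t, so it fixes
     the attracting flag b0 a of these products, which is a. *)
  - have [n0 /= fn0] := filter_ex Fg.
    pose b0 := (bet n0)^-1%g.
    have b0a : fixes theta b0 a by apply: fixesV => //; exact: fixes_exp.
    have t0 := tends_mull UF b0 ga.
    have t1 := tends_mull UF h2 t0; have t2 := tends_mulr UF h2 t0.
    have E : flag_of (lift_mx h2 *m (lift_mx b0 *m a)) = flag_of (lift_mx b0 *m a).
      apply: (tends_unique UF t1); apply: (tends_near UF _ t2).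
      apply: (@filterS _ F _ _ _ _ Fg) => t /= ft; move: ft; rewrite -fn0 /f /b0 => ft.
      rewrite -(mulgA _ (bet t)) -[(bet t * h2)%g](mulgVK (bet t)) ft.
      by rewrite !mulgA mulVg mul1g.
    have b0aU : lift_mx b0 *m a \in unitmx by rewrite unitmx_mul lift_unit.
    rewrite /fixes -b0a -E; apply: flag_of_frame_mul => //.
    exact: lift_unit.
(* The repelling flag of a sequence attracted to a third limit flag differs from y or from a. The
   one it differs from is transverse to it and fixed by Gamma, so it is the attracting flag. *)
have [F3 [[F3L F3y] F3a]] := infinite_setN0 (infinite_setD
  (infinite_setD Linf (finite_set1 (flag_of y))) (finite_set1 (flag_of a))).
have [gam3 [x3 [v3 [gam3G gam3N x3F gx3 [_ v3L]]]]] := of_limit F3L.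
have v3U : v3 \in unitmx by case: gx3.
have [v3y|v3y] := pselect (flag_of (dual_frame v3) = flag_of y).
  have pr : pairs_with theta v3 a.
    by apply: (limit_pairs thetaS transGamma); rewrite ?v3y.
  apply: F3a; rewrite -x3F /=.
  by apply: (attracted_fixed UF gx3 pr) => // t; exact: fixa.
have pr : pairs_with theta v3 y.
  by apply: (limit_pairs thetaS transGamma) => // /esym.
apply: F3y; rewrite -x3F /=.
by apply: (attracted_fixed UF gx3 pr) => // t; exact: fixy.
Qed.

End NonElementary.

(** * Almost additive translates *)

Section AdditiveSet.
Variables (R : realType) (k : RC) (d : nat) (theta : {set 'I_d.-1}).
Local Notation K := (RCfield R k).
Local Notation PSLK := (PSL d K).
Variables (Gamma G : set PSLK).
Hypothesis thetaS : symmetric_roots theta.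
Hypothesis GammaG : is_subgroup Gamma.
Hypothesis transG : transverse_group theta Gamma.
Hypothesis nonel : non_elementary theta Gamma.
Hypothesis subG : is_subgroup G.
Hypothesis GGamma : G `<=` Gamma.
Hypothesis limG : limit_set theta G `<` limit_set theta Gamma.
Local Notation flag_of := (flag_of_frame theta).

Definition additive_set (M : R) : set PSLK := [set gam | Gamma gam /\
  forall g, G g -> forall i, i \in theta -> om i g + om i gam <= om i (g * gam)%g + M].

Let divGamma : divergent theta Gamma := transG.1.
Let transGamma := transG.2.

Lemma divergentS : divergent theta G.
Proof. by move=> gam gamI gamG; apply: divGamma => // n; exact/GGamma/gamG. Qed.

(** For empty theta there is only one flag, so no limit set is infinite. *)
Lemma theta_neq0 : exists i, i \in theta.
Proof.
apply: contrapT => nt; apply: nonel.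
have sub1 F1 F2 : limit_set theta Gamma F1 -> limit_set theta Gamma F2 -> F1 = F2.
  move=> _ _; apply: val_inj; apply/ffunP => -[i it].
  by case: nt; exists i.
have [[F1 F1L]|nL] := pselect (limit_set theta Gamma !=set0).
  apply: sub_finite_set (finite_set1 F1) => F2 F2L; exact: sub1.
by rewrite (_ : limit_set _ _ = set0) //; apply/eqP/negPn/negP => /set0P.
Qed.

(* Additivity for h at gam and for h^-1 at h gam bounds om h + om h^-1 by 2 M. *)
Lemma additive_stabilizer_finite M : finite_set [set h | G h /\
  exists2 gam, additive_set M gam & additive_set M (h * gam)%g].
Proof.
have [i it] := theta_neq0; have [C CP] := om_lower R k i.
have [C' CP'] := weight_om_close R k i.
apply: sub_finite_set (divergent_finite divergentS (2 * (2 * M + C + C'))).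
move=> h [hG [gam [gamG gamA] [hgamG hgamA]]]; split => //; exists i => //.
have hVG : G h^-1%g by exact: subgroupV.
have := hgamA _ hVG _ it; rewrite mulKg => l1; have l2 := gamA _ hG _ it.
have l3 := CP h^-1%g; have := CP' h; have := simple_root_le_weight i h.
have H (a w o o' p q : R) : a <= 2 * w -> `|w - o| <= C' -> o' + q <= p + M ->
    o + p <= q + M -> - C <= o' -> a <= 2 * (2 * M + C + C').
  by rewrite ler_norml => ? /andP[? ?] *; lra.
by move=> h1 h2; exact: H h1 h2 l1 l2 l3.
Qed.

Section Ultra.
Variables (F : set_system nat) (UF : UltraFilter F).
Hypothesis ooF : \oo `<=` F.

Lemma eventually_large (M : R) : F [set n : nat | M < n%:R].
Proof.
apply: ooF; exists (Num.bound `|M|) => // n /= Mn.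
apply: le_lt_trans (ler_norm M) _.
apply: lt_le_trans (archi_boundP (normr_ge0 M)) _.
by rewrite ler_nat.
Qed.

(** Otherwise some g n in G violates additivity at bet n with defect n. If g is almost constant,
    subadditivity bounds the defect. If not, its repelling flag belongs to the limit set of G, so it
    is not the flag of x; the two are then transverse and [om_comp] bounds the defect. *)
Lemma additive_eventually (bet : nat -> PSLK) x v : (forall n, Gamma (bet n)) ->
  tends theta F bet x v -> limit_set theta Gamma (flag_of x) ->
  ~ limit_set theta G (flag_of x) ->
  exists n, additive_set n%:R (bet n).
Proof.
move=> betG gx xL xNL; apply: contrapT => nA.
have bad n : exists gi : PSLK * 'I_d.-1, [/\ G gi.1, gi.2 \in theta &
    om gi.2 (gi.1 * bet n)%g + n%:R < om gi.2 gi.1 + om gi.2 (bet n)].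
  apply: contrapT => nb; apply: nA; exists n; split => // g gG i it.
  by rewrite leNgt; apply/negP => lt; apply: nb; exists (g, i).
pose gi n := projT1 (cid (bad n)).
have giP n : [/\ G (gi n).1, (gi n).2 \in theta & om (gi n).2 ((gi n).1 * bet n)%g + n%:R <
    om (gi n).2 (gi n).1 + om (gi n).2 (bet n)] by rewrite /gi; case: cid.
have [|i Fi] := ultra_finite_exists UF (A := fun i n => (gi n).2 = i).
  by apply: (@filterE _ F) => n; exists (gi n).2.
have it : i \in theta.
  by have [n /= <-] := filter_ex Fi; have [] := giP n.
pose g n := (gi n).1.
have gG n : G (g n) by have [] := giP n.
have [gN|[g0 Fg]] : nonconst F g \/ exists g0, F [set n | g n = g0].
  have [|nN] := pselect (nonconst F g); first by left.
  by right; apply: contrapT => ng; apply: nN => g0 Fg; apply: ng; exists g0.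
- have [x' [v' [gx' _ _ v'L _]]] := extract UF thetaS divergentS (subgroupV subG) gG gN.
  have pr : pairs_with theta v' x.
    apply: (limit_pairs thetaS transGamma) => //; [by case: gx'|by case: gx| |].
      by apply: (proj1 limG).
    by move=> xv; apply: xNL; rewrite xv.
  have [C FC] := om_comp UF it pr gx' gx.
  have [n [/= [{}Fi {}FC] nC]] := filter_ex (filterI (filterI Fi FC) (eventually_large C)).
  have [_ _] := giP n; rewrite Fi -/(g n).
  have H (a b c r : R) : a + b <= c + C -> C < r -> c + r < a + b -> False by lra.
  exact: H FC nC.
- have [n [/= [{}Fi {}Fg] nC]] := filter_ex (filterI (filterI Fi Fg)
    (eventually_large (om i g0 + om i g0^-1%g))).
  have [_ _] := giP n; rewrite Fi -/(g n) Fg.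
  have := omM i g0^-1%g (g0 * bet n)%g; rewrite mulKg.
  have H (a a' b c r : R) : b <= a' + c -> a + a' < r -> c + r < a + b -> False by lra.
  by move=> l1; exact: H l1 nC.
Qed.

Lemma additive_covering_ultra : exists M f1 f2, [/\ Gamma f1, Gamma f2 &
  finite_set [set gam | Gamma gam /\
    ~ additive_set M (f1 * gam)%g /\ ~ additive_set M (f2 * gam)%g]].
Proof.
have [i0 it0] := theta_neq0.
have [xi xiL xiNL] : exists2 xi, limit_set theta Gamma xi & ~ limit_set theta G xi.
  apply: contrapT => nx; apply: (proj2 limG) => xi xiL.
  by apply: contrapT => xiG; apply: nx; exists xi.
have [gx [x0 [v0 [gxG gxN x0xi gx0 [gxV v0L]]]]] := of_limit UF ooF thetaS divGamma GammaG xiL.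
have x0U : x0 \in unitmx by case: gx0.
have v0U : v0 \in unitmx by case: gx0.
pose y := dual_frame v0.
have yU : y \in unitmx by exact: dual_frame_unit.
have [h hG hy] := exists_moving UF ooF thetaS divGamma transGamma GammaG yU v0L nonel.
apply: contrapT => ncov.
(* Both the constant and the two translating elements vary with n, so one diagonal sequence violates
   every candidate covering. The condition on the roots keeps this sequence from being almost
   constant. *)
have badN n : exists gam, [/\ Gamma gam, ~ additive_set n%:R (gx n * gam)%g,
    ~ additive_set n%:R (gx n * h * gam)%g &
    forall i, i \in theta -> n%:R < simple_root i (cartan_proj gam)].
  have inf : infinite_set [set gam | Gamma gam /\ ~ additive_set n%:R (gx n * gam)%g /\
      ~ additive_set n%:R (gx n * h * gam)%g].
    move=> fin; apply: ncov; exists n%:R, (gx n), (gx n * h)%g; split => //.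
    exact: subgroupM.
  have [gam [[gamG [n1 n2]] ngam]] :=
    infinite_setN0 (infinite_setD inf (divergent_finite divGamma n%:R)).
  exists gam; split => // i it; rewrite ltNge; apply/negP => le.
  by apply: ngam; split => //; exists i.
pose gam n := projT1 (cid (badN n)).
have gamP n : [/\ Gamma (gam n), ~ additive_set n%:R (gx n * gam n)%g,
    ~ additive_set n%:R (gx n * h * gam n)%g &
    forall i, i \in theta -> n%:R < simple_root i (cartan_proj (gam n))].
  by rewrite /gam; case: cid.
have gamG n : Gamma (gam n) by have [] := gamP n.
have gamN : nonconst F gam.
  move=> g Fg; have [n [/= ng]] := filter_ex (filterI Fg
    (eventually_large (simple_root i0 (cartan_proj g)))).
  have [_ _ _ /(_ i0 it0)] := gamP n; rewrite ng => l1 l2.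
  by have := lt_trans l1 l2; rewrite ltxx.
have [x [v [gamx _ xL _ _]]] := extract UF thetaS divGamma (subgroupV GammaG) gamG gamN.
have xU : x \in unitmx by case: gamx.
have x0L : limit_set theta Gamma (flag_of x0) by rewrite x0xi.
have x0NL : ~ limit_set theta G (flag_of x0) by rewrite x0xi.
(* y is the repelling flag of gx. When gam is attracted to it, h moves the attracting flag away
   before gx acts, and the second translate is additive; otherwise the first is. *)
have [xy|xy] := pselect (flag_of x = flag_of y).
  have hx := tends_mull UF h gamx.
  have hxU : lift_mx h *m x \in unitmx by rewrite unitmx_mul lift_unit.
  have hgamG n : Gamma (h * gam n)%g by exact: subgroupM.
  have hgamN : nonconst F (fun n => h * gam n)%g.
    move=> g Fg; apply: (gamN (h^-1 * g)%g); apply: (@filterS _ F _ _ _ _ Fg) => n /= <-.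
    by rewrite mulKg.
  have hxL := tends_limit UF thetaS divGamma (subgroupV GammaG) hgamG hgamN hx.
  have pr : pairs_with theta v0 (lift_mx h *m x).
    apply: (limit_pairs thetaS transGamma) => // E; apply: hy.
    by rewrite /fixes -[RHS]E; apply/esym/flag_of_frame_mul => //; exact: lift_unit.
  have [n] := additive_eventually (bet := fun n => (gx n * (h * gam n))%g)
    (fun n => subgroupM GammaG (gxG n) (hgamG n)) (tends_comp UF pr gx0 hx) x0L x0NL.
  by have [_ _ + _] := gamP n; rewrite mulgA.
have pr : pairs_with theta v0 x by apply: (limit_pairs thetaS transGamma).
have [n] := additive_eventually (bet := fun n => (gx n * gam n)%g)
  (fun n => subgroupM GammaG (gxG n) (gamG n)) (tends_comp UF pr gx0 gamx) x0L x0NL.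
by have [_ + _ _] := gamP n.
Qed.

End Ultra.

Lemma additive_covering : exists M f1 f2, [/\ Gamma f1, Gamma f2 &
  finite_set [set gam | Gamma gam /\
    ~ additive_set M (f1 * gam)%g /\ ~ additive_set M (f2 * gam)%g]].
Proof.
have [F [UF ooF]] := ultra_nat_exists.
exact: additive_covering_ultra UF ooF.
Qed.

End AdditiveSet.

(** * Coordinates on the partial Cartan subspace *)

Section WeightCoordinates.
Variables (R : realType) (d : nat) (theta : {set 'I_d.-1}).

Lemma fund_weight_linear (i : 'I_d.-1) : linear (@fund_weight R d i).
Proof.
move=> c a b; rewrite /fund_weight scaler_sumr -big_split /=.
by apply: eq_bigr => l _; rewrite !mxE.
Qed.
HB.instance Definition _ (i : 'I_d.-1) :=
  GRing.isLinear.Build R 'rV[R]_d R^o *:%R (@fund_weight R d i)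
    (fund_weight_linear i).

(** With the coordinate sum, these are the functionals behind the partial projection: roots off
    theta vanish on [cartan_theta], and weights in theta are prescribed by [cartan_proj_theta]. *)
Definition mixed_coords (a : 'rV[R]_d) : 'rV[R]_d.-1 :=
  \row_i (if i \in theta then fund_weight i a else simple_root i a).

Definition all_coords (a : 'rV[R]_d) : (R^o * 'rV[R]_d.-1)%type :=
  (coord_sum a, mixed_coords a).

Lemma all_coords_linear : linear all_coords.
Proof.
move=> c a b; rewrite /all_coords; congr (_, _); first exact: linearP.
by apply/rowP => i; rewrite !mxE; case: ifP => _; exact: linearP.
Qed.
HB.instance Definition _ :=
  GRing.isLinear.Build R 'rV[R]_d (R^o * 'rV[R]_d.-1)%type *:%R all_coords
    all_coords_linear.

Lemma summation_by_parts (a : nat -> R) n :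
  \sum_(m < n.+1) a m ^+ 2 = a n * \sum_(m < n.+1) a m -
    \sum_(m < n) (\sum_(l < m.+1) a l) * (a m.+1 - a m).
Proof.
elim: n => [|n IH]; first by rewrite !big_ord_recr !big_ord0 /=; ring.
rewrite big_ord_recr /= IH (big_ord_recr n.+1) /= [X in _ = _ - X]big_ord_recr /=.
by ring.
Qed.

(** Summation by parts writes the sum of the squared coordinates in terms of products of a weight
    and a simple root with the same index. In each product one factor is a mixed coordinate, hence
    0. *)
Lemma all_coords_inj a : (0 < d)%N -> all_coords a = 0 -> a = 0.
Proof.
move=> d0 [sum0 /rowP mix0].
pose f n : R := a 0 (insubd (Ordinal d0) n).
have fE (b : 'I_d) : f b = a 0 b.
  by rewrite /f; congr (a 0 _); apply: val_inj; rewrite val_insubd ltn_ord.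
have dE : d.-1.+1 = d by rewrite prednK.
have Sd : \sum_(m < d.-1.+1) f m = 0.
  rewrite dE -[RHS]sum0; apply: eq_bigr => b _; exact: fE.
have Sm (i : 'I_d.-1) : \sum_(l < i.+1) f l = fund_weight i a.
  rewrite /fund_weight [RHS]big_mkcond /= [RHS](@sum_lead _ R i) => [|b ib]; last first.
    by rewrite leqNgt ib.
  by apply: eq_bigr => l _; rewrite -ltnS lead_lt -fE ffunE.
have sq0 : \sum_(m < d.-1.+1) f m ^+ 2 = 0.
  rewrite summation_by_parts Sd mulr0 sub0r big1 ?oppr0 // => i _.
  rewrite Sm; have := mix0 i; rewrite !mxE; case: ifP => _ => [->|].
    by rewrite mul0r.
  rewrite /simple_root -!fE /= => /eqP; rewrite subr_eq0 => /eqP ->.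
  by rewrite subrr mulr0.
apply/rowP => b; rewrite mxE -fE; apply/eqP; rewrite -sqrf_eq0; apply/eqP.
rewrite dE in sq0; apply/eqP.
have /psumr_eq0P : forall i : 'I_d, true -> 0 <= f i ^+ 2 by move=> i _; exact: sqr_ge0.
by move=> /(_ sq0)/(_ b isT) ->.
Qed.

Lemma all_coords_surj w : (0 < d)%N -> exists a, all_coords a = w.
Proof.
move=> d0.
have ker0 : lker (linfun all_coords) = 0%VS.
  apply/eqP; rewrite -subv0; apply/subvP => a; rewrite memv_ker lfunE /=.
  by move=> /eqP/(all_coords_inj d0) ->; exact: mem0v.
have img : limg (linfun all_coords) = fullv.
  apply/eqP; rewrite eqEdim subvf /=.
  have := limg_ker_dim (linfun all_coords) fullv; rewrite ker0 capv0 dimv0 add0n => ->.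
  by rewrite !dimvf /dim /= /dim /= !mul1n add1n prednK.
have : w \in limg (linfun all_coords) by rewrite img memvf.
by move=> /memv_imgP[a _ ->]; exists a; rewrite lfunE.
Qed.

Lemma dual_weights : (0 < d)%N ->
  exists b : 'I_d.-1 -> subvs_of (cartan_theta R theta),
  forall i j, j \in theta -> fund_weight j (vsval (b i)) = (i == j)%:R.
Proof.
move=> d0.
suff bex i : exists x : subvs_of (cartan_theta R theta),
    forall j, j \in theta -> fund_weight j (vsval x) = (i == j)%:R.
  by exists (fun i => projT1 (cid (bex i))) => i j; case: cid => x /=; apply.
have [a [sum0 /rowP aE]] :=
  all_coords_surj (0, \row_j ((j \in theta) && (i == j))%:R) d0.
have aV : a \in cartan_theta R theta.
  rewrite mem_cartan_theta; apply/andP; split; first exact/eqP.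
  apply/'forall_implyP => j jt; have := aE j; rewrite !mxE (negPf jt) /=.
  by move=> /eqP; rewrite subr_eq0.
exists (Subvs aV) => j jt; rewrite /=.
by have := aE j; rewrite !mxE jt.
Qed.

Lemma cartan_theta_unique (x : subvs_of (cartan_theta R theta)) : (0 < d)%N ->
  (forall j, j \in theta -> fund_weight j (vsval x) = 0) -> x = 0.
Proof.
move=> d0 x0; apply: val_inj; apply: (all_coords_inj d0) => /=.
have := subvsP x; rewrite mem_cartan_theta => /andP[/eqP sum0 /'forall_implyP al0].
congr (_, _); first exact: sum0.
apply/rowP => j; rewrite !mxE; case: ifP => [jt|/negbT jt]; first exact: x0.
by apply/eqP; rewrite subr_eq0; exact: al0.
Qed.

(** The coefficients are the values of phi on the basis dual to the weights in theta; uniqueness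
    identifies the chosen [cartan_proj_theta] with the expansion in this basis. *)
Lemma phi_weights (k : RC) (phi : 'Hom(subvs_of (cartan_theta R theta), R^o)) :
  (0 < d)%N -> exists c : 'I_d.-1 -> R, forall g : PSL d (RCfield R k),
  phi (cartan_proj_theta theta g) =
  \sum_(i in theta) c i * fund_weight i (cartan_proj g).
Proof.
move=> d0; have [b bE] := dual_weights d0.
exists (fun i => phi (b i)) => g.
pose x := \sum_(i in theta) fund_weight i (cartan_proj g) *: b i.
have xE j : j \in theta -> fund_weight j (vsval x) = fund_weight j (cartan_proj g).
  move=> jt; rewrite /x linear_sum linear_sum /= (bigD1 j) //= big1 => [|i].
    by rewrite !linearZ /= bE // eqxx addr0 /GRing.scale /= mulr1.
  move=> /andP[it ij]; rewrite !linearZ /= bE // (negPf ij).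
  by rewrite /GRing.scale /= mulr0.
have -> : cartan_proj_theta theta g = x.
  rewrite /cartan_proj_theta; case: xgetP => [z _ zE|/(_ x)]; last by [].
  apply/eqP; rewrite -subr_eq0; apply/eqP/(cartan_theta_unique d0) => j jt.
  by rewrite !linearB /= zE // xE // subrr.
rewrite /x linear_sum; apply: eq_bigr => i _.
by rewrite linearZ /= mulrC.
Qed.

End WeightCoordinates.

(** * Comparing Poincare series *)

Lemma esum_leP (R : realType) (T : choiceType) (S : set T) (f : T -> R) (B : R) :
  (\esum_(x in S) (f x)%:E <= B%:E)%E <->
  (forall l : seq T, uniq l -> (forall x, x \in l -> S x) -> \sum_(x <- l) f x <= B).
Proof.
split=> [SB l ul lS|lB].
  rewrite -lee_fin; apply: le_trans SB; apply: ereal_sup_ubound.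
  exists [set` l]; first by split => // x /=; exact: lS.
  by rewrite -fsbig_seq // sumEFin.
apply: ge_ereal_sup => _ [X [/finite_seqP[l0 ->] XS] <-].
have -> : [set` l0] = [set` undup l0].
  by apply/seteqP; split=> x /=; rewrite mem_undup.
rewrite -fsbig_seq ?undup_uniq // sumEFin lee_fin.
by apply: lB; [exact: undup_uniq|move=> x; rewrite mem_undup; exact: XS].
Qed.

Lemma sum_uniq_subset (R : numDomainType) (T : eqType) (f : T -> R) (l E : seq T) :
  (forall x, 0 <= f x) -> uniq l -> uniq E -> {subset l <= E} ->
  \sum_(x <- l) f x <= \sum_(x <- E) f x.
Proof.
move=> f0 ul uE lE; rewrite [leRHS](bigID (fun x => x \in l)) /=.
have <- : \sum_(x <- l) f x = \sum_(x <- E | x \in l) f x.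
  rewrite -[RHS]big_filter; apply: perm_big; apply: uniq_perm => //.
    exact: filter_uniq.
  by move=> x; rewrite mem_filter; case: (boolP (x \in l)) => // /lE ->.
by rewrite lerDl sumr_ge0.
Qed.

(** * Double counting over finite lists *)

Section Counting.
Variables (R : realType) (gT : groupType) (P : gT -> R).
Variables (Gamma G A : set gT) (H E : seq gT) (f1 f2 : gT) (C1 C2 : R).
Hypothesis GAGamma : forall g x, G g -> A x -> Gamma (g * x)%g.
Hypothesis PM : forall g x, G g -> A x -> P (g * x)%g <= P g + P x + C1.
Hypothesis stabH : forall g g' x x', G g -> G g' -> A x -> A x' ->
  (g * x = g' * x')%g -> (g'^-1 * g)%g \in H.
Hypothesis uniqE : uniq E.
Hypothesis cover : forall x, Gamma x -> [\/ x \in E, A (f1 * x)%g | A (f2 * x)%g].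
Hypothesis Pf1 : forall x, P (f1 * x)%g <= P x + C2.
Hypothesis Pf2 : forall x, P (f2 * x)%g <= P x + C2.

Definition weight (s : R) x : R := expR (- s * P x).

Lemma weight_ge0 s x : 0 <= weight s x. Proof. exact: expR_ge0. Qed.

(** The multiplication map from pairs (g, x) to products has fibres of size at most that of H: after
    division by one fixed g0, the first components of a fibre lie in H. *)
Lemma double_sum_le s S (l lA : seq gT) : 0 <= s ->
  (forall X : seq gT, uniq X -> (forall x, x \in X -> Gamma x) ->
    \sum_(x <- X) weight s x <= S) ->
  uniq l -> (forall g, g \in l -> G g) -> uniq lA -> (forall x, x \in lA -> A x) ->
  (\sum_(g <- l) weight s g) * (\sum_(x <- lA) weight s x) <=
  expR (s * C1) * (size H)%:R * S.
Proof.
move=> s0 XS ul lG ulA lAA; rewrite mulr_suml.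
pose X := undup [seq (g * x)%g | g <- l, x <- lA].
have memX z : z \in X -> exists g x, [/\ g \in l, x \in lA & z = (g * x)%g].
  by rewrite mem_undup => /allpairsP[[g x] /= [gl xl ->]]; exists g, x.
have XG z : z \in X -> Gamma z.
  by move=> /memX[g [x [gl xl ->]]]; apply: GAGamma; [exact: lG|exact: lAA].
have row g : g \in l -> \sum_(x <- lA) weight s (g * x)%g =
    \sum_(z <- X) (g^-1 * z \in lA)%g%:R * weight s z.
  move=> gl; under [RHS]eq_bigr do rewrite mulr_natl mulrb.
  rewrite -[RHS]big_mkcond -[RHS]big_filter /=.
  rewrite -(big_map (fun x => g * x)%g xpredT (weight s)); apply: perm_big.
  apply: uniq_perm; first by rewrite map_inj_uniq //; exact: mulgI.
    exact/filter_uniq/undup_uniq.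
  move=> z; rewrite mem_filter; apply/mapP/andP => [[x xl ->]|[gz zX]].
    by rewrite mulKg xl mem_undup; split => //; apply/allpairsP; exists (g, x).
  by exists (g^-1 * z)%g => //; rewrite mulVKg.
have colH z : z \in X -> \sum_(g <- l) (g^-1 * z \in lA)%g%:R <= (size H)%:R :> R.
  move=> zX; rewrite -natr_sum ler_nat.
  have -> : (\sum_(g <- l) (g^-1 * z \in lA)%g = count (fun g => g^-1 * z \in lA)%g l)%N.
    by rewrite -sum1_count [RHS]big_mkcond; apply: eq_bigr => g _; case: (_ \in _).
  rewrite -size_filter.
  case: [seq g <- l | _] (filter_uniq (fun g => (g^-1 * z)%g \in lA) ul)
      (mem_filter (fun g => (g^-1 * z)%g \in lA) ^~ l) => // g0 l' ul' meml'.
  rewrite -(size_map (fun g => g0^-1 * g)%g); apply: uniq_leq_size.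
    by rewrite map_inj_uniq //; exact: mulgI.
  move=> _ /mapP[g gl' ->].
  have := meml' g0; rewrite mem_head => /esym/andP[g0A g0l].
  have := meml' g; rewrite gl' => /esym/andP[gA gl].
  apply: (stabH (lG _ gl) (lG _ g0l) (lAA _ gA) (lAA _ g0A)).
  by rewrite !mulVKg.
apply: (@le_trans _ _ (\sum_(g <- l) expR (s * C1) *
    \sum_(z <- X) (g^-1 * z \in lA)%g%:R * weight s z)).
  rewrite big_seq [leRHS]big_seq; apply: ler_sum => g gl.
  rewrite -row // !mulr_sumr big_seq [leRHS]big_seq; apply: ler_sum => x xl.
  rewrite /weight -!expRD ler_expR.
  have := ler_wpM2l s0 (PM (lG _ gl) (lAA _ xl)); lra.
rewrite -mulr_sumr -mulrA ler_wpM2l ?expR_ge0 //.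
rewrite exchange_big /=; apply: (@le_trans _ _ (\sum_(z <- X) (size H)%:R * weight s z)).
  rewrite big_seq [leRHS]big_seq; apply: ler_sum => z zX.
  by rewrite -mulr_suml ler_wpM2r ?weight_ge0 ?colH.
by rewrite -mulr_sumr ler_wpM2l // XS // undup_uniq.
Qed.

Lemma cover_sum_le s B (X : seq gT) : 0 <= s ->
  (forall lA : seq gT, uniq lA -> (forall x, x \in lA -> A x) ->
    \sum_(x <- lA) weight s x <= B) ->
  uniq X -> (forall x, x \in X -> Gamma x) ->
  \sum_(x <- X) weight s x <= \sum_(x <- E) weight s x + 2 * expR (s * C2) * B.
Proof.
move=> s0 lAB uX XG.
have shift f : (forall x, P (f * x)%g <= P x + C2) ->
    \sum_(x <- X | `[< A (f * x)%g >]) weight s x <= expR (s * C2) * B.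
  move=> Pf; apply: (@le_trans _ _ (expR (s * C2) *
      \sum_(x <- X | `[< A (f * x)%g >]) weight s (f * x)%g)).
    rewrite mulr_sumr; apply: ler_sum => x _; rewrite /weight -expRD ler_expR.
    by have := ler_wpM2l s0 (Pf x); lra.
  rewrite ler_wpM2l ?expR_ge0 // -big_filter.
  rewrite -(big_map (fun x => f * x)%g xpredT (weight s)); apply: lAB.
    by rewrite map_inj_uniq ?filter_uniq //; exact: mulgI.
  by move=> _ /mapP[x + ->]; rewrite mem_filter => /andP[/asboolP].
have hE : \sum_(x <- X | x \in E) weight s x <= \sum_(x <- E) weight s x.
  rewrite -big_filter; apply: sum_uniq_subset => //; first by move=> x; exact: weight_ge0.
    exact: filter_uniq.
  by move=> x; rewrite mem_filter => /andP[].
have := lerD hE (lerD (shift _ Pf1) (shift _ Pf2)).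
have -> : \sum_(x <- E) weight s x + (expR (s * C2) * B + expR (s * C2) * B) =
  \sum_(x <- E) weight s x + 2 * expR (s * C2) * B by ring.
apply: le_trans; rewrite (big_mkcond (fun x => x \in E)) /=.
rewrite (big_mkcond (fun x => `[< A (f1 * x)%g >])) /=.
rewrite (big_mkcond (fun x => `[< A (f2 * x)%g >])) /= -!big_split /=.
rewrite big_seq [leRHS]big_seq; apply: ler_sum => x xX.
have i0 (b : bool) : 0 <= (if b then weight s x else 0).
  by case: b => //; exact: weight_ge0.
case: (cover (XG _ xX)) => [->|/asboolP ->|/asboolP ->].
- by rewrite lerDl addr_ge0.
- by rewrite addrCA lerDl addr_ge0.
- by rewrite addrA lerDr addr_ge0.
Qed.

(** S is the full series over Gamma and T a partial sum over G. The previous lemmas give S <= K + 2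
    e1 e2 h S / T. Once T > 4 e1 e2 h, the last term is at most S / 2 and can be absorbed because S
    is finite, so T <= S <= 2 K. *)
Lemma orbit_sum_le s S (l : seq gT) : 0 <= s -> 0 <= S ->
  (forall X : seq gT, uniq X -> (forall x, x \in X -> Gamma x) ->
    \sum_(x <- X) weight s x <= S) ->
  (forall B, (forall X : seq gT, uniq X -> (forall x, x \in X -> Gamma x) ->
    \sum_(x <- X) weight s x <= B) -> S <= B) ->
  G `<=` Gamma -> uniq l -> (forall g, g \in l -> G g) ->
  \sum_(g <- l) weight s g <=
  4 * expR (s * C1) * expR (s * C2) * (size H)%:R + 2 * \sum_(x <- E) weight s x.
Proof.
move=> s0 S0 XS Slub GGamma ul lG.
set T := \sum_(g <- l) _; set K := \sum_(x <- E) _.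
set e1 := expR (s * C1); set e2 := expR (s * C2); set h := (size H)%:R.
have K0 : 0 <= K by apply: sumr_ge0 => x _; exact: weight_ge0.
have e10 : 0 < e1 by exact: expR_gt0.
have e20 : 0 < e2 by exact: expR_gt0.
have h0 : 0 <= h by exact: ler0n.
have e1e2h : 0 <= e1 * e2 * h by rewrite !mulr_ge0 // ltW.
have [Tc|cT] := leP T (4 * e1 * e2 * h); first lra.
have T0 : 0 < T by lra.
have TS : T <= S by apply: XS => // g /lG; exact: GGamma.
have : S <= K + 2 * e2 * (e1 * h * S / T).
  apply: Slub => X uX XG; apply: cover_sum_le => // lA ulA lAA.
  by rewrite ler_pdivlMr // mulrC; exact: double_sum_le.
have : 2 * e2 * (e1 * h * S / T) <= S / 2.
  have -> : 2 * e2 * (e1 * h * S / T) = (2 * (e1 * e2 * h) * S) / T by ring.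
  rewrite ler_pdivrMr //.
  have : 2 * (e1 * e2 * h) <= T / 2 by lra.
  by move=> /(ler_wpM2r S0); lra.
lra.
Qed.

End Counting.

Section WeightEstimates.
Variables (R : realType) (k : RC) (d : nat) (theta : {set 'I_d.-1}).
Local Notation PSLK := (PSL d (RCfield R k)).
Variable phi : 'Hom(subvs_of (cartan_theta R theta), R^o).
Hypothesis d_gt0 : (0 < d)%N.

Definition height (g : PSLK) : R := phi (cartan_proj_theta theta g).

(** Subadditivity of [om] is the other half of the hypothesis, so the defect of each weight is
    bounded in absolute value, whatever the sign of its coefficient. The factor 3 accounts for
    passing from weights to [om] at g, h and their product. *)
Lemma height_defect (M : R) : exists2 C, 0 <= C & forall g h : PSLK,
  (forall i, i \in theta -> om i g + om i h <= om i (g * h)%g + M) ->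
  height (g * h)%g <= height g + height h + C.
Proof.
have [c cE] := phi_weights k phi d_gt0.
pose B (i : 'I_d.-1) : R := projT1 (cid (weight_om_close R k i)).
have BP i (g : PSLK) : `|fund_weight i (cartan_proj g) - om i g| <= B i.
  by rewrite /B; case: cid => C /=.
have B0 i : 0 <= B i by apply: le_trans (BP i 1%g).
exists (\sum_(i in theta) `|c i| * (`|M| + 3 * B i)).
  by apply: sumr_ge0 => i _; rewrite mulr_ge0 // addr_ge0 // mulr_ge0.
move=> g h gh; rewrite /height !cE -!big_split /=; apply: ler_sum => i it.
rewrite -mulrDr -lerBlDl -mulrBr.
apply: le_trans (ler_norm _) _; rewrite normrM ler_wpM2l //.
have est (a b e oa ob oe : R) : oa + ob <= oe + M -> oe <= oa + ob ->
    `|a - oa| <= B i -> `|b - ob| <= B i -> `|e - oe| <= B i ->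
    `|e - (a + b)| <= `|M| + 3 * B i.
  rewrite !ler_norml => ? ? /andP[? ?] /andP[? ?] /andP[? ?].
  by have := ler_norm M; have := normr_ge0 M; move=> ? ?; apply/andP; split; lra.
exact: est (gh i it) (omM i g h) (BP i g) (BP i h) (BP i _).
Qed.

(** Writing g as the inverse of f times f g bounds the defect of [om] by a constant depending on f
    only. *)
Lemma height_mull (f : PSLK) : exists2 C, 0 <= C & forall g,
  height (f * g)%g <= height g + C.
Proof.
pose M : R := \sum_(i in theta) (`|om i f| + `|om i f^-1%g|).
have [C C0 CP] := height_defect M.
exists (C + `|height f|) => [|g]; first by rewrite addr_ge0.
apply: le_trans (CP f g _) _; last by have := ler_norm (height f); lra.
move=> i it; have := omM i f^-1%g (f * g)%g; rewrite mulKg.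
have : `|om i f| + `|om i f^-1%g| <= M.
  by rewrite /M (bigD1 i) //= lerDl sumr_ge0 // => j _; rewrite addr_ge0.
by have := ler_norm (om i f); have := ler_norm (om i f^-1%g); lra.
Qed.

End WeightEstimates.

Theorem theorem1p2 (R : realType) (k : RC) (d : nat) (theta : {set 'I_d.-1})
    (Gamma : set (PSL d (RCfield R k)))
    (phi : 'Hom(subvs_of (cartan_theta R theta), R^o))
    (G : set (PSL d (RCfield R k))) :
  symmetric_roots theta ->
  is_subgroup Gamma ->
  transverse_group theta Gamma ->
  non_elementary theta Gamma ->
  (critical_exponent phi Gamma < +oo)%E ->
  is_subgroup G ->
  G `<=` Gamma ->
  poincare_series phi G (fine (critical_exponent phi G)) = +oo%E ->
  limit_set theta G `<` limit_set theta Gamma ->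
  (critical_exponent phi G < critical_exponent phi Gamma)%E.
Proof.
move=> thetaS GammaG transG nonel fin_Gamma subG GGamma divG limG.
rewrite ltNge; apply/negP => le_crit.
have [i0 it0] := theta_neq0 nonel.
have d0 := index_gt0 i0.
have [M [f1 [f2 [f1G f2G Efin]]]] :=
  additive_covering thetaS GammaG transG nonel subG GGamma limG.
set A := additive_set theta Gamma G M in Efin.
have [H HE] := (finite_seqP _).1
  (additive_stabilizer_finite transG nonel subG GGamma M).
have [E0 E0E] := (finite_seqP _).1 Efin.
pose E := undup E0.
have [C1 C10 C1P] := height_defect k phi d0 M.
have [D1 D10 D1P] := height_mull phi d0 f1.
have [D2 D20 D2P] := height_mull phi d0 f2.
pose C2 := D1 + D2.
have C20 : 0 <= C2 by rewrite addr_ge0.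
pose P : PSL d (RCfield R k) -> R := height phi.
have GAGamma g x : G g -> A x -> Gamma (g * x)%g.
  by move=> /GGamma gG [xG _]; exact: subgroupM.
have PM g x : G g -> A x -> P (g * x)%g <= P g + P x + C1.
  by move=> gG [_ xA]; apply: C1P; exact: xA.
have stabH g g' x x' : G g -> G g' -> A x -> A x' ->
    (g * x = g' * x')%g -> (g'^-1 * g)%g \in H.
  move=> gG g'G Ax Ax' gx.
  have : [set` H] (g'^-1 * g)%g; last by [].
  rewrite -HE; split; first by apply: subgroupM => //; exact: subgroupV.
  by exists x => //; rewrite -mulgA gx mulKg.
have cover x : Gamma x -> [\/ x \in E, A (f1 * x)%g | A (f2 * x)%g].
  move=> xG; have [A1|nA1] := pselect (A (f1 * x)%g); first by apply: Or32.
  have [A2|nA2] := pselect (A (f2 * x)%g); first by apply: Or33.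
  apply: Or31; rewrite mem_undup; have : [set` E0] x by rewrite -E0E.
  by [].
have Pf1 x : P (f1 * x)%g <= P x + C2.
  by apply: le_trans (D1P x) _; rewrite lerD2l lerDl.
have Pf2 x : P (f2 * x)%g <= P x + C2.
  by apply: le_trans (D2P x) _; rewrite lerD2l lerDr.
have crit_GGamma : (critical_exponent phi G <= critical_exponent phi Gamma)%E.
  apply: le_ereal_inf_tmp => _ [s [s0 Qs] <-]; apply: ereal_inf_lbound; exists s => //; split => //.
  apply: le_lt_trans Qs; apply: ge_ereal_sup => _ [X [Xfin XG] <-].
  by apply: ereal_sup_ubound; exists X => //; split => //; exact: subset_trans XG GGamma.
have crit_ge0 : (0 <= critical_exponent phi G)%E.
  by apply: le_ereal_inf_tmp => _ [s [s0 _] <-]; rewrite lee_fin ltW.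
(* The exponent of G is finite because that of Gamma is, so [fine] returns its true value. *)
have critE : (fine (critical_exponent phi G))%:E = critical_exponent phi G.
  by rewrite fineK // ge0_fin_numE // (le_lt_trans crit_GGamma).
set del := fine _ in critE divG.
have del0 : 0 <= del by rewrite -lee_fin critE.
pose K := \sum_(x <- E) expR ((del + 1) * `|P x|).
(* A bound for the partial sums over G that is uniform for s between del and del + 1. *)
pose B := 4 * expR ((del + 1) * C1) * expR ((del + 1) * C2) * (size H)%:R + 2 * K.
suff : (poincare_series phi G del <= (2 * B)%:E)%E by rewrite divG leye_eq.
apply/esum_leP => l ul lG.
(* Fatou's lemma by hand: the list l is fixed first, and s is then taken so close to del that no
   term of l changes by more than a factor 2, that is, (s - del) m <= ln 2. The summand 1 makes m
   positive. *)
pose m := 1 + \sum_(x <- l) `|P x|.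
have m0 : 0 < m by rewrite ltr_pwDl // sumr_ge0.
have ln20 : 0 < ln 2 :> R by rewrite ln_gt0 // ltr1n.
pose eps := Num.min 1 (ln 2 / m).
have eps0 : 0 < eps by rewrite lt_min ltr01 divr_gt0.
have [s [s0 Qs] sdel] : exists2 s, 0 < s /\ (poincare_series phi Gamma s < +oo)%E &
    s < del + eps.
  have : (critical_exponent phi Gamma < (del + eps)%:E)%E.
    by apply: le_lt_trans le_crit _; rewrite -critE lte_fin ltrDl.
  by move=> /ereal_inf_lt[_ [s sP <-]]; rewrite lte_fin => ?; exists s.
have dels : del <= s.
  rewrite -lee_fin critE; apply: le_trans crit_GGamma _.
  by apply: ereal_inf_lbound; exists s.
have s1 : s <= del + 1.
  by apply: le_trans (ltW sdel) _; rewrite lerD2l ge_min lexx.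
have Q0 : (0 <= poincare_series phi Gamma s)%E.
  by apply: esum_ge0 => x _; rewrite lee_fin expR_ge0.
pose S := fine (poincare_series phi Gamma s).
have SE : S%:E = poincare_series phi Gamma s by rewrite fineK // ge0_fin_numE.
have S0 : 0 <= S by rewrite -lee_fin SE.
have XS (X : seq _) : uniq X -> (forall x, x \in X -> Gamma x) ->
    \sum_(x <- X) weight P s x <= S.
  by apply: (esum_leP _ (weight P s) _).1; rewrite SE.
have Slub b : (forall X : seq _, uniq X -> (forall x, x \in X -> Gamma x) ->
    \sum_(x <- X) weight P s x <= b) -> S <= b.
  by move=> /(esum_leP _ (weight P s) _).2; rewrite -lee_fin SE.
have := orbit_sum_le GAGamma PM stabH (undup_uniq E0) cover Pf1 Pf2
  (ltW s0) S0 XS Slub GGamma ul lG.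
move=> sB.
have {}sB : \sum_(g <- l) weight P s g <= B.
  apply: le_trans sB _; apply: lerD.
    rewrite ler_wpM2r //; apply: ler_pM; rewrite ?mulr_ge0 ?expR_ge0 //.
      by rewrite ler_wpM2l // ler_expR ler_wpM2r.
    by rewrite ler_expR ler_wpM2r.
  rewrite ler_wpM2l //; apply: ler_sum => x _; rewrite /weight ler_expR.
  apply: le_trans (ler_norm _) _; rewrite normrM normrN.
  by rewrite ler_wpM2r // ger0_norm // ltW.
apply: (@le_trans _ _ (2 * \sum_(g <- l) weight P s g)); last by rewrite ler_wpM2l.
rewrite mulr_sumr big_seq [leRHS]big_seq; apply: ler_sum => g gl.
have -> : 2 = expR (ln 2) :> R by rewrite lnK // posrE.
rewrite /weight -expRD ler_expR.
have gm : `|P g| <= m.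
  apply: (@le_trans _ _ (\sum_(x <- l) `|P x|)); last by rewrite /m lerDr.
  by rewrite (big_rem g gl) /= lerDl sumr_ge0.
have h1 : (s - del) * P g <= (s - del) * m.
  by apply: ler_wpM2l; [rewrite subr_ge0|exact: le_trans (ler_norm _) gm].
have h2 : (s - del) * m <= ln 2.
  rewrite -ler_pdivlMr // lerBlDl; apply: le_trans (ltW sdel) _.
  by rewrite lerD2l ge_min lexx orbT.
move: h1 h2; rewrite !mulrBl -[phi _]/(P g); move: (P g) => p; lra.
Qed.
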